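(* Let $\phi : M^2\to\mathbb{R}^4\equiv\mathbb{C}^2$ be a compact self-shrinker, i.e. an isometric immersion of a compact surface with $H=-\phi^\perp$. If $\phi$ is a Hamiltonian stationary Lagrangian embedding, then $M$ is the Clifford torus $\mathbb{S}^1\times\mathbb{S}^1$ (the product of two unit circles centered at the origin in $\mathbb{C}\times\mathbb{C}$).
   Context: $H=\operatorname{trace}\sigma$ is the (unnormalized) mean curvature vector, $\sigma$ the second fundamental form, $\phi^\perp$ the normal projection of the position vector. $\phi$ is Lagrangian if the Kähler form $\omega(\cdot,\cdot)=\langle J\cdot,\cdot\rangle$ of $\mathbb{C}^2$ ($J$ the standard complex structure) vanishes on $M$; then $JH$ is a tangent vector field on $M$, and a Lagrangian immersion is Hamiltonian stationary if $\operatorname{div}(JH)=0$ on $M$. The identification with the Clifford torus is up to a linear isometry of $\mathbb{R}^4$. *)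

(* Defs.v *)
From HB Require Import structures.
From mathcomp Require Import all_boot all_order all_algebra.
From mathcomp Require Import all_classical all_reals all_analysis.

Set Implicit Arguments.
Unset Strict Implicit.
Unset Printing Implicit Defensive.

Import Order.TTheory GRing.Theory Num.Theory.
Import numFieldNormedType.Exports.
Local Open Scope classical_set_scope.
Local Open Scope ring_scope.

Section Geometry.
Variable R : realType.

Notation V2 := 'rV[R]_2.
Notation V4 := 'rV[R]_4.

Definition dot (n : nat) (u v : 'rV[R]_n) : R := \sum_(i < n) u 0 i * v 0 i.

(* Standard complex structure J on R^4 = C^2, (x1+ix2, x3+ix4):
   J(x1,x2,x3,x4) = (-x2, x1, -x4, x3);  J u = u *m Jmat. *)
Definition Jmat : 'M[R]_4 :=
  \matrix_(i < 4, j < 4)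
    (if (val i == 0%N) && (val j == 1%N) then 1
     else if (val i == 1%N) && (val j == 0%N) then -1
     else if (val i == 2%N) && (val j == 3%N) then 1
     else if (val i == 3%N) && (val j == 2%N) then -1
     else 0).
Definition J (u : V4) : V4 := u *m Jmat.

Definition e2 (i : 'I_2) : V2 := delta_mx 0 i.

Definition pd (W : normedModType R) (i : 'I_2) (F : V2 -> W) : V2 -> W :=
  fun p => 'D_(e2 i) F p.

Fixpoint Ck (W : normedModType R) (k : nat) (U : set V2) (F : V2 -> W) : Prop :=
  match k with
  | 0%N => forall p, U p -> {for p, continuous F}
  | k'.+1 => (forall (i : 'I_2) p, U p -> derivable F p (e2 i)) /\
             (forall (i : 'I_2), Ck k' U (pd i F)) /\
             (forall p, U p -> {for p, continuous F})
  end.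

Definition smooth_on (W : normedModType R) (U : set V2) (F : V2 -> W) : Prop :=
  forall k, Ck k U F.

(* Local parametrization (chart) of an embedded surface S in R^4:
   smooth immersion of an open U of R^2 which is a homeomorphism onto an
   open piece S /\ W of S. *)
Definition local_param (S : set V4) (U : set V2) (X : V2 -> V4) : Prop :=
  open U /\ smooth_on U X /\
      (forall q, U q -> forall a b : R,
          a *: pd 0 X q + b *: pd 1 X q = 0 -> a = 0 /\ b = 0) /\
      (forall q1 q2, U q1 -> U q2 -> X q1 = X q2 -> q1 = q2) /\
      (exists W : set V4, open W /\ X @` U = S `&` W) /\
      (forall V : set V2, open V -> V `<=` U ->
          exists W : set V4, open W /\ X @` V = S `&` W).

Definition embedded_surface (S : set V4) : Prop :=
  forall p, S p -> exists (U : set V2) (X : V2 -> V4),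
    local_param S U X /\ (X @` U) p.

Definition gmet (X : V2 -> V4) (q : V2) (i j : 'I_2) : R :=
  dot (pd i X q) (pd j X q).
Definition detg (X : V2 -> V4) (q : V2) : R :=
  gmet X q 0 0 * gmet X q 1 1 - gmet X q 0 1 * gmet X q 1 0.
Definition ginv (X : V2 -> V4) (q : V2) (i j : 'I_2) : R :=
  (if i == j then gmet X q (1 - i) (1 - j) else - gmet X q i j) / detg X q.

Definition tanproj (X : V2 -> V4) (q : V2) (w : V4) : V4 :=
  \sum_(i < 2) \sum_(j < 2) (ginv X q i j * dot w (pd j X q)) *: pd i X q.
Definition nproj (X : V2 -> V4) (q : V2) (w : V4) : V4 := w - tanproj X q w.

Definition sff (X : V2 -> V4) (q : V2) (i j : 'I_2) : V4 :=
  nproj X q (pd i (pd j X) q).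
Definition Hvec (X : V2 -> V4) (q : V2) : V4 :=
  \sum_(i < 2) \sum_(j < 2) ginv X q i j *: sff X q i j.

Definition JHcoef (X : V2 -> V4) (i : 'I_2) (q : V2) : R :=
  \sum_(j < 2) ginv X q i j * dot (J (Hvec X q)) (pd j X q).

Definition divJH (X : V2 -> V4) (q : V2) : R :=
  (Num.sqrt (detg X q))^-1 *
  \sum_(i < 2) pd i (fun q' => Num.sqrt (detg X q') * JHcoef X i q') q.

Definition lagrangian (S : set V4) : Prop :=
  forall U X, local_param S U X -> forall q, U q ->
    forall i j : 'I_2, dot (J (pd i X q)) (pd j X q) = 0.

Definition hamiltonian_stationary (S : set V4) : Prop :=
  forall U X, local_param S U X -> forall q, U q -> divJH X q = 0.

Definition self_shrinker (S : set V4) : Prop :=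
  forall U X, local_param S U X -> forall q, U q ->
    Hvec X q = - nproj X q (X q).

Definition clifford_torus : set V4 :=
  [set x | x 0 (inord 0) ^+ 2 + x 0 (inord 1) ^+ 2 = 1 /\
           x 0 (inord 2) ^+ 2 + x 0 (inord 3) ^+ 2 = 1].

End Geometry.

(* Main.v *)
(* Let T be the tangential part of the position vector x and V = J (T - x) = J H.
   By the Lagrangian condition and the Codazzi symmetry, div (J H) = 0 forces
   <V, T> = 0; differentiating this relation determines the second fundamental form
   in the frame (V, N), N orthogonal to V, wherever H <> 0. A complex linear Hermitian
   operator P built from V and T is then locally constant there, and P x = J V / |V|^2.
   So the locus K where P takes the value P0 found at a farthest point p of S is open
   and closed in S; P0 is 1/|p|^2 on the complex line of p and 1 - 1/|p|^2 on its
   orthogonal complement. The vector fields |P0 x|^2 x - P0 x and J P0 x are tangent to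
   K, so K contains their integral curves starting on K (Nagumo), which is incompatible
   with the Lagrangian condition unless |p|^2 = 2. In that case T = 0 on K, a second
   operator built from V N^* + N V^* is locally constant up to sign, and the linear
   flows that it defines sweep out a product torus inside K that is open and closed in
   S. If S were larger, the rest of S would contain another such torus; but any two of
   them intersect, since the quadratic form that cuts out the first has trace zero on
   the second. *)

(* The model behind [P] is the family (y e^{i l1 t}, z e^{i l2 t}), y and z real, with l1 y^2 + l2
   z^2 = 1 and l1 + l2 = 1. These are Hamiltonian stationary Lagrangian self-shrinkers, and [P]
   recovers diag(l1, l2) from second order data at a single point. Some of them close up to compact
   immersed tori with l1 <> l2, so l1 = l2 has to come from embeddedness: S has only one tangent
   plane at each point, and tangency is therefore treated as a property of the point set. [P] is
   undefined where H = 0, and S is assumed neither connected nor oriented. Hence level sets of a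
   locally constant operator replace continuation, frames are fixed only up to sign, and closedness
   at zeros of H has to be proved separately, from |P x| = 1/|H|. No differential equation is
   solved: the integral curves are written with sin and cos, and only the invariance of a compact
   set along a given curve is needed. The field |P0 x|^2 x - P0 x vanishes at p, so the arcs issuing
   from p are obtained as limits of arcs through nearby points. *)
Require Import Defs.
From HB Require Import structures.
From mathcomp Require Import all_boot all_order all_algebra.
From mathcomp Require Import all_classical all_reals all_analysis.
From mathcomp Require Import ring lra.
Import Order.TTheory GRing.Theory Num.Theory.
Import numFieldNormedType.Exports.
Local Open Scope classical_set_scope.
Local Open Scope ring_scope.

Set Implicit Arguments.
Unset Strict Implicit.
Unset Printing Implicit Defensive.

(** * Dot product and complex structure of R^4 *)

Section LinearAlgebra.
Variable R : realType.
Implicit Types (u v x : 'rV[R]_4).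

Lemma dotC n (u v : 'rV[R]_n) : dot u v = dot v u.
Proof. by apply: eq_bigr => i _; rewrite mulrC. Qed.

Lemma dotDl n (u v x : 'rV[R]_n) : dot (u + v) x = dot u x + dot v x.
Proof. by rewrite -big_split; apply: eq_bigr => i _; rewrite mxE mulrDl. Qed.

Lemma dotZl n a (u x : 'rV[R]_n) : dot (a *: u) x = a * dot u x.
Proof. by rewrite mulr_sumr; apply: eq_bigr => i _; rewrite mxE mulrA. Qed.

Lemma dotDr n (u v x : 'rV[R]_n) : dot x (u + v) = dot x u + dot x v.
Proof. by rewrite !(dotC x) dotDl. Qed.

Lemma dotZr n a (u x : 'rV[R]_n) : dot x (a *: u) = a * dot x u.
Proof. by rewrite !(dotC x) dotZl. Qed.

Lemma dotNl n (u x : 'rV[R]_n) : dot (- u) x = - dot u x.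
Proof. by rewrite -scaleN1r dotZl mulN1r. Qed.

Lemma dotNr n (u x : 'rV[R]_n) : dot x (- u) = - dot x u.
Proof. by rewrite !(dotC x) dotNl. Qed.

Lemma dot0l n (x : 'rV[R]_n) : dot 0 x = 0.
Proof. by rewrite -(scale0r 0) dotZl mul0r. Qed.

Lemma dot0r n (x : 'rV[R]_n) : dot x 0 = 0.
Proof. by rewrite dotC dot0l. Qed.

Lemma dotBl n (u v x : 'rV[R]_n) : dot (u - v) x = dot u x - dot v x.
Proof. by rewrite dotDl dotNl. Qed.

Lemma dotBr n (u v x : 'rV[R]_n) : dot x (u - v) = dot x u - dot x v.
Proof. by rewrite dotDr dotNr. Qed.

Definition dotE := (dotDl, dotDr, dotZl, dotZr, dotNl, dotNr, dot0l, dot0r).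

Lemma dot_ge0 n (u : 'rV[R]_n) : 0 <= dot u u.
Proof. by apply: sumr_ge0 => i _; rewrite -expr2 sqr_ge0. Qed.

Lemma dot_eq0 n (u : 'rV[R]_n) : dot u u = 0 -> u = 0.
Proof.
move=> /eqP; rewrite psumr_eq0; last by move=> i _; rewrite -expr2 sqr_ge0.
move=> /allP h; apply/rowP => i; rewrite mxE; apply/eqP.
by have := h i (mem_index_enum i); rewrite /= mulf_eq0 orbb.
Qed.

Lemma dot_gt0 n (u : 'rV[R]_n) : u != 0 -> 0 < dot u u.
Proof.
by move=> u0; rewrite lt0r dot_ge0 andbT; apply: contra u0 => /eqP/dot_eq0 ->.
Qed.

Lemma dot_inj n (u v : 'rV[R]_n) : (forall y : 'rV[R]_n, dot u y = dot v y) -> u = v.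
Proof. by move=> h; apply/subr0_eq/dot_eq0; rewrite dotBl h subrr. Qed.

Lemma dot4E u v : dot u v = u 0 (inord 0) * v 0 (inord 0) +
  u 0 (inord 1) * v 0 (inord 1) + u 0 (inord 2) * v 0 (inord 2) +
  u 0 (inord 3) * v 0 (inord 3).
Proof.
rewrite /dot !big_ord_recl big_ord0 addr0 !addrA.
by do 3?[congr (_ + _)]; congr (_ * _); congr (fun_of_matrix _ _ _);
  apply: val_inj; rewrite /= inordK.
Qed.

Lemma row4P u v : u 0 (inord 0) = v 0 (inord 0) ->
  u 0 (inord 1) = v 0 (inord 1) -> u 0 (inord 2) = v 0 (inord 2) ->
  u 0 (inord 3) = v 0 (inord 3) -> u = v.
Proof.
move=> h0 h1 h2 h3; apply/rowP => i; rewrite -[i]inord_val.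
by case: i => -[|[|[|[|m]]]].
Qed.

Lemma JE u : [/\ J u 0 (inord 0) = - u 0 (inord 1),
  J u 0 (inord 1) = u 0 (inord 0), J u 0 (inord 2) = - u 0 (inord 3) &
  J u 0 (inord 3) = u 0 (inord 2)].
Proof.
have E (i : 'I_4) : J u 0 i = u 0 (inord 0) * Jmat R (inord 0) i +
    u 0 (inord 1) * Jmat R (inord 1) i + u 0 (inord 2) * Jmat R (inord 2) i +
    u 0 (inord 3) * Jmat R (inord 3) i.
  have := dot4E u (row i (Jmat R)^T); rewrite !mxE /dot => <-.
  by apply: eq_bigr => j _; rewrite !mxE.
by split; rewrite E !mxE /= !inordK //=; ring.
Qed.

Lemma JD u v : J (u + v) = J u + J v. Proof. exact: mulmxDl. Qed.
Lemma JN u : J (- u) = - J u. Proof. exact: mulNmx. Qed.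
Lemma JB u v : J (u - v) = J u - J v. Proof. exact: mulmxBl. Qed.
Lemma JZ a u : J (a *: u) = a *: J u. Proof. by rewrite /J scalemxAl. Qed.
Lemma J0 : J (0 : 'rV[R]_4) = 0. Proof. exact: mul0mx. Qed.

Lemma JJ u : J (J u) = - u.
Proof.
have [a b c d] := JE (J u); have [a' b' c' d'] := JE u.
by apply: row4P; rewrite ?(a, b, c, d) ?(a', b', c', d') [RHS]mxE ?opprK.
Qed.

Lemma dotJ u v : dot (J u) v = - dot u (J v).
Proof.
have [a b c d] := JE v; have [a' b' c' d'] := JE u.
by rewrite !dot4E a b c d a' b' c' d'; ring.
Qed.

Lemma dotJr u v : dot u (J v) = - dot (J u) v.
Proof. by rewrite dotJ opprK. Qed.

Lemma dotJJ u v : dot (J u) (J v) = dot u v.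
Proof. by rewrite dotJ JJ dotNr opprK. Qed.

Lemma dotJu u : dot (J u) u = 0.
Proof. by have := dotJ u u; rewrite (dotC u (J u)) => h; lra. Qed.

Lemma dotuJ u : dot u (J u) = 0.
Proof. by rewrite dotC dotJu. Qed.

(** The square matrix with rows [f i] has a right inverse, its transpose divided by w; a one-sided
    inverse of a square matrix is two-sided, which is the expansion. *)
Lemma orthogonal4_expand (f : 'I_4 -> 'rV[R]_4) w : w != 0 ->
  (forall i j, dot (f i) (f j) = w *+ (i == j)) ->
  forall x, x = \sum_i (dot x (f i) / w) *: f i.
Proof.
move=> w0 ff x; pose M := \matrix_i f i.
have MM : M *m (w^-1 *: M^T) = 1%:M.
  apply/matrixP => i j; rewrite !mxE -(mulVf w0) -mulrnAr -ff mulr_sumr.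
  by apply: eq_bigr => k _; rewrite !mxE; ring.
rewrite -{1}[x]mulmx1 -(mulmx1C MM) mulmxA mulmx_sum_row.
apply: eq_bigr => i _; rewrite rowK -scalemxAr !mxE mulrC; congr (_ / _ *: _).
by apply: eq_bigr => k _; rewrite !mxE.
Qed.

(** Equal length and orthogonality over C make V, N, J V, J N a real orthogonal basis. Most later
    identities are reduced to scalar ones in these four coordinates. *)
Lemma unitary_expand (V N : 'rV[R]_4) w : w != 0 -> dot V V = w ->
  dot N N = w -> dot V N = 0 -> dot V (J N) = 0 ->
  forall x, x = (dot x V / w) *: V + (dot x N / w) *: N +
    (dot x (J V) / w) *: J V + (dot x (J N) / w) *: J N.
Proof.
move=> w0 VV NN VN VJN x.
pose f (i : 'I_4) := nth 0 [:: V; N; J V; J N] i.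
suff /(orthogonal4_expand w0)/(_ x) : forall i j, dot (f i) (f j) = w *+ (i == j).
  by rewrite !big_ord_recl big_ord0 addr0 /f /= !addrA.
move=> i j; rewrite /f.
have NV : dot N V = 0 by rewrite dotC.
have JNV : dot (J N) V = 0 by rewrite dotC.
have NJV : dot N (J V) = 0 by rewrite dotJr JNV oppr0.
have JVN : dot (J V) N = 0 by rewrite dotJ VJN oppr0.
by case: i => -[|[|[|[|?]]]] //= ?; case: j => -[|[|[|[|?]]]] //= ?;
  rewrite ?dotJJ ?dotuJ ?dotJu ?VV ?NN ?VN ?NV ?NJV ?JVN ?VJN ?JNV ?mulr1n.
Qed.

Lemma unitary_dot (V N : 'rV[R]_4) w : w != 0 -> dot V V = w ->
  dot N N = w -> dot V N = 0 -> dot V (J N) = 0 ->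
  forall x y, dot x y = (dot x V * dot y V + dot x N * dot y N +
    dot x (J V) * dot y (J V) + dot x (J N) * dot y (J N)) / w.
Proof.
move=> w0 VV NN VN VJN x y.
rewrite {1}(unitary_expand w0 VV NN VN VJN x) !dotE.
by rewrite !(dotC _ y); field.
Qed.

End LinearAlgebra.

(** * Calculus on the plane *)

Section DerivationRules.
Variables (R : realType) (V : normedModType R).
Implicit Types (x v : V).

(** Together with [is_derive_restrict_line] this passes between a directional derivative and a
    derivative in one real variable, where the chain rule and the mean value theorem apply. *)
Lemma is_derive_line (W : normedModType R) (f : V -> W) x v t :
  derivable f (x + t *: v) v ->
  is_derive t 1 (fun s : R => f (x + s *: v)) ('D_v f (x + t *: v)).
Proof.
move=> df.
have E : (fun h : R => h^-1 *: (f (x + (h *: 1 + t) *: v) - f (x + t *: v))) =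
    (fun h : R => h^-1 *: ((f \o shift (x + t *: v)) (h *: v) - f (x + t *: v))).
  apply/funext => h /=; congr (_ *: (f _ - _)).
  by rewrite [h%:A]mulr1 scalerDl addrCA addrC.
by split; rewrite /derivable /derive /= E.
Qed.

Lemma is_derive_restrict_line (W : normedModType R) (f : V -> W) x v df :
  is_derive (0 : R) 1 (fun s : R => f (x + s *: v)) df -> is_derive x v f df.
Proof.
have E : (fun h : R => h^-1 *: (f (x + (h *: (1 : R) + 0) *: v) - f (x + (0 : R) *: v))) =
    (fun h : R => h^-1 *: ((f \o shift x) (h *: v) - f x)).
  apply/funext => h /=; rewrite scale0r !addr0; congr (_ *: (f _ - _)).
  by rewrite [h *: 1]mulr1 addrC.
by case=> + <-; rewrite /derivable /derive /= E => d; split.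
Qed.

Lemma is_derive_comp1 (g : R -> R) (f : V -> R) x v (df dg : R) :
  is_derive x v f df -> is_derive (f x) 1 g dg ->
  is_derive x v (fun y => g (f y)) (dg * df).
Proof.
move=> [d <-] dg'; apply: is_derive_restrict_line.
have d0 : derivable f (x + 0 *: v) v by rewrite scale0r addr0.
have := is_derive_line d0; rewrite scale0r addr0 => D.
have := @is_derive1_comp _ g (fun s : R => f (x + s *: v)) 0 dg ('D_v f x).
by rewrite scale0r addr0; apply.
Qed.

Lemma is_derive_translate (W : normedModType R) (f : V -> W) x u v df :
  is_derive (x + u) v f df -> is_derive x v (fun y => f (y + u)) df.
Proof.
have E : (fun h : R => h^-1 *: (f (h *: v + x + u) - f (x + u))) =
    (fun h : R => h^-1 *: ((f \o shift (x + u)) (h *: v) - f (x + u))).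
  by apply/funext => h /=; rewrite addrA.
by case=> d <-; split; rewrite /derivable /derive /= E.
Qed.

Lemma is_derive_mx m n (M : V -> 'M[R]_(m, n)) (dM : 'M[R]_(m, n)) x v :
  (forall i j, is_derive x v (fun y => M y i j) (dM i j)) -> is_derive x v M dM.
Proof.
move=> h; have d : derivable M x v.
  by apply/derivable_mxP => i j; have [] := h i j.
by split=> //; rewrite derive_mx//; apply/matrixP => i j; rewrite mxE; have [] := h i j.
Qed.

Lemma is_derive_coord m n (M : V -> 'M[R]_(m, n)) (dM : 'M[R]_(m, n)) x v i j :
  is_derive x v M dM -> is_derive x v (fun y => M y i j) (dM i j).
Proof.
case=> d <-; split; first by move/derivable_mxP : d.
by rewrite derive_mx// mxE.
Qed.

Lemma is_derive_suml n (h : 'I_n -> V -> R) x v dh :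
  (forall i, is_derive x v (h i) (dh i)) ->
  is_derive x v (fun y => \sum_i h i y) (\sum_i dh i).
Proof.
move=> H; rewrite (_ : (fun y => _) = \sum_i h i); first exact: is_derive_sum.
by apply/funext => y; rewrite fct_sumE.
Qed.

Lemma is_derive_addl (W : normedModType R) (f g : V -> W) x v df dg :
  is_derive x v f df -> is_derive x v g dg ->
  is_derive x v (fun y => f y + g y) (df + dg).
Proof. by move=> ? ?; exact: is_deriveD. Qed.

Lemma is_derive_oppl (W : normedModType R) (f : V -> W) x v df :
  is_derive x v f df -> is_derive x v (fun y => - f y) (- df).
Proof. by move=> ?; exact: is_deriveN. Qed.

Lemma is_derive_subl (W : normedModType R) (f g : V -> W) x v df dg :
  is_derive x v f df -> is_derive x v g dg ->
  is_derive x v (fun y => f y - g y) (df - dg).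
Proof. by move=> ? ?; exact: is_deriveB. Qed.

Lemma is_derive_eqR (f : V -> R) x v (df df' : R) :
  is_derive x v f df -> df = df' -> is_derive x v f df'.
Proof. by move=> ? <-. Qed.

Lemma is_derive_mull (f g : V -> R) x v (df dg : R) :
  is_derive x v f df -> is_derive x v g dg ->
  is_derive x v (fun y => f y * g y) (df * g x + f x * dg).
Proof.
move=> ? ?; apply: is_derive_eq (is_deriveM _ _) _ => //.
by rewrite addrC; congr (_ + _); rewrite /GRing.scale/= mulrC.
Qed.

Lemma is_derive_invl (f : V -> R) x v (df : R) : f x != 0 ->
  is_derive x v f df -> is_derive x v (fun y => (f y)^-1) (- df / f x ^+ 2).
Proof.
move=> f0 [d <-]; split; first exact: derivableV.
by rewrite deriveV// /GRing.scale/= -exprVn; ring.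
Qed.

Lemma is_derive_divl (f g : V -> R) x v (df dg : R) : g x != 0 ->
  is_derive x v f df -> is_derive x v g dg ->
  is_derive x v (fun y => f y / g y) ((df * g x - f x * dg) / g x ^+ 2).
Proof.
move=> g0 hf hg; apply: is_derive_eqR.
  exact: is_derive_mull hf (is_derive_invl g0 hg).
by rewrite /=; field.
Qed.

Lemma is_derive_dot n (f g : V -> 'rV[R]_n) x v (df dg : 'rV[R]_n) :
  is_derive x v f df -> is_derive x v g dg ->
  is_derive x v (fun y => dot (f y) (g y)) (dot df (g x) + dot (f x) dg).
Proof.
move=> hf hg; rewrite /dot -big_split; apply: is_derive_suml => i.
by apply: is_derive_mull; exact: is_derive_coord.
Qed.

Lemma is_derive_scalel m n (a : V -> R) (f : V -> 'M[R]_(m, n)) x v (da : R) (df : 'M[R]_(m, n)) :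
  is_derive x v a da -> is_derive x v f df ->
  is_derive x v (fun y => a y *: f y) (da *: f x + a x *: df).
Proof.
move=> ha hf; apply: is_derive_mx => i j; rewrite !mxE.
rewrite (_ : (fun y => _) = (fun y => a y * f y i j)).
  by apply: is_derive_mull => //; exact: is_derive_coord.
by apply/funext => y; rewrite mxE.
Qed.

Lemma is_derive_J (f : V -> 'rV[R]_4) x v (df : 'rV[R]_4) :
  is_derive x v f df -> is_derive x v (fun y => J (f y)) (J df).
Proof.
move=> hf; apply: is_derive_mx => i j; rewrite /J.
rewrite (_ : (fun y => _) = (fun y => \sum_k f y i k * Jmat R k j)); last first.
  by apply/funext => y; rewrite mxE.
rewrite mxE; apply: is_derive_suml => k.
apply: is_derive_eq; first by apply: is_derive_mull (is_derive_coord _ _ hf) (is_derive_cst _ _ _).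
by rewrite /cst mulr0 addr0.
Qed.


(** The form in which geometric identities are differentiated: an identity valid near x becomes a
    linear relation between derivatives at x. *)
Lemma is_derive_near0 (f : V -> R) x v (df : R) :
  (\forall y \near x, f y = 0) -> is_derive x v f df -> df = 0.
Proof.
move=> f0 /(near_eq_is_derive (g := cst 0) f0) [_ <-].
by rewrite derive_cst.
Qed.

End DerivationRules.

Section PlaneCalculus.
Variable R : realType.
Notation V2 := 'rV[R]_2.

Lemma near_all_ord (T : topologicalType) (a : T) n (P : 'I_n -> T -> Prop) :
  (forall i, \forall x \near a, P i x) -> \forall x \near a, forall i, P i x.
Proof. exact: filter_forall. Qed.

Lemma coord_norm n (u : 'rV[R]_n) i : `|u 0 i| <= `|u|.
Proof. by rewrite [leRHS]/Num.norm/= mx_normrE; exact: (le_bigmax _ _ (ord0, i)). Qed.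

Lemma norm_rV_le n (u : 'rV[R]_n) (e : R) : 0 <= e ->
  (forall i, `|u 0 i| <= e) -> `|u| <= e.
Proof.
move=> e0 h; rewrite [leLHS]/Num.norm/= mx_normrE; apply: bigmax_le => // -[i j] _ /=.
by rewrite (ord1 i).
Qed.

Lemma rV2E (h : V2) : h = h 0 0 *: e2 R 0 + h 0 1 *: e2 R 1.
Proof.
apply/rowP => i; rewrite !mxE /= ?eqxx /=.
case: i => -[|[|//]] Hi /=; rewrite ?mulr1 ?mulr0 ?addr0 ?add0r;
  by congr (h 0 _); apply: val_inj.
Qed.

Lemma e2E (i j : 'I_2) : e2 R i 0 j = (i == j)%:R.
Proof. by rewrite mxE eqxx /= eq_sym. Qed.

Lemma norm_e2 i : `|e2 R i| <= 1.
Proof. by apply: norm_rV_le => // j; rewrite e2E; case: eqP => _; rewrite ?normr1 ?normr0. Qed.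

(** The intermediate point is located only by its absolute value, so that both signs of h are
    covered and the bound feeds directly into ball estimates. *)
Lemma mvt_line (V : normedModType R) (f : V -> R) (p v : V) (h : R) :
  (forall t : R, `|t| <= `|h| -> derivable f (p + t *: v) v) ->
  exists2 c, `|c| <= `|h| & f (p + h *: v) - f p = h * 'D_v f (p + c *: v).
Proof.
move=> df; pose g t := f (p + t *: v).
have dg (t : R) : `|t| <= `|h| -> is_derive t 1 g ('D_v f (p + t *: v)).
  by move=> th; apply: is_derive_line; exact: df.
have cg (a b : R) : (forall t : R, t \in `[a, b] -> `|t| <= `|h|) -> {within `[a, b], continuous g}.
  move=> H; apply: derivable_within_continuous => t /H th.
  by have [] := dg t th.
have g0 : g 0 = f p by rewrite /g scale0r addr0.
have [h0|h0] := leP 0 h.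
  have H (t : R) : t \in `[0, h] -> `|t| <= `|h|.
    by rewrite in_itv /= => /andP[t0 th]; rewrite !ger0_norm.
  have dI (t : R) : t \in `]0, h[ -> is_derive t 1 g ('D_v f (p + t *: v)).
    by move=> tI; apply/dg/H; exact: subset_itv_oo_cc.
  have [c cI E] := MVT_segment h0 dI (cg _ _ H).
  by exists c; [exact: H|rewrite -g0 -/(g h) E subr0 mulrC].
have H (t : R) : t \in `[h, 0] -> `|t| <= `|h|.
  by rewrite in_itv /= => /andP[ht t0]; rewrite !ler0_norm// ?(ltW h0)// lerN2.
have dI (t : R) : t \in `]h, 0[ -> is_derive t 1 g ('D_v f (p + t *: v)).
  by move=> tI; apply/dg/H; exact: subset_itv_oo_cc.
have [c cI E] := MVT_segment (ltW h0) dI (cg _ _ H).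
exists c; [exact: H|]; rewrite -g0 -/(g h) -opprB E sub0r; ring.
Qed.

Lemma normr_comb2_le (x y u v n e : R) : `|x| <= n -> `|y| <= n ->
  `|u| <= e / 2 -> `|v| <= e / 2 -> `|- (x * u) - y * v| <= e * n.
Proof.
move=> xn yn ue ve; rewrite (le_trans (ler_normB _ _))// normrN !normrM.
have -> : e * n = n * (e / 2) + n * (e / 2) by field.
by apply: lerD; apply: ler_pM.
Qed.

Lemma expand_remainder_eq (A B C D0 D1 d0 d1 x y : R) :
  B - A = x * D0 -> C - B = y * D1 ->
  C - A - (x * d0 + y * d1) = - (x * (d0 - D0)) - y * (d1 - D1).
Proof. by move=> *; lra. Qed.

Lemma row_comb_coord n (A B C D : 'rV[R]_n) x y j :
  (A - B - (x *: C + y *: D)) 0 j = A 0 j - B 0 j - (x * C 0 j + y * D 0 j).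
Proof. by rewrite !mxE. Qed.

(** The step from a to a + h is split into two axis-parallel steps. The mean value theorem turns
    each into a partial derivative at a point near a, and continuity of the partials compares it
    with the value at a. *)
Lemma C1_expand (f : V2 -> R) (a : V2) :
  (\forall p \near a, forall i, derivable f p (e2 R i)) ->
  (forall i, {for a, continuous (pd i f)}) ->
  forall e : R, 0 < e -> \forall h \near (0 : V2),
  `|f (a + h) - f a - (h 0 0 * pd 0 f a + h 0 1 * pd 1 f a)| <= e * `|h|.
Proof.
move=> df cf e e0.
have e20 : 0 < e / 2 by rewrite divr_gt0.
have /nbhs_ballP[r /= r0 Hr] : \forall p \near a, (forall i, derivable f p (e2 R i)) /\
    forall i, `|pd i f a - pd i f p| <= e / 2.
  have A : \forall p \near a, forall i, `|pd i f a - pd i f p| <= e / 2.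
    apply: near_all_ord => i.
    by move/cvgrPdist_le : (cf i); apply.
  exact: filterI df A.
have {Hr}Hr p : `|p - a| < r -> (forall i, derivable f p (e2 R i)) /\
    forall i, `|pd i f a - pd i f p| <= e / 2.
  by move=> pa; apply: Hr; rewrite -ball_normE /= distrC.
apply/nbhs_ballP; exists (r / 2) => /=; first by rewrite divr_gt0.
move=> h; rewrite -ball_normE /= sub0r normrN => hr.
have hr' : `|h| < r by rewrite (lt_le_trans hr)// ler_pdivrMr// ler_peMr ?ler1n// ltW.
have h0 := coord_norm h 0; have h1 := coord_norm h 1.
have S c i : `|c| <= `|h| -> `|c *: e2 R i| <= `|h|.
  move=> ch; rewrite normrZ (le_trans _ ch)//.
  by rewrite -[leRHS]mulr1 ler_wpM2l ?norm_e2.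
have [|c0 c0h E0] := @mvt_line _ f a (e2 R 0) (h 0 0).
  move=> t th; apply: (Hr _ _).1; rewrite addrC addKr.
  exact: le_lt_trans (S t 0 (le_trans th h0)) hr'.
pose b := a + h 0 0 *: e2 R 0.
have bb t i : `|t| <= `|h| -> `|b + t *: e2 R i - a| < r.
  move=> th; rewrite /b addrC -(addrA a) addKr (le_lt_trans (ler_normD _ _))//.
  by rewrite (splitr r) ltrD//; [exact: le_lt_trans (S _ 0 h0) hr|exact: le_lt_trans (S _ i th) hr].
have [|c1 c1h E1] := @mvt_line _ f b (e2 R 1) (h 0 1).
  by move=> t th; apply: (Hr _ _).1; apply: bb; exact: le_trans th h1.
have -> : a + h = b + h 0 1 *: e2 R 1 by rewrite /b -addrA -rV2E.
rewrite (expand_remainder_eq _ _ E0 E1); apply: normr_comb2_le => //.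
  apply: (Hr _ _).2; rewrite addrC addKr.
  exact: le_lt_trans (S c0 0 (le_trans c0h h0)) hr'.
by apply: (Hr _ _).2; apply: bb; exact: le_trans c1h h1.
Qed.

Lemma pd_coord n (F : V2 -> 'rV[R]_n) (p : V2) (i : 'I_2) j :
  derivable F p (e2 R i) -> pd i F p 0 j = pd i (fun q => F q 0 j) p.
Proof. by move=> d; rewrite /pd derive_mx// mxE. Qed.

Lemma C1_expand_rV n (F : V2 -> 'rV[R]_n) (a : V2) :
  (\forall p \near a, forall i, derivable F p (e2 R i)) ->
  (forall i, {for a, continuous (pd i F)}) ->
  forall e : R, 0 < e -> \forall h \near (0 : V2),
  `|F (a + h) - F a - (h 0 0 *: pd 0 F a + h 0 1 *: pd 1 F a)| <= e * `|h|.
Proof.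
move=> dF cF e e0.
suff H : \forall h \near (0 : V2), forall j, `|F (a + h) 0 j - F a 0 j -
    (h 0 0 * pd 0 (fun q => F q 0 j) a + h 0 1 * pd 1 (fun q => F q 0 j) a)| <= e * `|h|.
  near=> h; apply: norm_rV_le => [|j]; first by rewrite mulr_ge0// ltW.
  have dFa := nbhs_singleton dF.
  have /(_ j) Hh : forall j, `|F (a + h) 0 j - F a 0 j -
    (h 0 0 * pd 0 (fun q => F q 0 j) a + h 0 1 * pd 1 (fun q => F q 0 j) a)| <= e * `|h|.
    by near: h; exact: H.
  rewrite -(pd_coord _ (dFa 0)) -(pd_coord _ (dFa 1)) in Hh.
  by apply: le_trans Hh; rewrite -row_comb_coord.
apply: near_all_ord => j; apply: C1_expand => //.
  by apply: filterS dF => p dp i; have /derivable_mxP := dp i; apply.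
move=> i.
have E : \forall p \near a, pd i F p 0 j = pd i (fun q => F q 0 j) p.
  by apply: filterS dF => p dp; exact: pd_coord.
change (pd i (fun q => F q 0 j) x @[x --> a] --> pd i (fun q => F q 0 j) a).
rewrite -(nbhs_singleton E).
apply: cvg_trans; first exact: (near_eq_cvg E).
by apply: (@continuous_comp _ _ _ (pd i F) (fun M : 'rV[R]_n => M 0 j)); [exact: cF|exact: coord_continuous].
Unshelve. all: by end_near. Qed.

Lemma pdP (W : normedModType R) (F : V2 -> W) (p : V2) (i : 'I_2) :
  derivable F p (e2 R i) -> is_derive p (e2 R i) F (pd i F p).
Proof. exact: derivableP. Qed.

Lemma pd_val (W : normedModType R) (F : V2 -> W) (p : V2) (i : 'I_2) df :
  is_derive p (e2 R i) F df -> pd i F p = df.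
Proof. by case. Qed.

(** Both mixed derivatives are approximated by one second difference of f over a square of side h:
    the mean value theorem, applied twice in either order, writes it as h^2 times a mixed derivative
    at a point close to a. *)
Lemma pd_comm_scalar (f : V2 -> R) (a : V2) :
  (\forall p \near a, forall i, derivable f p (e2 R i)) ->
  (\forall p \near a, forall i j, derivable (pd i f) p (e2 R j)) ->
  (forall i j, {for a, continuous (pd j (pd i f))}) ->
  pd 0 (pd 1 f) a = pd 1 (pd 0 f) a.
Proof.
move=> df ddf cf; apply/eqP; rewrite -subr_eq0 -normr_le0; apply/ler_addgt0Pl => e e0.
rewrite addr0.
have e20 : 0 < e / 2 by rewrite divr_gt0.
have /nbhs_ballP[r /= r0 Hr] : \forall p \near a, [/\ (forall i, derivable f p (e2 R i)),
    (forall i j, derivable (pd i f) p (e2 R j)) &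
    forall i j, `|pd j (pd i f) a - pd j (pd i f) p| <= e / 2].
  have A : \forall p \near a, forall i j, `|pd j (pd i f) a - pd j (pd i f) p| <= e / 2.
    apply: near_all_ord => i; apply: near_all_ord => j.
    by move/cvgrPdist_le : (cf i j); apply.
  by near=> p; split; [near: p; exact: df|near: p; exact: ddf|near: p; exact: A].
have {Hr}Hr p : `|p - a| < r -> [/\ (forall i, derivable f p (e2 R i)),
    (forall i j, derivable (pd i f) p (e2 R j)) &
    forall i j, `|pd j (pd i f) a - pd j (pd i f) p| <= e / 2].
  by move=> pa; apply: Hr; rewrite -ball_normE /= distrC.
(* Two steps of length at most h stay strictly inside the ball of radius r. *)
pose h := r / 3; have h0 : 0 < h by rewrite divr_gt0.
have S c i : `|c| <= `|h| -> `|c *: e2 R i| <= h.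
  move=> ch; rewrite normrZ -[leRHS]mulr1 ler_pM ?norm_e2//.
  by rewrite -[leRHS](gtr0_norm h0).
have in_ball c d i j : `|c| <= `|h| -> `|d| <= `|h| ->
    `|a + c *: e2 R i + d *: e2 R j - a| < r.
  move=> ch dh; rewrite addrC -(addrA a) addKr (le_lt_trans (ler_normD _ _))//.
  by have := S c i ch; have := S d j dh; rewrite /h; lra.
have second i j : exists c d, [/\ `|c| <= `|h|, `|d| <= `|h| &
    f (a + h *: e2 R i + h *: e2 R j) - f (a + h *: e2 R j) - f (a + h *: e2 R i) + f a =
    h * (h * pd j (pd i f) (a + c *: e2 R i + d *: e2 R j))].
  pose g p := f (p + h *: e2 R j) - f p.
  have hh : `|h| <= `|h| by [].
  have z0 : `|0 : R| <= `|h| by rewrite normr0.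
  have dg t : `|t| <= `|h| -> is_derive (a + t *: e2 R i) (e2 R i) g
      (pd i f (a + t *: e2 R i + h *: e2 R j) - pd i f (a + t *: e2 R i)).
    move=> th; apply: is_derive_subl.
      apply: is_derive_translate.
      have [d _ _] := Hr _ (in_ball t h i j th hh).
      exact: derivableP (d i).
    have [d _ _] := Hr _ (in_ball t 0 i j th z0).
    by apply: derivableP; move: (d i); rewrite scale0r addr0.
  have [t th|c ch E] := @mvt_line _ g a (e2 R i) h.
    by have [] := dg t th.
  have [t th|d dh E'] := @mvt_line _ (pd i f) (a + c *: e2 R i) (e2 R j) h.
    by have [_ D _] := Hr _ (in_ball c t i j ch th); exact: D.
  exists c, d; split=> //; rewrite -/(pd j _ _) in E' *; rewrite -E'.
  have [_ gE] := dg c ch; rewrite gE in E; rewrite -E /g; ring.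
have [c [d [ch dh E]]] := second 0 1.
have [c' [d' [ch' dh' E']]] := second 1 0.
have {E E'}Q : pd 1 (pd 0 f) (a + c *: e2 R 0 + d *: e2 R 1) =
    pd 0 (pd 1 f) (a + c' *: e2 R 1 + d' *: e2 R 0).
  have hn : h != 0 by rewrite gt_eqF.
  apply: (mulfI hn); apply: (mulfI hn).
  apply: etrans (esym E) _; apply: etrans _ E'.
  by rewrite (addrAC a); congr (_ + _); exact: addrAC.
have [_ _ /(_ 0 1) B1] := Hr _ (in_ball _ _ 0 1 ch dh).
have [_ _ /(_ 1 0) B2] := Hr _ (in_ball _ _ 1 0 ch' dh').
rewrite -Q in B2.
apply: le_trans (ler_distD (pd 1 (pd 0 f) (a + c *: e2 R 0 + d *: e2 R 1)) _ _) _.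
by rewrite (splitr e); apply: lerD; [exact: B2|rewrite distrC; exact: B1].
Unshelve. all: by end_near. Qed.

Lemma pd0_const (f : V2 -> R) (a : V2) (r : R) :
  (forall p, `|p - a| < r -> forall i, is_derive p (e2 R i) f 0) ->
  forall p, `|p - a| < r -> f p = f a.
Proof.
move=> df p pr; pose h := p - a; rewrite -/h in pr.
have h0 := coord_norm h 0; have h1 := coord_norm h 1.
have S c i : `|c| <= `|h| -> `|c *: e2 R i| <= `|h|.
  move=> ch; rewrite normrZ (le_trans _ ch)//.
  by rewrite -[leRHS]mulr1 ler_wpM2l ?norm_e2.
have [|c0 c0h E0] := @mvt_line _ f a (e2 R 0) (h 0 0).
  move=> t th; apply: ex_derive; apply: df; rewrite addrC addKr.
  exact: le_lt_trans (S t 0 (le_trans th h0)) pr.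
pose b := a + h 0 0 *: e2 R 0.
have bb t : `|t| <= `|h 0 1| -> `|b + t *: e2 R 1 - a| < r.
  move=> th; rewrite /b addrC -(addrA a) addKr (le_lt_trans _ pr)//.
  apply: norm_rV_le => // i; rewrite mxE [X in X + _]mxE [X in _ + X]mxE !e2E.
  case: i => -[|[|//]] Hi /=; rewrite ?mulr1 ?mulr0 ?addr0 ?add0r; first exact: h0.
  exact: le_trans th h1.
have [|c1 c1h E1] := @mvt_line _ f b (e2 R 1) (h 0 1).
  by move=> t th; apply: ex_derive; apply: df; exact: bb.
have Ep : p = b + h 0 1 *: e2 R 1.
  by rewrite /b -addrA -rV2E /h addrC subrK.
move: E1; rewrite -Ep; have [_ ->] := df _ (bb _ c1h) 1.
rewrite mulr0 => /subr0_eq ->.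
move: E0; rewrite -/b.
have [_ ->] : is_derive (a + c0 *: e2 R 0) (e2 R 0) f 0.
  apply: df; rewrite addrC addKr; exact: le_lt_trans (S c0 0 (le_trans c0h h0)) pr.
by rewrite mulr0 => /subr0_eq ->.
Qed.

End PlaneCalculus.

(** * The operator built from the tangential position and the mean curvature *)

Section Pointwise.
Variable R : realType.
Notation V4 := 'rV[R]_4.

Lemma sum2 (M : nmodType) (f : 'I_2 -> M) : \sum_i f i = f 0 + f 1.
Proof.
by rewrite !big_ord_recl big_ord0 addr0; congr (f _ + f _); apply: val_inj.
Qed.

(** The derivatives of V and T in the direction X0 = a V + b N. They encode that the cubic form
    C(X,Y,Z) = <second derivative along X and Y, J Z> has in the frame only the entries C(V,V,V) =
    -(w^2 + w^2 kap) and C(V,N,N) = w^2 kap, up to symmetry. *)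
Record frame_derivatives (X0 V N T Vk Tk : V4) (w tau kap a b : R) : Prop := FrameDerivatives {
  fd_VV : dot V V = w;
  fd_NN : dot N N = w;
  fd_VN : dot V N = 0;
  fd_VJN : dot V (J N) = 0;
  fd_T : T = tau *: N;
  fd_kap : kap = (1 - w) / (w * (1 + tau ^+ 2));
  fd_X : X0 = a *: V + b *: N;
  fd_VkV : dot Vk V = - (tau * b * (w ^+ 2 * kap));
  fd_VkN : dot Vk N = - (tau * a * (w ^+ 2 * kap));
  fd_VkJV : dot Vk (J V) = - (a * (w ^+ 2 + w ^+ 2 * kap));
  fd_VkJN : dot Vk (J N) = b * (w ^+ 2 * kap);
  fd_TkV : dot Tk V = a * w - a * (w ^+ 2 + w ^+ 2 * kap);
  fd_TkN : dot Tk N = b * w + b * (w ^+ 2 * kap);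
  fd_TkJV : dot Tk (J V) = tau * b * (w ^+ 2 * kap);
  fd_TkJN : dot Tk (J N) = tau * a * (w ^+ 2 * kap) }.

(* The operator -kap + (1+2kap)/w V V^* + kap/w (i V T^* - i T V^* ), complex
   linear for i = J and Hermitian, paired with y. *)
Definition Pform (V T x y : V4) : R :=
  let w := dot V V in let kap := (1 - w) / (w + dot T T) in
  - kap * dot x y + (1 + 2 * kap) / w *
    (dot V x * dot V y + dot (J V) x * dot (J V) y) +
  kap / w * (dot T x * dot (J V) y - dot (J T) x * dot V y
    - dot V x * dot (J T) y + dot (J V) x * dot T y).

(** All derivatives of V and T are known from [frame_derivatives]. Once every product with x and y
    is expanded in the basis V, N, J V, J N, the claim is a rational identity in w, tau, a, b and
    the eight coordinates of x and y. *)
Lemma Pform_derive (W : normedModType R) (V T : W -> V4) (q d : W) Vk Tk x y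
    (X0 N : V4) (w tau kap a b : R) :
  is_derive q d V Vk -> is_derive q d T Tk -> w != 0 ->
  frame_derivatives X0 (V q) N (T q) Vk Tk w tau kap a b ->
  is_derive q d (fun r => Pform (V r) (T r) x y) 0.
Proof.
move=> dV dT w0 [VV NN VN VJN TN kapE _ VkV VkN VkJV VkJN TkV TkN TkJV TkJN].
have t0 : 1 + tau ^+ 2 != 0 by rewrite gt_eqF// ltr_pwDl// sqr_ge0.
have cd (z : V4) := is_derive_cst z q d.
have TT : dot (T q) (T q) = tau ^+ 2 * w by rewrite TN !dotE NN; ring.
have s0 : dot (V q) (V q) + dot (T q) (T q) != 0.
  by rewrite VV TT (_ : _ + _ = w * (1 + tau ^+ 2)) ?mulf_neq0//; ring.
have w0' : dot (V q) (V q) != 0 by rewrite VV.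
have dJV := is_derive_J dV; have dJT := is_derive_J dT.
have dw := is_derive_dot dV dV.
have ds := is_derive_addl dw (is_derive_dot dT dT).
pose wf r := dot (V r) (V r); pose sf r := dot (V r) (V r) + dot (T r) (T r).
have dk := is_derive_divl (g := sf) (x := q) s0 (is_derive_subl (is_derive_cst (1 : R) q d) dw) ds.
have dVx := is_derive_dot dV (cd x); have dVy := is_derive_dot dV (cd y).
have dJVx := is_derive_dot dJV (cd x); have dJVy := is_derive_dot dJV (cd y).
have dTx := is_derive_dot dT (cd x); have dTy := is_derive_dot dT (cd y).
have dJTx := is_derive_dot dJT (cd x); have dJTy := is_derive_dot dJT (cd y).
have d1 := is_derive_mull (is_derive_oppl dk) (is_derive_cst (dot x y) q d).
have d2 := is_derive_mull (is_derive_divl (g := wf) (x := q) w0' (is_derive_addl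
   (is_derive_cst (1 : R) q d) (is_derive_mull (is_derive_cst (2 : R) q d) dk)) dw)
  (is_derive_addl (is_derive_mull dVx dVy) (is_derive_mull dJVx dJVy)).
have d3 := is_derive_mull (is_derive_divl (g := wf) (x := q) w0' dk dw)
  (is_derive_addl (is_derive_subl (is_derive_subl (is_derive_mull dTx dJVy)
    (is_derive_mull dJTx dVy)) (is_derive_mull dVx dJTy)) (is_derive_mull dJVx dTy)).
have D := is_derive_addl (is_derive_addl d1 d2) d3.
apply: (is_derive_eqR D).
rewrite /cst /=.
have NV : dot N (V q) = 0 by rewrite dotC.
have NJV : dot N (J (V q)) = 0 by rewrite dotJr dotC VJN oppr0.
have coords (z : V4) : exists z1 z2 z3 z4 : R, (forall u, dot u z = (dot u (V q) * z1 +
    dot u N * z2 + dot u (J (V q)) * z3 + dot u (J N) * z4) / w) /\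
    [/\ dot z (V q) = z1, dot z N = z2, dot z (J (V q)) = z3 & dot z (J N) = z4].
  exists (dot z (V q)), (dot z N), (dot z (J (V q))), (dot z (J N)); split=> // u.
  exact: unitary_dot w0 VV NN VN VJN u z.
have [x1 [x2 [x3 [x4 [xE [xV xN xJV xJN]]]]]] := coords x.
have [y1 [y2 [y3 [y4 [yE [yV yN yJV yJN]]]]]] := coords y.
rewrite /wf /sf /cst !dot0r !xE !yE xV xN xJV xJN !dotJ !JJ !dotNr (dotC (V q) Vk) (dotC (T q) Tk).
rewrite VkV VkN VkJV VkJN TkV TkN TkJV TkJN TN !dotE VV NN VN TkN NV NJV VJN !dotuJ.
rewrite kapE.
clear - w0 t0.
have s0' : w + tau * (tau * w) != 0.
  by rewrite (_ : _ + _ = w * (1 + tau ^+ 2)) ?mulf_neq0//; ring.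
have t0' : 1 + tau * tau != 0 by [].
by field; apply/and3P.
Qed.


(** The calculus is separated from the algebra here: the second derivatives enter only through the
    symmetries of the cubic form, its trace [so_tr] (the shrinker equation), and the derivative
    [so_dVT] of <V, T> = 0. *)
Record second_order_data (X : 'I_2 -> V4) (XX : 'I_2 -> 'I_2 -> V4)
    (V T : V4) (dV dT : 'I_2 -> V4) (v0 v1 E F G : R) : Prop := SecondOrderData {
  so_E : dot (X 0) (X 0) = E;
  so_F : dot (X 0) (X 1) = F;
  so_G : dot (X 1) (X 1) = G;
  so_lag : forall i j, dot (J (X i)) (X j) = 0;
  so_symm : forall i j l, dot (XX i j) (J (X l)) = dot (XX j i) (J (X l));
  so_symr : forall i j l, dot (XX i j) (J (X l)) = dot (XX i l) (J (X j));
  so_V : V = v0 *: X 0 + v1 *: X 1;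
  so_T : forall l, dot T (J (X l)) = 0;
  so_X : forall k, dT k + J (dV k) = X k;
  so_dT : forall k l, dot (dT k) (J (X l)) = dot (J T) (XX k l);
  so_dV : forall k l, dot (dV k) (J (X l)) = dot (J V) (XX k l);
  so_tr : forall m, G * dot (XX 0 0) (J (X m)) - F * dot (XX 0 1) (J (X m))
    - F * dot (XX 1 0) (J (X m)) + E * dot (XX 1 1) (J (X m)) =
    - (E * G - F ^+ 2) * dot V (X m);
  so_VT : dot V T = 0;
  so_dVT : forall k, dot (dV k) T + dot V (dT k) = 0 }.

(** The quarter turn of v0 X0 + v1 X1 in the plane of X0 and X1 with metric (E, F, G), when r is the
    area factor sqrt (E G - F^2). *)
Definition rotated (X0 X1 : V4) (v0 v1 E F G r : R) : V4 :=
  (- (F * v0 + G * v1) / r) *: X0 + ((E * v0 + F * v1) / r) *: X1.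

(** In the frame V, N the symmetric cubic form has four entries A = C(V,V,V), B = C(V,V,N), C =
    C(V,N,N), K = C(N,N,N). The trace gives A + C = - w^2 and B + K = 0; differentiating <V, T> = 0
    along V and N gives A + w = tau^2 C and B = tau^2 K. Since 1 + tau^2 > 0 these equations
    determine all four. The final clause records what the same form says about a derivative of N, as
    needed for [Lform]. *)
Lemma second_order_frame X XX V T dV dT v0 v1 E F G r :
  second_order_data X XX V T dV dT v0 v1 E F G ->
  r ^+ 2 = E * G - F ^+ 2 -> r != 0 -> V != 0 ->
  let N := rotated (X 0) (X 1) v0 v1 E F G r in let w := dot V V in
  exists tau kap, forall k, exists a b,
    frame_derivatives (X k) V N T (dV k) (dT k) w tau kap a b /\
    forall dN, (forall l, dot dN (J (X l)) = dot (J N) (XX k l)) ->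
      dot dN (J V) = b * (w ^+ 2 * kap) /\ dot dN (J N) = a * (w ^+ 2 * kap).
Proof.
move=> [gE gF gG lag symm symr VE TJ hX hT hV tr VT dVT] rD r0 Vn0.
move=> N w; rewrite {}/w.
have gF' : dot (X 1) (X 0) = F by rewrite dotC.
have lagr i j : dot (X i) (J (X j)) = 0 by rewrite dotJr lag oppr0.
set n0 := - (F * v0 + G * v1) / r; set n1 := (E * v0 + F * v1) / r.
have NE : N = n0 *: X 0 + n1 *: X 1 by [].
set w := dot V V.
have wE : w = E * v0 ^+ 2 + 2 * F * v0 * v1 + G * v1 ^+ 2.
  by rewrite /w VE !dotE gE gF gG gF'; ring.
have w0 : w != 0 by rewrite gt_eqF// dot_gt0.
pose D := E * G - F ^+ 2.
have D0 : D != 0 by rewrite /D -rD expf_neq0.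
(* Completeness of the frame: v_i v_j + n_i n_j is w times the inverse metric. It turns traces taken
   with the inverse metric into sums over V and N. *)
have n00 : v0 * v0 + n0 * n0 = w * G / D.
  by rewrite wE /n0 -!expr2 exprMn exprVn rD -/D /D; field.
have n01 : v0 * v1 + n0 * n1 = - w * F / D.
  rewrite wE /n0 /n1 [X in _ + X](_ : _ = - (F * v0 + G * v1) * (E * v0 + F * v1) / r ^+ 2).
    by rewrite rD -/D /D; field.
  by field.
have n11 : v1 * v1 + n1 * n1 = w * E / D.
  by rewrite wE /n1 -!expr2 exprMn exprVn rD -/D /D; field.
have VV : dot V V = w by [].
have NN : dot N N = w.
  have -> : dot N N =
    E * (v0 * v0 + n0 * n0) + 2 * F * (v0 * v1 + n0 * n1) + G * (v1 * v1 + n1 * n1) - w.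
    by rewrite NE !dotE gE gF gG gF' wE; ring.
  by rewrite n00 n01 n11 /D; field.
have VN : dot V N = 0.
  by rewrite NE VE !dotE gE gF gG gF' /n0 /n1; field.
have VJN : dot V (J N) = 0.
  by rewrite NE VE JD !JZ !dotE !lagr; ring.
have exp := unitary_expand w0 VV NN VN VJN.
have TJV : dot T (J V) = 0 by rewrite VE JD !JZ !dotE !TJ; ring.
have TJN : dot T (J N) = 0 by rewrite NE JD !JZ !dotE !TJ; ring.
pose tau := dot T N / w.
have TN : T = tau *: N.
  by rewrite {1}(exp T) (dotC T V) VT TJV TJN !mul0r !scale0r add0r !addr0.
pose c0 := dot (XX 0 0) (J (X 0)); pose c1 := dot (XX 0 0) (J (X 1)).
pose c2 := dot (XX 0 1) (J (X 1)); pose c3 := dot (XX 1 1) (J (X 1)).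
have c010 : dot (XX 0 1) (J (X 0)) = c1 by rewrite symr.
have c100 : dot (XX 1 0) (J (X 0)) = c1 by rewrite symm.
have c101 : dot (XX 1 0) (J (X 1)) = c2 by rewrite symm.
have c110 : dot (XX 1 1) (J (X 0)) = c2 by rewrite symr.
pose A := c0 * v0 * v0 * v0 + 3 * c1 * v0 * v0 * v1 + 3 * c2 * v0 * v1 * v1 + c3 * v1 * v1 * v1.
pose B := c0 * v0 * v0 * n0 + c1 * (v0 * v0 * n1 + 2 * v0 * v1 * n0) +
  c2 * (v1 * v1 * n0 + 2 * v0 * v1 * n1) + c3 * v1 * v1 * n1.
pose C := c0 * v0 * n0 * n0 + c1 * (n0 * n0 * v1 + 2 * n0 * n1 * v0) +
  c2 * (n1 * n1 * v0 + 2 * n0 * n1 * v1) + c3 * v1 * n1 * n1.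
pose K := c0 * n0 * n0 * n0 + 3 * c1 * n0 * n0 * n1 + 3 * c2 * n0 * n1 * n1 + c3 * n1 * n1 * n1.
have tr0 := tr 0; have tr1 := tr 1.
rewrite c010 c100 c110 -/c0 in tr0; rewrite c101 -/c1 -/c2 -/c3 in tr1.
have AC : A + C = - w ^+ 2.
  have -> : A + C = v0 * (c0 * (v0 * v0 + n0 * n0) + 2 * c1 * (v0 * v1 + n0 * n1) +
      c2 * (v1 * v1 + n1 * n1)) + v1 * (c1 * (v0 * v0 + n0 * n0) +
      2 * c2 * (v0 * v1 + n0 * n1) + c3 * (v1 * v1 + n1 * n1)) by rewrite /A /C; ring.
  rewrite n00 n01 n11.
  have -> : v0 * (c0 * (w * G / D) + 2 * c1 * (- w * F / D) + c2 * (w * E / D)) +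
    v1 * (c1 * (w * G / D) + 2 * c2 * (- w * F / D) + c3 * (w * E / D)) =
    w / D * (v0 * (G * c0 - F * c1 - F * c1 + E * c2) +
             v1 * (G * c1 - F * c2 - F * c2 + E * c3)) by field.
  rewrite tr0 tr1 -/D.
  have -> : v0 * (- D * dot V (X 0)) + v1 * (- D * dot V (X 1)) = - D * w.
    by rewrite -VV {4}VE dotDr !dotZr; ring.
  by field.
have BK : B + K = 0.
  have -> : B + K = n0 * (c0 * (v0 * v0 + n0 * n0) + 2 * c1 * (v0 * v1 + n0 * n1) +
      c2 * (v1 * v1 + n1 * n1)) + n1 * (c1 * (v0 * v0 + n0 * n0) +
      2 * c2 * (v0 * v1 + n0 * n1) + c3 * (v1 * v1 + n1 * n1)) by rewrite /B /K; ring.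
  rewrite n00 n01 n11.
  have -> : n0 * (c0 * (w * G / D) + 2 * c1 * (- w * F / D) + c2 * (w * E / D)) +
    n1 * (c1 * (w * G / D) + 2 * c2 * (- w * F / D) + c3 * (w * E / D)) =
    w / D * (n0 * (G * c0 - F * c1 - F * c1 + E * c2) +
             n1 * (G * c1 - F * c2 - F * c2 + E * c3)) by field.
  rewrite tr0 tr1 -/D.
  have -> : n0 * (- D * dot V (X 0)) + n1 * (- D * dot V (X 1)) = - D * dot V N.
    by rewrite NE dotDr !dotZr; ring.
  by rewrite VN; ring.
pose a k := dot (X k) V / w; pose b k := dot (X k) N / w.
have XE k : X k = a k *: V + b k *: N.
  have XJV : dot (X k) (J V) = 0 by rewrite VE JD !JZ !dotE !lagr; ring.
  have XJN : dot (X k) (J N) = 0 by rewrite NE JD !JZ !dotE !lagr; ring.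
  by rewrite {1}(exp (X k)) XJV XJN !mul0r !scale0r !addr0.
have aE k : a k * w = dot (X k) V by rewrite /a divfK.
have bE k : b k * w = dot (X k) N by rewrite /b divfK.
have ab00 : a 0 * v0 + b 0 * n0 = 1.
  rewrite /a /b VE NE !dotE gE gF.
  have -> : (v0 * E + v1 * F) / w * v0 + (n0 * E + n1 * F) / w * n0 =
    (E * (v0 * v0 + n0 * n0) + F * (v0 * v1 + n0 * n1)) / w by field.
  by rewrite n00 n01 /D; field; rewrite w0 -/D D0.
have ab01 : a 0 * v1 + b 0 * n1 = 0.
  rewrite /a /b VE NE !dotE gE gF.
  have -> : (v0 * E + v1 * F) / w * v1 + (n0 * E + n1 * F) / w * n1 =
    (E * (v0 * v1 + n0 * n1) + F * (v1 * v1 + n1 * n1)) / w by field.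
  by rewrite n01 n11 /D; field; rewrite w0 -/D D0.
have ab10 : a 1 * v0 + b 1 * n0 = 0.
  rewrite /a /b VE NE !dotE gF' gG.
  have -> : (v0 * F + v1 * G) / w * v0 + (n0 * F + n1 * G) / w * n0 =
    (F * (v0 * v0 + n0 * n0) + G * (v0 * v1 + n0 * n1)) / w by field.
  by rewrite n00 n01 /D; field; rewrite w0 -/D D0.
have ab11 : a 1 * v1 + b 1 * n1 = 1.
  rewrite /a /b VE NE !dotE gF' gG.
  have -> : (v0 * F + v1 * G) / w * v1 + (n0 * F + n1 * G) / w * n1 =
    (F * (v0 * v1 + n0 * n1) + G * (v1 * v1 + n1 * n1)) / w by field.
  by rewrite n01 n11 /D; field; rewrite w0 -/D D0.
(* [q k] is the cubic form evaluated on X k and on the tangent vectors with coordinates (x0, x1) and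
   (y0, y1). *)
pose q k (x0 x1 y0 y1 : R) := x0 * (y0 * dot (XX k 0) (J (X 0)) + y1 * dot (XX k 0) (J (X 1))) +
   x1 * (y0 * dot (XX k 1) (J (X 0)) + y1 * dot (XX k 1) (J (X 1))).
have qvv k : q k v0 v1 v0 v1 = a k * A + b k * B.
  have -> : a k * A + b k * B = (a k * v0 + b k * n0) * (c0 * v0 * v0 + 2 * c1 * v0 * v1 +
    c2 * v1 * v1) + (a k * v1 + b k * n1) * (c1 * v0 * v0 + 2 * c2 * v0 * v1 + c3 * v1 * v1).
    by rewrite /A /B; ring.
  case: k => -[|[|//]] Hk; [rewrite (_ : Ordinal Hk = 0) |rewrite (_ : Ordinal Hk = 1)];
    try exact: val_inj; rewrite /q ?c010 ?c100 ?c101 ?c110.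
  - by rewrite ab00 ab01 -/c0 -/c1 -/c2; ring.
  - by rewrite ab10 ab11 -/c3; ring.
have qvn k : q k v0 v1 n0 n1 = a k * B + b k * C.
  have -> : a k * B + b k * C = (a k * v0 + b k * n0) * (c0 * v0 * n0 + c1 * (v0 * n1 + v1 * n0) +
    c2 * v1 * n1) + (a k * v1 + b k * n1) * (c1 * v0 * n0 + c2 * (v0 * n1 + v1 * n0) + c3 * v1 * n1).
    by rewrite /B /C; ring.
  case: k => -[|[|//]] Hk; [rewrite (_ : Ordinal Hk = 0) |rewrite (_ : Ordinal Hk = 1)];
    try exact: val_inj; rewrite /q ?c010 ?c100 ?c101 ?c110.
  - by rewrite ab00 ab01 -/c0 -/c1 -/c2; ring.
  - by rewrite ab10 ab11 -/c3; ring.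
have qnn k : q k n0 n1 n0 n1 = a k * C + b k * K.
  have -> : a k * C + b k * K = (a k * v0 + b k * n0) * (c0 * n0 * n0 + 2 * c1 * n0 * n1 +
    c2 * n1 * n1) + (a k * v1 + b k * n1) * (c1 * n0 * n0 + 2 * c2 * n0 * n1 + c3 * n1 * n1).
    by rewrite /C /K; ring.
  case: k => -[|[|//]] Hk; [rewrite (_ : Ordinal Hk = 0) |rewrite (_ : Ordinal Hk = 1)];
    try exact: val_inj; rewrite /q ?c010 ?c100 ?c101 ?c110.
  - by rewrite ab00 ab01 -/c0 -/c1 -/c2; ring.
  - by rewrite ab10 ab11 -/c3; ring.
have dTJ k z0 z1 : dot (dT k) (J (z0 *: X 0 + z1 *: X 1)) = tau * q k z0 z1 n0 n1.
  rewrite JD !JZ dotDr !dotZr !hT TN NE !JZ JD !JZ !dotE /q.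
  by rewrite !(dotC (J _)); ring.
have dVJ k z0 z1 : dot (dV k) (J (z0 *: X 0 + z1 *: X 1)) = q k z0 z1 v0 v1.
  rewrite JD !JZ dotDr !dotZr !hV VE JD !JZ !dotE /q.
  by rewrite !(dotC (J _)); ring.
have dTt k Z : dot (dT k) Z = dot (X k) Z + dot (dV k) (J Z).
  by rewrite -hX dotDl dotJ; ring.
have dVt k Z : dot (dV k) Z = dot (X k) (J Z) - dot (dT k) (J Z).
  by rewrite -hX dotDl dotJJ; ring.
have XJ k z0 z1 : dot (X k) (J (z0 *: X 0 + z1 *: X 1)) = 0.
  by rewrite JD !JZ !dotE !lagr; ring.
have qs k : q k v0 v1 n0 n1 = q k n0 n1 v0 v1 by rewrite /q (symr k 0 1); ring.
have dVV k : dot (dV k) V = - (tau * (a k * B + b k * C)).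
  by rewrite dVt VE XJ dTJ qvn sub0r.
have dVN k : dot (dV k) N = - (tau * (a k * C + b k * K)).
  by rewrite dVt NE XJ dTJ qnn sub0r.
have dVJV k : dot (dV k) (J V) = a k * A + b k * B by rewrite {1}VE dVJ qvv.
have dVJN k : dot (dV k) (J N) = a k * B + b k * C by rewrite {1}NE dVJ -qs qvn.
have dTV k : dot (dT k) V = a k * w + (a k * A + b k * B) by rewrite dTt dVJV aE.
have dTN k : dot (dT k) N = b k * w + (a k * B + b k * C) by rewrite dTt dVJN bE.
have dTJV k : dot (dT k) (J V) = tau * (a k * B + b k * C) by rewrite {1}VE dTJ qvn.
have dTJN k : dot (dT k) (J N) = tau * (a k * C + b k * K) by rewrite {1}NE dTJ qnn.
have eqk k : tau * - (tau * (a k * C + b k * K)) + (a k * w + (a k * A + b k * B)) = 0.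
  by rewrite -(dVT k) (dotC V) dTV TN dotZr dVN.
have va : v0 * a 0 + v1 * a 1 = 1.
  apply: (mulIf w0); rewrite mul1r mulrDl -(mulrA v0) -(mulrA v1) !aE -!dotZl -dotDl -VE; exact: VV.
have na : n0 * a 0 + n1 * a 1 = 0.
  by apply: (mulIf w0); rewrite mul0r mulrDl -(mulrA n0) -(mulrA n1) !aE -!dotZl -dotDl -NE dotC.
have vb : v0 * b 0 + v1 * b 1 = 0.
  by apply: (mulIf w0); rewrite mul0r mulrDl -(mulrA v0) -(mulrA v1) !bE -!dotZl -dotDl -VE.
have nb : n0 * b 0 + n1 * b 1 = 1.
  by apply: (mulIf w0); rewrite mul1r mulrDl -(mulrA n0) -(mulrA n1) !bE -!dotZl -dotDl -NE.
(* The derivatives of <V, T> in the two coordinate directions are combined with weights v0, v1, and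
   below with n0, n1, into its derivatives along V and N. *)
have e1 : - tau ^+ 2 * C + w + A = 0.
  have : v0 * (tau * - (tau * (a 0 * C + b 0 * K)) + (a 0 * w + (a 0 * A + b 0 * B))) +
    v1 * (tau * - (tau * (a 1 * C + b 1 * K)) + (a 1 * w + (a 1 * A + b 1 * B))) = 0.
    by rewrite !eqk !mulr0 addr0.
  have -> : v0 * (tau * - (tau * (a 0 * C + b 0 * K)) + (a 0 * w + (a 0 * A + b 0 * B))) +
    v1 * (tau * - (tau * (a 1 * C + b 1 * K)) + (a 1 * w + (a 1 * A + b 1 * B))) =
    (v0 * a 0 + v1 * a 1) * (- tau ^+ 2 * C + w + A) + (v0 * b 0 + v1 * b 1) * (B - tau ^+ 2 * K) by ring.
  by rewrite va vb mul1r mul0r addr0.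
have e2' : - tau ^+ 2 * K + B = 0.
  have : n0 * (tau * - (tau * (a 0 * C + b 0 * K)) + (a 0 * w + (a 0 * A + b 0 * B))) +
    n1 * (tau * - (tau * (a 1 * C + b 1 * K)) + (a 1 * w + (a 1 * A + b 1 * B))) = 0.
    by rewrite !eqk !mulr0 addr0.
  have -> : n0 * (tau * - (tau * (a 0 * C + b 0 * K)) + (a 0 * w + (a 0 * A + b 0 * B))) +
    n1 * (tau * - (tau * (a 1 * C + b 1 * K)) + (a 1 * w + (a 1 * A + b 1 * B))) =
    (n0 * a 0 + n1 * a 1) * (- tau ^+ 2 * C + w + A) + (n0 * b 0 + n1 * b 1) * (- tau ^+ 2 * K + B) by ring.
  by rewrite na nb mul1r mul0r add0r.
have t0 : 1 + tau ^+ 2 != 0 by rewrite gt_eqF// ltr_pwDl// sqr_ge0.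
have K0 : K = 0.
  apply: (mulIf t0); rewrite mul0r.
  have -> : K * (1 + tau ^+ 2) = (B + K) - (- tau ^+ 2 * K + B) by ring.
  by rewrite BK e2' subrr.
have B0 : B = 0 by rewrite -BK K0 addr0.
pose kap := (1 - w) / (w * (1 + tau ^+ 2)).
have CE : C = w ^+ 2 * kap.
  apply: (mulIf t0).
  have -> : C * (1 + tau ^+ 2) = (A + C) - (- tau ^+ 2 * C + w + A) + w by ring.
  by rewrite AC e1 /kap; field; rewrite w0 t0.
have AE : A = - (w ^+ 2 + w ^+ 2 * kap) by rewrite -CE opprD -AC; ring.
exists tau, kap => k; exists (a k), (b k); split; last first.
  move=> dN dNX.
  have dNJ z0 z1 : dot dN (J (z0 *: X 0 + z1 *: X 1)) = q k z0 z1 n0 n1.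
    rewrite JD !JZ dotDr !dotZr !dNX NE JD !JZ !dotE /q.
    by rewrite !(dotC (J _)); ring.
  split; [rewrite {1}VE dNJ qvn B0 CE|rewrite {1}NE dNJ qnn K0 CE]; ring.
split=> //; rewrite ?dVV ?dVN ?dVJV ?dVJN ?dTV ?dTN ?dTJV ?dTJN ?B0 ?K0 ?CE ?AE; ring.
Qed.

End Pointwise.

(** * Tangential projection through the Gram matrix; Lagrangian planes *)

Section TangentProjection.
Variable R : realType.
Notation V4 := 'rV[R]_4.
Implicit Types (P : 'I_2 -> V4).

Lemma ord2_ind (Q : 'I_2 -> Prop) : Q 0 -> Q 1 -> forall i, Q i.
Proof.
by move=> Q0 Q1 [[|[|//]] Hi]; [rewrite (_ : Ordinal Hi = 0)|rewrite (_ : Ordinal Hi = 1)];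
  try exact: val_inj.
Qed.

Definition independent2 (u v : V4) := forall a b : R, a *: u + b *: v = 0 -> a = 0 /\ b = 0.

Lemma gram_gt0 (u v : V4) : independent2 u v ->
  0 < dot u u * dot v v - dot u v ^+ 2.
Proof.
move=> ind.
have u0 : u != 0.
  apply/eqP => u0; have [|] := ind 1 0; last by move/eqP; rewrite oner_eq0.
  by rewrite u0 scaler0 scale0r addr0.
have uu := dot_gt0 u0.
have : 0 < dot (dot u u *: v - dot u v *: u) (dot u u *: v - dot u v *: u).
  apply: dot_gt0; apply/eqP => h.
  have [|_ /eqP] := ind (- dot u v) (dot u u); last by rewrite gt_eqF.
  by rewrite scaleNr addrC.
have -> : dot (dot u u *: v - dot u v *: u) (dot u u *: v - dot u v *: u) =
   dot u u * (dot u u * dot v v - dot u v ^+ 2).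
  by rewrite !dotE (dotC v u); ring.
by rewrite pmulr_rgt0.
Qed.

(** Gram-Schmidt replaces v by a vector N orthogonal to u and rescaled to the length of u; the
    Lagrangian condition makes u, N orthogonal over C, and all four coordinates of z in the
    resulting basis vanish. *)
Lemma lagrangian_span (u v z : V4) : independent2 u v -> dot (J u) v = 0 ->
  dot z u = 0 -> dot z v = 0 -> dot z (J u) = 0 -> dot z (J v) = 0 -> z = 0.
Proof.
move=> ind uv zu zv zJu zJv.
have D0 := gram_gt0 ind; set D := _ - _ in D0.
have u0 : u != 0.
  apply/eqP => u0; have [|] := ind 1 0; last by move/eqP; rewrite oner_eq0.
  by rewrite u0 scaler0 scale0r addr0.
have uu := dot_gt0 u0.
pose r := Num.sqrt D; have rD : r ^+ 2 = D by rewrite sqr_sqrtr// ltW.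
have r0 : r != 0 by rewrite gt_eqF// sqrtr_gt0.
pose N := r^-1 *: (dot u u *: v - dot u v *: u).
have NN : dot N N = dot u u.
  have -> : dot N N = dot u u * D / r ^+ 2.
    by rewrite /N !dotE (dotC v u) /D; field.
  by rewrite rD mulfK// gt_eqF.
have uN : dot u N = 0 by rewrite /N !dotE; ring.
have uJN : dot u (J N) = 0.
  by rewrite /N JZ JB !JZ !dotE dotuJ (dotJr u v) uv; ring.
have w0 : dot u u != 0 by rewrite gt_eqF.
apply: dot_eq0; rewrite (unitary_dot w0 erefl NN uN uJN).
have zN : dot z N = 0 by rewrite /N !dotE zu zv; ring.
have zJN : dot z (J N) = 0 by rewrite /N JZ JB !JZ !dotE zJu zJv; ring.
by rewrite zu zJu zN zJN; ring.
Qed.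


Definition gramdet P := dot (P 0) (P 0) * dot (P 1) (P 1) - dot (P 0) (P 1) ^+ 2.

Definition gramcoef0 P w := (dot (P 1) (P 1) * dot w (P 0) - dot (P 0) (P 1) * dot w (P 1)) / gramdet P.

Definition gramcoef1 P w := (dot (P 0) (P 0) * dot w (P 1) - dot (P 0) (P 1) * dot w (P 0)) / gramdet P.

Definition gramproj P w := gramcoef0 P w *: P 0 + gramcoef1 P w *: P 1.

(* Working with an abstract P instead of [pd ^~ X q] keeps unification from
   comparing the partial derivatives pd 0 X q and pd 1 X q by unfolding limits. *)
Section Bridge.
Variables (X : 'rV[R]_2 -> V4) (q : 'rV[R]_2) (P : 'I_2 -> V4).
Hypothesis PE : P = fun i => pd i X q.

Lemma detg_gram : detg X q = gramdet P.
Proof.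
transitivity (dot (P 0) (P 0) * dot (P 1) (P 1) - dot (P 0) (P 1) * dot (P 1) (P 0)).
  by rewrite PE.
by rewrite (dotC (P 1) (P 0)).
Qed.

Lemma ginv_gram (i j : 'I_2) : ginv X q i j =
  (if i == j then dot (P (1 - i)) (P (1 - j)) else - dot (P i) (P j)) / gramdet P.
Proof. by rewrite -detg_gram PE. Qed.

Lemma ginv_gramE : [/\ ginv X q 0 0 = dot (P 1) (P 1) / gramdet P,
  ginv X q 0 1 = - dot (P 0) (P 1) / gramdet P,
  ginv X q 1 0 = - dot (P 0) (P 1) / gramdet P &
  ginv X q 1 1 = dot (P 0) (P 0) / gramdet P].
Proof. by split; rewrite ginv_gram /= ?subr0 ?subrr // (dotC (P 1)). Qed.

Lemma tanproj_gram w : tanproj X q w = gramproj P w.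
Proof.
have [g00 g01 g10 g11] := ginv_gramE.
transitivity (\sum_(i < 2) \sum_(j < 2) (ginv X q i j * dot w (P j)) *: P i).
  by rewrite PE.
move: (ginv X q) g00 g01 g10 g11 => gi g00 g01 g10 g11.
rewrite !sum2 g00 g01 g10 g11 -!scalerDl /gramproj.
by congr (_ *: _ + _ *: _); rewrite /gramcoef0 /gramcoef1; ring.
Qed.

Lemma JHcoef_gram (JH : V4) : JH = J (Hvec X q) ->
  JHcoef X 0 q = gramcoef0 P JH /\ JHcoef X 1 q = gramcoef1 P JH.
Proof.
move=> JHE; have [g00 g01 g10 g11] := ginv_gramE.
have E i : JHcoef X i q = \sum_(j < 2) ginv X q i j * dot JH (P j).
  by rewrite JHE PE.
move: (ginv X q) (JHcoef X ^~ q) g00 g01 g10 g11 E => gi jh g00 g01 g10 g11 E.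
by rewrite !E !sum2 g00 g01 g10 g11 /gramcoef0 /gramcoef1; split; ring.
Qed.

Lemma Hvec_gram (Q : 'I_2 -> 'I_2 -> V4) : Q = (fun i j => pd i (pd j X) q) ->
  Hvec X q = (gramdet P)^-1 *: (dot (P 1) (P 1) *: (Q 0 0 - gramproj P (Q 0 0)) -
    dot (P 0) (P 1) *: (Q 0 1 - gramproj P (Q 0 1)) -
    dot (P 0) (P 1) *: (Q 1 0 - gramproj P (Q 1 0)) +
    dot (P 0) (P 0) *: (Q 1 1 - gramproj P (Q 1 1))).
Proof.
move=> QE; have [g00 g01 g10 g11] := ginv_gramE.
transitivity (\sum_(i < 2) \sum_(j < 2) ginv X q i j *: (Q i j - tanproj X q (Q i j))).
  by rewrite QE.
move: (ginv X q) g00 g01 g10 g11 => gi g00 g01 g10 g11.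
rewrite !sum2 g00 g01 g10 g11 !tanproj_gram; move: (gramproj P) => pr.
by apply/rowP => m; rewrite !mxE; ring.
Qed.

End Bridge.

Lemma dot_gramproj P w (l : 'I_2) : gramdet P != 0 ->
  dot (gramproj P w) (P l) = dot w (P l).
Proof.
move=> D0; rewrite /gramproj !dotE /gramcoef0 /gramcoef1.
move: l; apply: ord2_ind; move: D0; rewrite /gramdet => D0.
  by rewrite (dotC (P 1) (P 0)); field.
by field.
Qed.

Lemma dot_gramproj_normal P w z : (forall l, dot (P l) z = 0) ->
  dot (gramproj P w) z = 0.
Proof. by move=> h; rewrite !dotE !h !mulr0 addr0. Qed.

(** A Lagrangian plane is its own complement for the Kähler form, so orthogonality to its image
    under J already puts w into the plane. *)
Lemma gramproj_id P w : independent2 (P 0) (P 1) ->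
  (forall i j, dot (J (P i)) (P j) = 0) ->
  (forall l, dot w (J (P l)) = 0) -> gramproj P w = w.
Proof.
move=> ind lag wJ; have D0 : gramdet P != 0 by rewrite gt_eqF// gram_gt0.
apply/subr0_eq; apply: (lagrangian_span ind (lag 0 1));
  rewrite dotBl ?dot_gramproj ?subrr// wJ subr0 dot_gramproj_normal//;
  by move=> l; rewrite dotJr lag oppr0.
Qed.

End TangentProjection.

Section Schwarz.
Variables (R : realType) (U : set 'rV[R]_2) (X : 'rV[R]_2 -> 'rV[R]_4).
Hypothesis Uo : open U.
Hypothesis Xsmooth : smooth_on U X.

Lemma smooth_derivable q i : U q -> is_derive q (e2 R i) X (pd i X q).
Proof. by move=> Uq; have [d _] := Xsmooth 1; exact: pdP (d i q Uq). Qed.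

Lemma smooth_derivable2 q i j : U q -> is_derive q (e2 R i) (pd j X) (pd i (pd j X) q).
Proof. by move=> Uq; have [_ [/(_ j) [d _] _]] := Xsmooth 2; exact: pdP (d i q Uq). Qed.

Lemma smooth_continuous q : U q -> {for q, continuous X}.
Proof. exact: (Xsmooth 0). Qed.

Lemma smooth_continuous1 q i : U q -> {for q, continuous (pd i X)}.
Proof. by have [_ [h _]] := Xsmooth 1; exact: h. Qed.

Lemma smooth_continuous2 q i j : U q -> {for q, continuous (pd i (pd j X))}.
Proof. by have [_ [/(_ j) [_ [h _]] _]] := Xsmooth 2; exact: h. Qed.

Lemma open_near q : U q -> \forall p \near q, U p.
Proof. by move=> Uq; apply: open_nbhs_nbhs. Qed.

Lemma smooth_schwarz01 q : U q -> pd 0 (pd 1 X) q = pd 1 (pd 0 X) q.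
Proof.
move=> Uq; apply/rowP => m.
pose f p := X p 0 m.
have f1 k p : U p -> pd k X p 0 m = pd k f p.
  by move=> Up; apply: pd_coord; have [d _] := smooth_derivable k Up; exact: d.
have f2 k l p : U p -> is_derive p (e2 R l) (pd k f) (pd l (pd k X) p 0 m).
  move=> Up; apply: (near_eq_is_derive (f := fun p => pd k X p 0 m)).
    by apply: filterS (open_near Up) => p' Up'; exact: f1.
  exact: is_derive_coord (smooth_derivable2 l k Up).
have f2E k l p : U p -> pd l (pd k f) p = pd l (pd k X) p 0 m.
  by move=> Up; apply: pd_val; exact: f2.
apply: etrans (esym (f2E 1 0 _ Uq)) _; apply: etrans _ (f2E 0 1 _ Uq).
apply: pd_comm_scalar.
- apply: filterS (open_near Uq) => p Up i'.
  by have [d _] := is_derive_coord 0 m (smooth_derivable i' Up); exact: d.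
- apply: filterS (open_near Uq) => p Up i' j'.
  by have [d _] := f2 i' j' _ Up; exact: d.
- move=> i' j'.
  change (pd j' (pd i' f) x @[x --> q] --> pd j' (pd i' f) q).
  rewrite f2E//.
  have E : \forall p \near q, pd j' (pd i' X) p 0 m = pd j' (pd i' f) p.
    by apply: filterS (open_near Uq) => p Up; rewrite f2E.
  apply: cvg_trans; first exact: (near_eq_cvg E).
  apply: (@continuous_comp _ _ _ (pd j' (pd i' X)) (fun M : 'rV[R]_4 => M 0 m));
    [exact: smooth_continuous2|exact: coord_continuous].
Qed.

Lemma smooth_schwarz q i j : U q -> pd i (pd j X) q = pd j (pd i X) q.
Proof.
move=> Uq; have H := smooth_schwarz01 Uq.
move: i; apply: ord2_ind; move: j; apply: ord2_ind.
- exact: erefl.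
- exact: H.
- exact: esym H.
- exact: erefl.
Qed.

End Schwarz.

Section TwistForm.
Variable R : realType.
Notation V4 := 'rV[R]_4.

(* The Hermitian operator (V N^* + N V^* )/2 paired with y. *)
Definition Lform (V N x y : V4) : R :=
  (dot V x * dot N y + dot N x * dot V y +
   dot (J V) x * dot (J N) y + dot (J N) x * dot (J V) y) / 2.

(** Here tau = 0 and kap = -1/2, so the data say V' = - J (a V + b N) and N' = - J (b V + a N).
    Inserted into the derivative of the operator V N^* + N V^* , the terms cancel in pairs. *)
Lemma Lform_derive (W : normedModType R) (V N : W -> V4) (q d : W) Vk Nk Tk x y
    (X0 T : V4) (tau kap a b : R) :
  is_derive q d V Vk -> is_derive q d N Nk -> T = 0 ->
  frame_derivatives X0 (V q) (N q) T Vk Tk 2 tau kap a b ->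
  dot Nk (V q) = - dot Vk (N q) -> dot Nk (N q) = 0 ->
  dot Nk (J (V q)) = b * (2 ^+ 2 * kap) -> dot Nk (J (N q)) = a * (2 ^+ 2 * kap) ->
  is_derive q d (fun r => Lform (V r) (N r) x y) 0.
Proof.
move=> dV dN T0 [VV NN VN VJN TN kapE _ VkV VkN VkJV VkJN _ _ _ _] NkV NkN NkJV NkJN.
have tau0 : tau = 0.
  have : dot T (N q) = tau * 2 by rewrite TN dotZl NN.
  by rewrite T0 dot0l => /esym/eqP; rewrite mulf_eq0 pnatr_eq0 orbF => /eqP.
have k2 : kap = - 2^-1 by rewrite kapE tau0; field.
have cd (z : V4) := is_derive_cst z q d.
have dJV := is_derive_J dV; have dJN := is_derive_J dN.
have dVx := is_derive_dot dV (cd x); have dVy := is_derive_dot dV (cd y).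
have dJVx := is_derive_dot dJV (cd x); have dJVy := is_derive_dot dJV (cd y).
have dNx := is_derive_dot dN (cd x); have dNy := is_derive_dot dN (cd y).
have dJNx := is_derive_dot dJN (cd x); have dJNy := is_derive_dot dJN (cd y).
have D := is_derive_mull (is_derive_addl (is_derive_addl (is_derive_addl
  (is_derive_mull dVx dNy) (is_derive_mull dNx dVy)) (is_derive_mull dJVx dJNy))
  (is_derive_mull dJNx dJVy)) (is_derive_cst (2^-1 : R) q d).
apply: (is_derive_eqR D).
have NV : dot (N q) (V q) = 0 by rewrite dotC.
have NJV : dot (N q) (J (V q)) = 0 by rewrite dotJr dotC VJN oppr0.
have n2 : (2 : R) != 0 by rewrite pnatr_eq0.
have exp u z := unitary_dot n2 VV NN VN VJN u z.
rewrite /cst !dot0r !(exp _ x) !(exp _ y) !dotJ !JJ !dotNr.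
rewrite VkV VkN VkJV VkJN NkV NkN NkJV NkJN VkN VV NN VN NV NJV VJN !dotuJ tau0 k2.
by move: (dot x _) (dot x _) (dot x _) (dot x _) => x1 x2 x3 x4; field.
Qed.

End TwistForm.

(** * Geometry in one chart: the relation <V, T> = 0 and the local constancy of both operators *)

Section ChartGeometry.
Variables (R : realType) (U : set 'rV[R]_2) (X : 'rV[R]_2 -> 'rV[R]_4)
  (dX : 'I_2 -> 'rV[R]_2 -> 'rV[R]_4) (ddX : 'I_2 -> 'I_2 -> 'rV[R]_2 -> 'rV[R]_4).
Notation V2 := 'rV[R]_2.
Notation V4 := 'rV[R]_4.

Definition posT (q : V2) := gramproj (dX ^~ q) (X q).
Definition posV q := J (posT q - X q).
Definition vcoef0 q := gramcoef0 (dX ^~ q) (posV q).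
Definition vcoef1 q := gramcoef1 (dX ^~ q) (posV q).

Hypothesis Uo : open U.
Hypothesis dXP : forall q i, U q -> is_derive q (e2 R i) X (dX i q).
Hypothesis ddXP : forall q i j, U q -> is_derive q (e2 R i) (dX j) (ddX i j q).
Hypothesis ddXC : forall q i j, U q -> ddX i j q = ddX j i q.
Hypothesis Ximm : forall q, U q -> independent2 (dX 0 q) (dX 1 q).
Hypothesis Xlag : forall q, U q -> forall i j, dot (J (dX i q)) (dX j q) = 0.
Hypothesis Xshrink : forall q, U q -> let P := dX ^~ q in let Q i j := ddX i j q in
  (gramdet P)^-1 *: (dot (P 1) (P 1) *: (Q 0 0 - gramproj P (Q 0 0)) -
    dot (P 0) (P 1) *: (Q 0 1 - gramproj P (Q 0 1)) -
    dot (P 0) (P 1) *: (Q 1 0 - gramproj P (Q 1 0)) +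
    dot (P 0) (P 0) *: (Q 1 1 - gramproj P (Q 1 1))) = posT q - X q.
Hypothesis Xdiv : forall q, U q -> forall d0 d1 : R,
  is_derive q (e2 R 0) (fun p => Num.sqrt (gramdet (dX ^~ p)) * vcoef0 p) d0 ->
  is_derive q (e2 R 1) (fun p => Num.sqrt (gramdet (dX ^~ p)) * vcoef1 p) d1 ->
  d0 + d1 = 0.

Lemma chart_det_gt0 q : U q -> 0 < gramdet (dX ^~ q).
Proof. by move=> Uq; apply: gram_gt0; exact: Ximm. Qed.

Lemma posT_normal q l : U q -> dot (posT q) (J (dX l q)) = 0.
Proof.
move=> Uq; rewrite /posT dot_gramproj_normal// => m.
by rewrite dotJr Xlag ?oppr0.
Qed.

Lemma posV_normal q l : U q -> dot (posV q) (J (dX l q)) = 0.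
Proof.
move=> Uq; rewrite dotJJ dotBl (dot_gramproj (P := dX ^~ q)) ?subrr//.
by rewrite gt_eqF// chart_det_gt0.
Qed.

Lemma posV_coef q : U q -> posV q = vcoef0 q *: dX 0 q + vcoef1 q *: dX 1 q.
Proof.
move=> Uq; rewrite -{1}(@gramproj_id _ (dX ^~ q) (posV q))//.
- exact: Ximm.
- exact: Xlag.
- by move=> l; exact: posV_normal.
Qed.

Lemma posTV q : posT q + J (posV q) = X q.
Proof. by rewrite /posV JJ opprB addrC subrK. Qed.

Lemma gramdet_derivable q i : U q ->
  is_derive q (e2 R i) (fun p => gramdet (dX ^~ p))
   (2 * (dot (ddX i 0 q) (dX 0 q) * dot (dX 1 q) (dX 1 q) +
    dot (dX 0 q) (dX 0 q) * dot (ddX i 1 q) (dX 1 q) -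
    dot (dX 0 q) (dX 1 q) * (dot (ddX i 0 q) (dX 1 q) + dot (dX 0 q) (ddX i 1 q)))).
Proof.
move=> Uq; have d0 := ddXP i 0 Uq; have d1 := ddXP i 1 Uq.
have d01 := is_derive_dot d0 d1.
apply: (is_derive_eqR (is_derive_subl (is_derive_mull (is_derive_dot d0 d0)
  (is_derive_dot d1 d1)) (is_derive_mull d01 d01))).
by rewrite (dotC (dX 0 q) (ddX i 0 q)) (dotC (dX 1 q) (ddX i 1 q)); ring.
Qed.

Lemma gramproj_derivable q i (W : V2 -> V4) : U q -> derivable W q (e2 R i) ->
  [/\ derivable (fun p => gramcoef0 (dX ^~ p) (W p)) q (e2 R i),
    derivable (fun p => gramcoef1 (dX ^~ p) (W p)) q (e2 R i) &
    derivable (fun p => gramproj (dX ^~ p) (W p)) q (e2 R i)].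
Proof.
move=> Uq /derivableP d.
have d0 := ddXP i 0 Uq; have d1 := ddXP i 1 Uq.
have D0 : gramdet (dX ^~ q) != 0 by rewrite gt_eqF// chart_det_gt0.
have dD := is_derive_invl (f := fun p => gramdet (dX ^~ p)) D0 (gramdet_derivable i Uq).
have dE := is_derive_dot d0 d0; have dF := is_derive_dot d0 d1.
have dG := is_derive_dot d1 d1.
have dw0 := is_derive_dot d d0; have dw1 := is_derive_dot d d1.
have c0 := is_derive_mull (is_derive_subl (is_derive_mull dG dw0) (is_derive_mull dF dw1)) dD.
have c1 := is_derive_mull (is_derive_subl (is_derive_mull dE dw1) (is_derive_mull dF dw0)) dD.
by split; [have [] := c0|have [] := c1|
  have [] := is_derive_addl (is_derive_scalel c0 d0) (is_derive_scalel c1 d1)].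
Qed.

Lemma posT_derivable q i : U q -> derivable posT q (e2 R i).
Proof.
move=> Uq; have [dd _] := dXP i Uq.
by have [] := gramproj_derivable Uq dd.
Qed.

Lemma posV_derivable q i : U q -> derivable posV q (e2 R i).
Proof.
move=> Uq; have /derivableP dt := posT_derivable (i := i) Uq.
by have [] := is_derive_J (is_derive_subl dt (dXP i Uq)).
Qed.

Lemma vcoef_derivable q i : U q ->
  derivable vcoef0 q (e2 R i) /\ derivable vcoef1 q (e2 R i).
Proof.
move=> Uq; have [h0 h1 _] := gramproj_derivable Uq (posV_derivable (i := i) Uq).
by split; [exact: h0|exact: h1].
Qed.

Lemma near_chart q : U q -> \forall p \near q, U p.
Proof. by move=> Uq; apply: open_nbhs_nbhs. Qed.

(** Two expressions for D = E G - F^2 times the divergence of v0 X_0 + v1 X_1: the metric trace of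
    its derivative, and sqrt D times the derivative of sqrt D v^i. The letters A, B, C stand for
    X_00, X_01, X_11 paired with X_0 and X_1. *)
Lemma div_identity (E F G A0 A1 B0 B1 C0 C1 v0 v1 v00 v01 v10 v11 : R) :
  G * (v00 * E + v0 * A0 + (v10 * F + v1 * B0)) -
  F * (v00 * F + v0 * A1 + (v10 * G + v1 * B1) + (v01 * E + v0 * B0 + (v11 * F + v1 * C0))) +
  E * (v01 * F + v0 * B1 + (v11 * G + v1 * C1)) =
  (A0 * G + E * B1 - F * (A1 + B0)) * v0 + (B0 * G + E * C1 - F * (B1 + C0)) * v1 +
  (E * G - F ^+ 2) * (v00 + v11).
Proof. by ring. Qed.

Section AtPoint.
Variables (q : V2) (Uq : U q) (dT dV : 'I_2 -> V4).
Hypothesis dTP : forall k, is_derive q (e2 R k) posT (dT k).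
Hypothesis dVP : forall k, is_derive q (e2 R k) posV (dV k).

Lemma dTV_sum k : dT k + J (dV k) = dX k q.
Proof.
have fE : (fun p => posT p + J (posV p)) = X by apply/funext; exact: posTV.
have := is_derive_addl (dTP k) (is_derive_J (dVP k)).
by rewrite fE => -[_ <-]; have [_ <-] := dXP k Uq.
Qed.

Lemma normal_derive (W : V2 -> V4) k l dW : is_derive q (e2 R k) W dW ->
  (forall p, U p -> dot (W p) (J (dX l p)) = 0) ->
  dot dW (J (dX l q)) = dot (J (W q)) (ddX k l q).
Proof.
move=> dWP W0; have := is_derive_near0 _ (is_derive_dot dWP (is_derive_J (ddXP k l Uq))).
rewrite dotJ => H; apply/eqP; rewrite -addr_eq0; apply/eqP; rewrite -[LHS]opprK.
rewrite H ?oppr0//.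
by apply: filterS (near_chart Uq) => p Up; exact: W0.
Qed.

(** Derivative of the Lagrangian condition. With the symmetry of second derivatives it makes the
    cubic form totally symmetric. *)
Lemma cubic_symr i j l :
  dot (ddX i j q) (J (dX l q)) = dot (ddX i l q) (J (dX j q)).
Proof.
have : dot (J (ddX i j q)) (dX l q) + dot (J (dX j q)) (ddX i l q) = 0.
  apply: is_derive_near0 (is_derive_dot (is_derive_J (ddXP i j Uq)) (ddXP i l Uq)).
  by apply: filterS (near_chart Uq) => p Up; exact: Xlag.
by rewrite dotJ (dotC (J _)) => /eqP; rewrite addrC subr_eq0 => /eqP.
Qed.

Lemma cubic_symm i j l :
  dot (ddX i j q) (J (dX l q)) = dot (ddX j i q) (J (dX l q)).
Proof. by rewrite ddXC. Qed.

Lemma dT_normal k l : dot (dT k) (J (dX l q)) = dot (J (posT q)) (ddX k l q).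
Proof. by apply: (normal_derive (dTP k)) => p Up; exact: posT_normal. Qed.

Lemma dV_normal k l : dot (dV k) (J (dX l q)) = dot (J (posV q)) (ddX k l q).
Proof. by apply: (normal_derive (dVP k)) => p Up; exact: posV_normal. Qed.

(** When J Z is normal, pairing the shrinker equation H = - J V with J Z removes the tangential
    projections hidden in H. *)
Lemma cubic_trace Z : (forall l, dot (dX l q) (J Z) = 0) ->
  dot (dX 1 q) (dX 1 q) * dot (ddX 0 0 q) (J Z) - dot (dX 0 q) (dX 1 q) * dot (ddX 0 1 q) (J Z)
  - dot (dX 0 q) (dX 1 q) * dot (ddX 1 0 q) (J Z) + dot (dX 0 q) (dX 0 q) * dot (ddX 1 1 q) (J Z) =
  - gramdet (dX ^~ q) * dot (posV q) Z.
Proof.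
move=> ZJ; have D0 : gramdet (dX ^~ q) != 0 by rewrite gt_eqF// chart_det_gt0.
have /(congr1 (fun u => dot u (J Z))) := Xshrink Uq.
have TE : posT q - X q = - J (posV q) by rewrite /posV JJ opprK.
rewrite /= TE dotNl dotJJ.
have pr w : dot (gramproj (dX ^~ q) w) (J Z) = 0 by exact: dot_gramproj_normal.
move: (gramproj (dX ^~ q)) pr => G pr.
rewrite !dotE !pr => /(congr1 (fun x => gramdet (dX ^~ q) * x)).
by rewrite mulVKf// => E; rewrite mulNr -mulrN -E; ring.
Qed.

Lemma div_trace : dot (dX 1 q) (dX 1 q) * dot (dV 0) (dX 0 q)
  - dot (dX 0 q) (dX 1 q) * (dot (dV 0) (dX 1 q) + dot (dV 1) (dX 0 q))
  + dot (dX 0 q) (dX 0 q) * dot (dV 1) (dX 1 q) = 0.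
Proof.
have D0 := chart_det_gt0 Uq; set D := gramdet _ in D0.
pose dv0 k := 'D_(e2 R k) vcoef0 q; pose dv1 k := 'D_(e2 R k) vcoef1 q.
have v0P k : is_derive q (e2 R k) vcoef0 (dv0 k).
  by apply: derivableP; have [] := vcoef_derivable k Uq.
have v1P k : is_derive q (e2 R k) vcoef1 (dv1 k).
  by apply: derivableP; have [] := vcoef_derivable k Uq.
have dVE k : dV k = dv0 k *: dX 0 q + vcoef0 q *: ddX k 0 q +
    (dv1 k *: dX 1 q + vcoef1 q *: ddX k 1 q).
  have [_ <-] := is_derive_addl (is_derive_scalel (v0P k) (ddXP k 0 Uq))
    (is_derive_scalel (v1P k) (ddXP k 1 Uq)).
  have [_ <-] := dVP k; apply: near_eq_derive.
  by apply: filterS (near_chart Uq) => p Up; exact: posV_coef.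
have dD k := gramdet_derivable k Uq.
have dr k := is_derive_comp1 (f := fun p => gramdet (dX ^~ p)) (dD k) (is_derive1_sqrt D0).
have := Xdiv Uq (is_derive_mull (dr 0) (v0P 0)) (is_derive_mull (dr 1) (v1P 1)).
rewrite /= -/D !dVE !dotE.
set r := Num.sqrt D; have rD : r ^+ 2 = D by rewrite sqr_sqrtr// ltW.
have r0 : r != 0 by rewrite gt_eqF// sqrtr_gt0.
move=> /(congr1 (fun x => r * x)); rewrite mulr0.
rewrite (ddXC 1 0 Uq) (dotC (dX 0 q) (ddX _ _ _)) (dotC (dX 0 q) (ddX _ _ _)).
move=> H; rewrite -[RHS]H.
rewrite (dotC (dX 1 q) (dX 0 q)).
have rE (A B C A' B' C' : R) : r * ((2 * r)^-1 * (2 * A) * B + r * C + ((2 * r)^-1 * (2 * A') * B' + r * C')) =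
  A * B + A' * B' + D * (C + C') by rewrite -rD; field.
by rewrite rE /D /gramdet; exact: div_identity.
Qed.

(** Because x = T + J V, the tangential part of dV is governed by T: <dV_k, X_l> = - C(X_k, X_l, T).
    The divergence of V is therefore minus the trace of C against T, and by [cubic_trace] that is
    <V, T>. *)
Lemma posVT_dot : dot (posV q) (posT q) = 0.
Proof.
have D0 : gramdet (dX ^~ q) != 0 by rewrite gt_eqF// chart_det_gt0.
have tan k l : dot (dV k) (dX l q) = - dot (ddX k l q) (J (posT q)).
  rewrite (dotC _ (J _)) -dT_normal -dotJJ -[J (dV k)](addKr (dT k)) dTV_sum.
  by rewrite dotDl dotNl (dotJr (dX k q)) Xlag// oppr0 addr0.
have TJ l : dot (dX l q) (J (posT q)) = 0 by rewrite dotJr dotC posT_normal// oppr0.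
have E := cubic_trace TJ.
have := div_trace; rewrite !tan => H.
apply: (mulfI D0); rewrite mulr0; apply: oppr_inj; rewrite -mulNr -E oppr0 -[RHS]oppr0 -H; ring.
Qed.

End AtPoint.

Lemma posVT q : U q -> dot (posV q) (posT q) = 0.
Proof.
move=> Uq; apply: (posVT_dot Uq (dT := fun k => 'D_(e2 R k) posT q) (dV := fun k => 'D_(e2 R k) posV q)) => k;
  apply: derivableP; [exact: posT_derivable|exact: posV_derivable].
Qed.

Lemma chart_second_order q dT dV : U q ->
  (forall k, is_derive q (e2 R k) posT (dT k)) ->
  (forall k, is_derive q (e2 R k) posV (dV k)) ->
  second_order_data (dX ^~ q) (fun i j => ddX i j q) (posV q) (posT q) dV dT
    (vcoef0 q) (vcoef1 q) (dot (dX 0 q) (dX 0 q)) (dot (dX 0 q) (dX 1 q)) (dot (dX 1 q) (dX 1 q)).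
Proof.
move=> Uq dTP dVP; split=> //.
- exact: Xlag.
- by move=> i j l; exact: cubic_symm.
- by move=> i j l; exact: cubic_symr.
- exact: posV_coef.
- by move=> l; exact: posT_normal.
- by move=> k; exact: dTV_sum.
- by move=> k l; exact: dT_normal.
- by move=> k l; exact: dV_normal.
- move=> m; apply: (cubic_trace Uq) => l.
  by rewrite dotJr Xlag ?oppr0.
- exact: posVT.
- move=> k; apply: is_derive_near0 (is_derive_dot (dVP k) (dTP k)).
  by apply: filterS (near_chart Uq) => p Up; exact: posVT.
Qed.

Definition posN q := rotated (dX 0 q) (dX 1 q) (vcoef0 q) (vcoef1 q)
  (dot (dX 0 q) (dX 0 q)) (dot (dX 0 q) (dX 1 q)) (dot (dX 1 q) (dX 1 q))
  (Num.sqrt (gramdet (dX ^~ q))).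

Lemma chart_frame q : U q -> posV q != 0 -> exists dT dV : 'I_2 -> V4,
  [/\ forall k, is_derive q (e2 R k) posT (dT k),
    forall k, is_derive q (e2 R k) posV (dV k) &
  let w := dot (posV q) (posV q) in
  exists tau kap, forall k, exists a b,
    frame_derivatives (dX k q) (posV q) (posN q) (posT q) (dV k) (dT k) w tau kap a b /\
    forall dN, (forall l, dot dN (J (dX l q)) = dot (J (posN q)) (ddX k l q)) ->
      dot dN (J (posV q)) = b * (w ^+ 2 * kap) /\
      dot dN (J (posN q)) = a * (w ^+ 2 * kap)].
Proof.
move=> Uq V0; have D0 := chart_det_gt0 Uq.
pose dT k := 'D_(e2 R k) posT q; pose dV k := 'D_(e2 R k) posV q.
have dTP k : is_derive q (e2 R k) posT (dT k) by apply: derivableP; exact: posT_derivable.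
have dVP k : is_derive q (e2 R k) posV (dV k) by apply: derivableP; exact: posV_derivable.
exists dT, dV; split=> //.
apply: (second_order_frame (chart_second_order Uq dTP dVP)) => //.
  by rewrite sqr_sqrtr// ltW.
by rewrite gt_eqF// sqrtr_gt0.
Qed.

Lemma chart_P_derive q (k : 'I_2) x y : U q -> posV q != 0 ->
  is_derive q (e2 R k) (fun p => Pform (posV p) (posT p) x y) 0.
Proof.
move=> Uq V0; have [dT [dV [dTP dVP [tau [kap /(_ k)[a [b [fr _]]]]]]]] := chart_frame Uq V0.
apply: (Pform_derive _ _ (dVP k) (dTP k) _ fr).
by rewrite gt_eqF// dot_gt0.
Qed.

Lemma posN_normal q l : U q -> dot (posN q) (J (dX l q)) = 0.
Proof.
move=> Uq; rewrite /posN /rotated dotDl !dotZl.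
by rewrite !(dotJr (dX _ q)) !Xlag// !oppr0 !mulr0 addr0.
Qed.

Lemma posN_derivable q i : U q -> derivable posN q (e2 R i).
Proof.
move=> Uq; have D0 := chart_det_gt0 Uq.
have [/derivableP c0 /derivableP c1] := vcoef_derivable i Uq.
have d0 := ddXP i 0 Uq; have d1 := ddXP i 1 Uq.
have dE := is_derive_dot d0 d0; have dF := is_derive_dot d0 d1.
have dG := is_derive_dot d1 d1.
have dr := is_derive_comp1 (f := fun p => gramdet (dX ^~ p))
  (gramdet_derivable i Uq) (is_derive1_sqrt D0).
have r0 : Num.sqrt (gramdet (dX ^~ q)) != 0 by rewrite gt_eqF// sqrtr_gt0.
have dri := is_derive_invl (f := fun p => Num.sqrt (gramdet (dX ^~ p))) r0 dr.
have n0 := is_derive_mull (is_derive_oppl (is_derive_addl (is_derive_mull dF c0)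
  (is_derive_mull dG c1))) dri.
have n1 := is_derive_mull (is_derive_addl (is_derive_mull dE c0) (is_derive_mull dF c1)) dri.
by have [] := is_derive_addl (is_derive_scalel n0 d0) (is_derive_scalel n1 d1).
Qed.

(** The components of dN along V and N come from <V, N> = 0 and |N|^2 = 2, valid near q; those along
    J V and J N come from the last clause of [second_order_frame]. *)
Lemma chart_L_derive q (k : 'I_2) x y : U q ->
  (\forall p \near q, posT p = 0 /\ dot (posV p) (posV p) = 2) ->
  is_derive q (e2 R k) (fun p => Lform (posV p) (posN p) x y) 0.
Proof.
move=> Uq near2; have [T0 w2] := nbhs_singleton near2.
have V0 : posV q != 0.
  by apply: contraPneq w2 => ->; rewrite dot0l => /eqP; rewrite eq_sym pnatr_eq0.
have [dT [dV [dTP dVP [tau [kap /(_ k)[a [b [fr dNE]]]]]]]] := chart_frame Uq V0.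
have dNP : is_derive q (e2 R k) posN ('D_(e2 R k) posN q).
  by apply: derivableP; exact: posN_derivable.
have [|NJV NJN] := dNE ('D_(e2 R k) posN q).
  by move=> l; apply: (normal_derive Uq dNP) => p; exact: posN_normal.
have near_frame : \forall p \near q, dot (posN p) (posN p) = 2 /\ dot (posV p) (posN p) = 0.
  near=> p; have Up : U p by near: p; exact: near_chart.
  have [_ w2p] : posT p = 0 /\ dot (posV p) (posV p) = 2 by near: p.
  have V0p : posV p != 0.
    by apply: contraPneq w2p => ->; rewrite dot0l => /eqP; rewrite eq_sym pnatr_eq0.
  have [_ [_ [_ _ [_ [_ /(_ 0)[_ [_ [[VV NN VN _ _ _ _ _ _ _ _ _ _ _ _] _]]]]]]]] := chart_frame Up V0p.
  by rewrite NN VN w2p.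
have NVk : dot ('D_(e2 R k) posN q) (posV q) = - dot (dV k) (posN q).
  apply/eqP; rewrite -addr_eq0 dotC addrC; apply/eqP.
  apply: is_derive_near0 (is_derive_dot (dVP k) dNP).
  by apply: filterS near_frame => p [].
have NNk : dot ('D_(e2 R k) posN q) (posN q) = 0.
  have : dot ('D_(e2 R k) posN q) (posN q) + dot (posN q) ('D_(e2 R k) posN q) - 0 = 0.
    apply: is_derive_near0 (is_derive_subl (is_derive_dot dNP dNP) (is_derive_cst (2 : R) _ _)).
    by apply: filterS near_frame => p [-> _]; rewrite /cst subrr.
  by rewrite (dotC (posN q)) => h; lra.
rewrite w2 in fr NJV NJN.
exact: Lform_derive (dVP k) dNP T0 fr NVk NNk NJV NJN.
Unshelve. all: by end_near. Qed.

End ChartGeometry.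

Section Norms.
Variable R : realType.

Lemma dot_norm_le (u v : 'rV[R]_4) : `|dot u v| <= 4 * `|u| * `|v|.
Proof.
rewrite /dot (le_trans (ler_norm_sum _ _ _))//.
apply: (@le_trans _ _ (\sum_(i < 4) `|u| * `|v|)).
  by apply: ler_sum => i _; rewrite normrM ler_pM ?coord_norm.
by rewrite sumr_const card_ord -mulrA [leRHS]mulr_natl.
Qed.

End Norms.

(** * The local data of S used from here on *)

Section Charts.
Variable R : realType.
Notation V2 := 'rV[R]_2.
Notation V4 := 'rV[R]_4.

(** [lagrangian], [self_shrinker] and [hamiltonian_stationary] quantify over all parametrizations of
    S, whereas this record passes at once to a relatively open subset; that is needed to treat the
    complement of a torus in S as a surface again. [cd_nbhd] is the embedding property: nearby
    points of S have nearby parameters. *)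
Record chart_data (S : set V4) (U : set V2) (X : V2 -> V4)
    (dX : 'I_2 -> V2 -> V4) (ddX : 'I_2 -> 'I_2 -> V2 -> V4) : Prop := ChartData {
  cd_open : open U;
  cd_dX : forall q i, U q -> is_derive q (e2 R i) X (dX i q);
  cd_ddX : forall q i j, U q -> is_derive q (e2 R i) (dX j) (ddX i j q);
  cd_ddXC : forall q i j, U q -> ddX i j q = ddX j i q;
  cd_imm : forall q, U q -> independent2 (dX 0 q) (dX 1 q);
  cd_lag : forall q, U q -> forall i j, dot (J (dX i q)) (dX j q) = 0;
  cd_shrink : forall q, U q -> let P := dX ^~ q in let Q i j := ddX i j q in
    (gramdet P)^-1 *: (dot (P 1) (P 1) *: (Q 0 0 - gramproj P (Q 0 0)) -
      dot (P 0) (P 1) *: (Q 0 1 - gramproj P (Q 0 1)) -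
      dot (P 0) (P 1) *: (Q 1 0 - gramproj P (Q 1 0)) +
      dot (P 0) (P 0) *: (Q 1 1 - gramproj P (Q 1 1))) = posT X dX q - X q;
  cd_div : forall q, U q -> forall d0 d1 : R,
    is_derive q (e2 R 0) (fun p => Num.sqrt (gramdet (dX ^~ p)) * vcoef0 X dX p) d0 ->
    is_derive q (e2 R 1) (fun p => Num.sqrt (gramdet (dX ^~ p)) * vcoef1 X dX p) d1 ->
    d0 + d1 = 0;
  cd_cont : forall q, U q -> {for q, continuous X};
  cd_contd : forall q i, U q -> {for q, continuous (dX i)};
  cd_mem : forall q, U q -> S (X q);
  cd_expand : forall q (e : R), U q -> 0 < e -> \forall h \near (0 : V2),
    `|X (q + h) - X q - (h 0 0 *: dX 0 q + h 0 1 *: dX 1 q)| <= e * `|h|;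
  cd_nbhd : forall q (d : R), U q -> 0 < d -> exists2 r : R, 0 < r &
    forall p, S p -> `|p - X q| < r -> exists2 b, U b /\ `|b - q| < d & p = X b }.

Lemma local_param_chart_data (S : set V4) (U : set V2) (X : V2 -> V4) :
  self_shrinker S -> lagrangian S -> hamiltonian_stationary S ->
  local_param S U X -> exists dX ddX, chart_data S U X dX ddX.
Proof.
move=> shr lag ham lp.
have [Uo [sX [ind [inj [[W0 [W0o XU]] home]]]]] := lp.
pose dX i := pd i X; pose ddX i j := pd i (pd j X).
have PE q : (dX ^~ q) = fun i => pd i X q by [].
have imm q : U q -> independent2 (dX 0 q) (dX 1 q) by exact: ind.
have Tpos q : posT X dX q = tanproj X q (X q) by rewrite (tanproj_gram (PE q)).
have hvec q : U q -> Hvec X q = posT X dX q - X q.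
  by move=> Uq; rewrite (shr U X lp q Uq) /nproj opprB Tpos.
have vpos q : U q -> posV X dX q = J (Hvec X q) by move=> Uq; rewrite hvec.
exists dX, ddX; split.
- exact: Uo.
- by move=> q i Uq; exact (smooth_derivable sX i Uq).
- by move=> q i j Uq; exact (smooth_derivable2 sX i j Uq).
- by move=> q i j Uq; exact (smooth_schwarz Uo sX i j Uq).
- exact: imm.
- by move=> q Uq i j; exact (lag U X lp q Uq i j).
- move=> q Uq P Q; rewrite -(hvec _ Uq); apply: esym.
  by apply: (Hvec_gram (PE q)).
- move=> q Uq d0 d1 h0 h1; have := ham U X lp q Uq.
  have D0 : 0 < detg X q by rewrite (detg_gram (PE q)); apply: gram_gt0; exact: imm.
  rewrite /divJH => /eqP; rewrite mulf_eq0 invr_eq0 gt_eqF ?sqrtr_gt0//= => /eqP.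
  rewrite sum2 => H; rewrite -[RHS]H; congr (_ + _); apply: esym; apply: pd_val.
    apply: near_eq_is_derive h0; apply: filterS (open_near Uo Uq) => p Up.
    rewrite (detg_gram (PE p)).
    by have [-> _] := JHcoef_gram (PE p) (vpos p Up).
  apply: near_eq_is_derive h1; apply: filterS (open_near Uo Uq) => p Up.
  rewrite (detg_gram (PE p)).
  by have [_ ->] := JHcoef_gram (PE p) (vpos p Up).
- by move=> q Uq; exact: smooth_continuous sX _ Uq.
- by move=> q i Uq; exact: smooth_continuous1 sX _ _ Uq.
- move=> q Uq; suff : (S `&` W0) (X q) by case.
  by rewrite -XU; exists q.
- move=> q e Uq e0; apply: C1_expand_rV e0.
    by apply: filterS (open_near Uo Uq) => p Up i; have [] := smooth_derivable sX i Up.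
  by move=> i; exact: smooth_continuous1 sX _ _ Uq.
- move=> q d Uq d0.
  have [||W [Wo XV]] := home (U `&` ball q d).
  + by apply: openI => //; exact: ball_open.
  + exact: subIsetl.
  have : (S `&` W) (X q).
    by rewrite -XV; exists q => //; split => //; exact: ballxx.
  case=> _ Wq.
  have /nbhs_ballP[r /= r0 Hr] : nbhs (X q) W by apply: open_nbhs_nbhs.
  exists r => // p Sp pr.
  have : (S `&` W) p.
    by split=> //; apply: Hr; rewrite -ball_normE /= distrC.
  rewrite -XV => -[b [Ub]]; rewrite -ball_normE /= => bq bp.
  by exists b => //; split=> //; rewrite distrC.
Qed.

End Charts.

(** * Tangent cones *)

Section Tangent.
Variable R : realType.
Notation V2 := 'rV[R]_2.
Notation V4 := 'rV[R]_4.

(* Bouligand tangent cone: it depends on S only, so no change of charts is ever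
   needed. *)
Definition tangent (S : set V4) (q v : V4) := forall e : R, 0 < e ->
  exists h q', [/\ 0 < h, h < e, S q' & `|q' - (q + h *: v)| <= e * h].

(** The version for every small h, of either sign, which the invariance argument consumes; [tangent]
    only asks for arbitrarily small positive h. On a charted set the two agree
    ([tangent_strong]). *)
Definition strong_tangent (S : set V4) (q v : V4) := forall e : R, 0 < e ->
  exists2 d, 0 < d & forall h, `|h| < d ->
  exists2 q', S q' & `|q' - (q + h *: v)| <= e * `|h|.

Lemma strong_tangentW S q v : strong_tangent S q v -> tangent S q v.
Proof.
move=> st e e0; have [d d0 H] := st e e0.
pose h := Num.min d e / 2.
have m0 : 0 < Num.min d e by rewrite lt_min d0.
have h0 : 0 < h by rewrite divr_gt0.
have hm : h < Num.min d e by rewrite /h ltr_pdivrMr// ltr_pMr// ltr1n.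
have [|q' Sq' Hq'] := H h.
  by rewrite gtr0_norm// (lt_le_trans hm)// ge_min lexx.
exists h, q'; split=> //; last by rewrite gtr0_norm in Hq'.
by rewrite (lt_le_trans hm)// ge_min lexx orbT.
Qed.

Variables (S : set V4) (U : set V2) (X : V2 -> V4)
    (dX : 'I_2 -> V2 -> V4) (ddX : 'I_2 -> 'I_2 -> V2 -> V4).
Hypothesis cd : chart_data S U X dX ddX.

Lemma chart_strong_tangent a (x y : R) : U a ->
  strong_tangent S (X a) (x *: dX 0 a + y *: dX 1 a).
Proof.
move=> Ua e e0; pose xi : V2 := x *: e2 R 0 + y *: e2 R 1.
have xi0 : xi 0 0 = x by rewrite !mxE /= mulr1 mulr0 addr0.
have xi1 : xi 0 1 = y by rewrite !mxE /= mulr1 mulr0 add0r.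
pose K := `|xi| + 1; have K0 : 0 < K by rewrite ltr_wpDl.
have eK : 0 < e / K by rewrite divr_gt0.
have /nbhs_ballP[r /= r0 Hr] := cd_expand cd Ua eK.
have /nbhs_ballP[s /= s0 Hs] : nbhs a U by apply: open_nbhs_nbhs; split=> //; exact: cd_open cd.
pose m := Num.min r s; have m0 : 0 < m by rewrite lt_min r0.
exists (m / K) => [|h]; first by rewrite divr_gt0.
rewrite ltr_pdivlMr// => hm.
have hxi : `|h *: xi| <= `|h| * K by rewrite normrZ ler_wpM2l// lerDl.
have hxim := le_lt_trans hxi hm.
exists (X (a + h *: xi)).
  apply: (cd_mem cd); apply: Hs; rewrite -ball_normE /= opprD addNKr normrN.
  by rewrite (lt_le_trans hxim)// ge_min lexx orbT.
have /Hr : ball (0 : V2) r (h *: xi).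
  by rewrite -ball_normE /= sub0r normrN (lt_le_trans hxim)// ge_min lexx.
rewrite /= [(h *: xi) 0 0]mxE [(h *: xi) 0 1]mxE xi0 xi1 -!scalerA -scalerDr.
rewrite opprD addrA => H; apply: le_trans H _.
by rewrite -mulrA ler_pM2l// mulrC ler_pdivrMr.
Qed.

(** Cramer's rule for the Gram matrix expresses x and y through the products of x u + y v with u and
    v. *)
Lemma independent2_coercive (u v : V4) : independent2 u v ->
  exists2 K : R, 0 < K & forall x y : R, Num.max `|x| `|y| <= K * `|x *: u + y *: v|.
Proof.
move=> ind; have D0 := gram_gt0 ind; set D := _ - _ in D0.
pose K := (`|dot v v| + `|dot u v| + `|dot u u|) * (4 * `|u| + 4 * `|v|) / D + 1.
have D0' : D != 0 by rewrite gt_eqF.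
have hn0 : 0 <= 4 * `|u| + 4 * `|v| by rewrite addr_ge0// mulr_ge0.
have K0 : 0 < K.
  by rewrite ltr_wpDl// divr_ge0 ?(ltW D0)// mulr_ge0// !addr_ge0.
exists K => // x y; set z := x *: u + y *: v.
have xE : x = (dot v v * dot z u - dot u v * dot z v) / D.
  by rewrite /z !dotE (dotC v u) /D; field.
have yE : y = (dot u u * dot z v - dot u v * dot z u) / D.
  by rewrite /z !dotE (dotC v u) /D; field.
have zu : `|dot z u| <= `|z| * (4 * `|u| + 4 * `|v|).
  rewrite (le_trans (dot_norm_le _ _))// mulrAC mulrC ler_wpM2l//.
  by rewrite lerDl mulr_ge0.
have zv : `|dot z v| <= `|z| * (4 * `|u| + 4 * `|v|).
  rewrite (le_trans (dot_norm_le _ _))// mulrAC mulrC ler_wpM2l//.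
  by rewrite lerDr mulr_ge0.
have aux (g1 g2 p1 p2 : R) : `|g1| + `|g2| <= `|dot v v| + `|dot u v| + `|dot u u| ->
   `|p1| <= `|z| * (4 * `|u| + 4 * `|v|) -> `|p2| <= `|z| * (4 * `|u| + 4 * `|v|) ->
   `|(g1 * p1 - g2 * p2) / D| <= K * `|z|.
  move=> gg h1 h2; rewrite normrM normfV (gtr0_norm D0).
  apply: (@le_trans _ _ ((`|g1| + `|g2|) * (`|z| * (4 * `|u| + 4 * `|v|)) / D)).
    rewrite ler_wpM2r ?invr_ge0 ?(ltW D0)// (le_trans (ler_normB _ _))// !normrM mulrDl.
    by rewrite lerD// ler_wpM2l.
  pose B := 4 * `|u| + 4 * `|v|; pose A := `|dot v v| + `|dot u v| + `|dot u u|.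
  have c0 : 0 <= B / D * `|z| by rewrite mulr_ge0// divr_ge0// ltW.
  apply: (@le_trans _ _ (A * (B / D * `|z|))).
    rewrite (_ : _ / D = (`|g1| + `|g2|) * (B / D * `|z|)); last by rewrite /B; ring.
    by rewrite ler_wpM2r.
  rewrite (_ : K * `|z| = A * (B / D * `|z|) + `|z|) ?lerDl//.
  by rewrite /K /A /B; ring.
rewrite ge_max; apply/andP; split.
  by rewrite xE; apply: aux => //; rewrite lerDl.
by rewrite yE; apply: aux => //; rewrite addrC lerD2r lerDr.
Qed.

Lemma rV2_norm_le (k : V2) : `|k| <= Num.max `|k 0 0| `|k 0 1|.
Proof.
apply: norm_rV_le => [|i]; first by rewrite le_max normr_ge0.
by move: i; apply: ord2_ind; rewrite le_max lexx ?orbT.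
Qed.

(** A point q' of S close to X a is X (a + k) with |k| <= M h by coercivity of the differential. To
    first order q' - X a lies in the span of the partials, which is orthogonal to J dX, so the
    component of h v along J dX is o(h). *)
Lemma chart_tangent_normal a v (l : 'I_2) : U a -> tangent S (X a) v ->
  dot v (J (dX l a)) = 0.
Proof.
move=> Ua tv; set n := J (dX l a).
have [K K0 HK] := independent2_coercive (cd_imm cd Ua).
pose M := 2 * K * (`|v| + 1).
have M0 : 0 <= M by rewrite !mulr_ge0 ?addr_ge0// ltW.
have Xn (k : V2) : dot (k 0 0 *: dX 0 a + k 0 1 *: dX 1 a) n = 0.
  by rewrite !dotE /n (dotJr (dX 0 a)) (dotJr (dX 1 a)) !(cd_lag cd Ua) oppr0 !mulr0 addr0.
apply/eqP; rewrite -normr_le0; apply/ler_addgt0Pl => e e0; rewrite addr0.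
pose c := 4 * `|n| * (1 + M) + 1.
have c0 : 0 < c by rewrite ltr_wpDl// mulr_ge0 ?addr_ge0// mulr_ge0.
(* The bound 1 / (2 K) lets the remainder eps K |k| be absorbed when |k| is estimated; e / c is what
   the final estimate requires. *)
pose eps := Num.min 1 (Num.min (1 / (2 * K)) (e / c)).
have eps0 : 0 < eps by rewrite !lt_min ltr01 !divr_gt0// mulr_gt0.
have eps1 : eps <= 1 by rewrite ge_min lexx.
have epsK : eps * (2 * K) <= 1.
  by rewrite -ler_pdivlMr ?mulr_gt0// !ge_min lexx orbT.
have epsc : eps * c <= e by rewrite -ler_pdivlMr// !ge_min lexx !orbT.
have /nbhs_ballP[d /= d0 Hd] := cd_expand cd Ua eps0.
have [r r0 Hr] := cd_nbhd cd Ua d0.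
pose e' := Num.min eps (r / (`|v| + 1)).
have v10 : 0 < `|v| + 1 by rewrite ltr_wpDl.
have e'0 : 0 < e' by rewrite lt_min eps0 divr_gt0.
have [h [q' [h0 he' Sq' Hq']]] := tv e' e'0.
have e'eps : e' <= eps by rewrite ge_min lexx.
have {}Hq' : `|q' - (X a + h *: v)| <= eps * h.
  by rewrite (le_trans Hq')// ler_wpM2r// ltW.
have qX : `|q' - X a| <= h * (`|v| + 1).
  rewrite (_ : q' - X a = (q' - (X a + h *: v)) + h *: v); last first.
    by rewrite opprD addrA subrK.
  rewrite (le_trans (ler_normD _ _))// normrZ (gtr0_norm h0) mulrDr addrC lerD2l mulr1.
  by rewrite (le_trans Hq')// ler_piMl// ltW.
have [|b [Ub bd] bq] := Hr q' Sq'.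
  rewrite (le_lt_trans qX)// -ltr_pdivlMr// (lt_le_trans he')//.
  by rewrite ge_min lexx orbT.
pose k := b - a; have kd : `|k| < d by [].
have := Hd k; rewrite /= /k (addrC a) subrK -bq -/k => /(_ _).
rewrite -ball_normE /= sub0r normrN => /(_ kd) Hk.
pose kX := k 0 0 *: dX 0 a + k 0 1 *: dX 1 a.
rewrite -/kX in Hk.
have kXle : `|k| <= K * `|kX|.
  exact: le_trans (rV2_norm_le k) (HK _ _).
have kXq : `|kX| <= `|q' - X a| + eps * `|k|.
  rewrite (_ : kX = (q' - X a) - (q' - X a - kX)); last by rewrite opprB addrC subrK.
  by rewrite (le_trans (ler_normB _ _))// lerD2l.
have kle : `|k| <= M * h.
  have h1 : K * `|kX| <= K * (`|q' - X a| + eps * `|k|) by rewrite ler_pM2l.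
  have h2 : K * `|q' - X a| <= K * (h * (`|v| + 1)) by rewrite ler_pM2l.
  have h3 : eps * (2 * K) * `|k| <= 1 * `|k| by rewrite ler_wpM2r.
  rewrite /M; clear - kXle h1 h2 h3; move: `|k| `|kX| `|q' - X a| `|v| kXle h1 h2 h3.
  by move=> x1 x2 x3 x4 *; lra.
have hvE (y z p hv : V4) : hv + 0 = p - y - z - (p - (y + hv)) + z.
  by apply/rowP => m; rewrite !mxE; ring.
have E : h * dot v n = dot (q' - X a - kX) n - dot (q' - (X a + h *: v)) n.
  rewrite -dotBl -dotZl -[RHS]addr0 -(Xn k) -dotDl; congr (dot _ n).
  rewrite -/kX -[LHS]addr0; apply: hvE.
have n4 : 0 <= 4 * `|n| by rewrite mulr_ge0.
have b1 : `|dot (q' - X a - kX) n| <= 4 * `|n| * (eps * (M * h)).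
  rewrite (le_trans (dot_norm_le _ _))// mulrAC ler_wpM2l//.
  by rewrite (le_trans Hk)// ler_pM2l.
have b2 : `|dot (q' - (X a + h *: v)) n| <= 4 * `|n| * (eps * h).
  by rewrite (le_trans (dot_norm_le _ _))// mulrAC ler_wpM2l.
have : `|h * dot v n| <= h * e.
  rewrite E (le_trans (ler_normB _ _))// (le_trans (lerD b1 b2))//.
  rewrite (_ : _ + _ = h * (eps * (4 * `|n| * (1 + M)))); last by ring.
  rewrite ler_pM2l// (le_trans _ epsc)// ler_pM2l// /c lerDl//.
by rewrite normrM (gtr0_norm h0) ler_pM2l.
Qed.

Lemma chart_tangentP a v : U a ->
  tangent S (X a) v <-> forall l, dot v (J (dX l a)) = 0.
Proof.
move=> Ua; split=> [tv l|vJ]; first exact: chart_tangent_normal.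
rewrite -(@gramproj_id _ (dX ^~ a) v (cd_imm cd Ua) (cd_lag cd Ua) vJ).
by apply: strong_tangentW; exact: chart_strong_tangent.
Qed.

Lemma chart_tangent_strong a v : U a -> tangent S (X a) v -> strong_tangent S (X a) v.
Proof.
move=> Ua tv; have vJ := (chart_tangentP v Ua).1 tv.
rewrite -(@gramproj_id _ (dX ^~ a) v (cd_imm cd Ua) (cd_lag cd Ua) vJ).
exact: chart_strong_tangent.
Qed.

End Tangent.

Section ContinuousDot.
Variables (R : realType) (T : topologicalType) (z : T).

Lemma cvg_dot4 (f g : T -> 'rV[R]_4) a b : f @ z --> a -> g @ z --> b ->
  dot (f x) (g x) @[x --> z] --> dot a b.
Proof.
move=> fa gb.
have fc i : f x 0 i @[x --> z] --> a 0 i.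
  exact: (cvg_comp f (fun M : 'rV[R]_4 => M 0 i) fa (@coord_continuous _ _ _ 0 i a)).
have gc i : g x 0 i @[x --> z] --> b 0 i.
  exact: (cvg_comp g (fun M : 'rV[R]_4 => M 0 i) gb (@coord_continuous _ _ _ 0 i b)).
rewrite (_ : (fun x => _) = (fun x => f x 0 (inord 0) * g x 0 (inord 0) +
  f x 0 (inord 1) * g x 0 (inord 1) + f x 0 (inord 2) * g x 0 (inord 2) +
  f x 0 (inord 3) * g x 0 (inord 3))); last by apply/funext => x; exact: dot4E.
rewrite dot4E.
exact: cvgD (cvgD (cvgD (cvgM (fc _) (gc _)) (cvgM (fc _) (gc _))) (cvgM (fc _) (gc _)))
  (cvgM (fc _) (gc _)).
Qed.

End ContinuousDot.

(** * The tangential part of the position vector, independently of charts *)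

Section TangentPart.
Variable R : realType.
Notation V2 := 'rV[R]_2.
Notation V4 := 'rV[R]_4.

(** Chart-free substitute for [posT]: it depends on the point set alone, so values computed in
    different charts can be compared. On a charted S it is unique, and T - q is the mean curvature
    vector. *)
Definition tangent_part (S : set V4) (q T : V4) :=
  tangent S q T /\ forall v, tangent S q v -> dot (q - T) v = 0.

Definition locally_charted (S : set V4) := forall q, S q ->
  exists U X dX ddX a, [/\ chart_data S U X dX ddX, U a & X a = q].

Section InChart.
Variables (S : set V4) (U : set V2) (X : V2 -> V4)
    (dX : 'I_2 -> V2 -> V4) (ddX : 'I_2 -> 'I_2 -> V2 -> V4).
Hypothesis cd : chart_data S U X dX ddX.

Lemma chart_span a v : U a -> tangent S (X a) v ->
  exists x y : R, v = x *: dX 0 a + y *: dX 1 a.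
Proof.
move=> Ua /(chart_tangentP cd _ Ua) vJ.
exists (gramcoef0 (dX ^~ a) v), (gramcoef1 (dX ^~ a) v).
exact: esym (gramproj_id (P := dX ^~ a) (cd_imm cd Ua) (cd_lag cd Ua) vJ).
Qed.

Lemma chart_tangent_part a : U a -> tangent_part S (X a) (posT X dX a).
Proof.
move=> Ua; split.
  by apply/(chart_tangentP cd _ Ua) => l; exact: (posT_normal X (cd_lag cd)).
move=> v /(chart_span Ua)[x [y ->]].
rewrite -{1}(posTV X dX a) addrC addKr.
rewrite dotDr !dotZr !(dotJ (posV _ _ _)) !(posV_normal X (cd_imm cd))//.
by rewrite oppr0 !mulr0 addr0.
Qed.

Lemma posT_continuous a : U a -> {for a, continuous (posT X dX)}.
Proof.
move=> Ua; have cX : X x @[x --> a] --> X a by exact (cd_cont cd Ua).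
have c0 : dX 0 x @[x --> a] --> dX 0 a by exact (@cd_contd _ _ _ _ _ _ cd a 0 Ua).
have c1 : dX 1 x @[x --> a] --> dX 1 a by exact (@cd_contd _ _ _ _ _ _ cd a 1 Ua).
have D0 : gramdet (dX ^~ a) != 0 by rewrite gt_eqF// (chart_det_gt0 (cd_imm cd)).
have cE := cvg_dot4 c0 c0; have cF := cvg_dot4 c0 c1; have cG := cvg_dot4 c1 c1.
have cD : gramdet (dX ^~ x) @[x --> a] --> gramdet (dX ^~ a).
  exact (cvgB (cvgM cE cG) (cvgM cF cF)).
have cDi : (gramdet (dX ^~ x))^-1 @[x --> a] --> (gramdet (dX ^~ a))^-1 by exact: cvgV D0 cD.
have cx0 := cvg_dot4 cX c0; have cx1 := cvg_dot4 cX c1.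
exact (cvgD (cvgZ (cvgM (cvgB (cvgM cG cx0) (cvgM cF cx1)) cDi) c0)
  (cvgZ (cvgM (cvgB (cvgM cE cx1) (cvgM cF cx0)) cDi) c1)).
Qed.

Lemma posV_sqr_continuous a : U a ->
  {for a, continuous (fun p => dot (posV X dX p) (posV X dX p))}.
Proof.
move=> Ua.
rewrite (_ : (fun p => _) = fun p => dot (posT X dX p - X p) (posT X dX p - X p)).
  have c : (posT X dX x - X x) @[x --> a] --> (posT X dX a - X a).
    exact (cvgB (posT_continuous Ua) (cd_cont cd Ua)).
  exact: (cvg_dot4 c c).
by apply/funext => p; rewrite dotJJ.
Qed.

End InChart.

Section Charted.
Variable S : set V4.
Hypothesis Sc : locally_charted S.

Lemma tangent_lin q u v (x y : R) : S q -> tangent S q u -> tangent S q v ->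
  tangent S q (x *: u + y *: v).
Proof.
move=> Sq; have [U [X [dX [ddX [a [cd Ua <-]]]]]] := Sc Sq.
move=> /(chart_tangentP cd _ Ua) hu /(chart_tangentP cd _ Ua) hv.
by apply/(chart_tangentP cd _ Ua) => l; rewrite dotDl !dotZl hu hv !mulr0 addr0.
Qed.

Lemma tangentZ q u (x : R) : S q -> tangent S q u -> tangent S q (x *: u).
Proof.
by move=> Sq tu; have := tangent_lin x 0 Sq tu tu; rewrite scale0r addr0.
Qed.

Lemma tangent_strong q v : S q -> tangent S q v -> strong_tangent S q v.
Proof.
move=> Sq; have [U [X [dX [ddX [a [cd Ua <-]]]]]] := Sc Sq.
exact: (chart_tangent_strong cd).
Qed.

Lemma tangent_lagrangian q u v : S q -> tangent S q u -> tangent S q v ->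
  dot u (J v) = 0.
Proof.
move=> Sq; have [U [X [dX [ddX [a [cd Ua <-]]]]]] := Sc Sq.
move=> /(chart_tangentP cd _ Ua) hu /(chart_span cd Ua)[x [y ->]].
by rewrite JD !JZ dotDr !dotZr !hu !mulr0 addr0.
Qed.

Lemma tangent_normal_complement q v : S q ->
  (forall u, tangent S q u -> dot v (J u) = 0) -> tangent S q v.
Proof.
move=> Sq; have [U [X [dX [ddX [a [cd Ua <-]]]]]] := Sc Sq => h.
apply/(chart_tangentP cd _ Ua) => l; apply: h.
apply/(chart_tangentP cd _ Ua) => m.
by rewrite dotJr (cd_lag cd Ua) oppr0.
Qed.

Lemma tangent_part_exists q : S q -> exists T, tangent_part S q T.
Proof.
move=> Sq; have [U [X [dX [ddX [a [cd Ua <-]]]]]] := Sc Sq.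
by exists (posT X dX a); exact (chart_tangent_part cd Ua).
Qed.

Lemma tangent_part_unique q T T' : S q -> tangent_part S q T ->
  tangent_part S q T' -> T = T'.
Proof.
move=> Sq [tT nT] [tT' nT']; apply/subr0_eq/dot_eq0.
have tt : tangent S q (T - T').
  by rewrite -(scale1r T) -scaleN1r; exact: tangent_lin.
have E : T - T' = (q - T') - (q - T) by apply/rowP => m; rewrite !mxE; ring.
by rewrite {1}E dotBl nT// nT'// subr0.
Qed.

Lemma tangent_part_VT q T : S q -> tangent_part S q T -> dot (J (T - q)) T = 0.
Proof.
move=> Sq; have [U [X [dX [ddX [a [cd Ua Eq]]]]]] := Sc Sq.
have := chart_tangent_part cd Ua; rewrite Eq => tp /(tangent_part_unique Sq tp) <-.
rewrite -Eq; exact: (posVT (cd_open cd) (cd_dX cd) (cd_ddX cd) (cd_ddXC cd) (cd_imm cd)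
  (cd_lag cd) (cd_shrink cd) (cd_div cd) Ua).
Qed.

Lemma tangent_part_V q T : S q -> tangent_part S q T -> tangent S q (J (T - q)).
Proof.
move=> Sq [tT nT]; apply: tangent_normal_complement => // u tu.
by rewrite dotJJ -opprB dotNl nT// oppr0.
Qed.

(** Unlike the local constancy of P, this also covers points with H = 0; it is what closes the level
    set there. *)
Lemma tangent_part_w_continuous q T e : S q -> tangent_part S q T -> 0 < e ->
  exists2 r : R, 0 < r & forall p T', S p -> `|p - q| < r -> tangent_part S p T' ->
    `|dot (J (T - q)) (J (T - q)) - dot (J (T' - p)) (J (T' - p))| < e.
Proof.
move=> Sq tp e0; have [U [X [dX [ddX [a [cd Ua Eq]]]]]] := Sc Sq.
have /cvgrPdist_lt/(_ _ e0)/nbhs_ballP[d /= d0 Hd] := posV_sqr_continuous cd Ua.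
have [r r0 Hr] := cd_nbhd cd Ua d0; exists r => // p T' Sp pr tp'.
rewrite -Eq in pr; have [b [Ub bd] bp] := Hr p Sp pr.
have := chart_tangent_part cd Ua; rewrite Eq => /(tangent_part_unique Sq tp) ->.
have := chart_tangent_part cd Ub; rewrite -bp => /(tangent_part_unique Sp tp') ->.
by rewrite -Eq bp; apply: Hd; rewrite -ball_normE /= distrC.
Qed.

(** By continuity |V|^2 stays positive on a parameter ball, where all partial derivatives of [Pform]
    vanish; [cd_nbhd] turns that ball into a neighbourhood in S. *)
Lemma P_locally_constant q T : S q -> tangent_part S q T -> T != q ->
  exists2 r : R, 0 < r & forall p T', S p -> `|p - q| < r -> tangent_part S p T' ->
    T' != p /\ forall x y, Pform (J (T' - p)) T' x y = Pform (J (T - q)) T x y.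
Proof.
move=> Sq tp Tq; have [U [X [dX [ddX [a [cd Ua Eq]]]]]] := Sc Sq.
have TE : T = posT X dX a.
  by have := chart_tangent_part cd Ua; rewrite Eq => tp'; exact: (tangent_part_unique Sq tp tp').
have w0 : 0 < dot (posV X dX a) (posV X dX a).
  by rewrite dotJJ; apply: dot_gt0; rewrite subr_eq0 -TE Eq.
have /cvgrPdist_lt/(_ _ w0)/nbhs_ballP[d1 /= d10 Hd1] := posV_sqr_continuous cd Ua.
have /nbhs_ballP[d2 /= d20 Hd2] : nbhs a U.
  by apply: open_nbhs_nbhs; split=> //; exact: cd_open cd.
pose d := Num.min d1 d2; have d0 : 0 < d by rewrite lt_min d10.
have HU p : `|p - a| < d -> U p /\ posV X dX p != 0.
  rewrite distrC lt_min => /andP[h1 h2]; split.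
    by apply: Hd2; rewrite -ball_normE.
  have := Hd1 p; rewrite -ball_normE => /(_ h1); apply: contraTneq => ->.
  by rewrite dot0l subr0 gtr0_norm// ltxx.
have [r r0 Hr] := cd_nbhd cd Ua d0; exists r => // p T' Sp pr tp'.
rewrite -Eq in pr; have [b [Ub bd] bp] := Hr p Sp pr.
have T'E : T' = posT X dX b.
  by have := chart_tangent_part cd Ub; rewrite -bp => tpb; exact: (tangent_part_unique Sp tp' tpb).
have [_ Vb] := HU b bd; split.
  by apply: contraNneq Vb => T'p; rewrite /posV -T'E -bp T'p subrr J0.
move=> x y; rewrite T'E TE bp -Eq.
apply: (@pd0_const _ (fun p => Pform (posV X dX p) (posT X dX p) x y) a d) => // c cd' i.
have [Uc Vc] := HU c cd'.
exact: (chart_P_derive (cd_open cd) (cd_dX cd) (cd_ddX cd) (cd_ddXC cd) (cd_imm cd)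
  (cd_lag cd) (cd_shrink cd) (cd_div cd)).
Qed.

(** For V tangent with |V|^2 = 2 this fixes N up to sign, and no better: S carries no
    orientation. *)
Definition twist_frame q V N := [/\ tangent S q N, dot V N = 0 & dot N N = 2].

Lemma chart_twist_frame U X dX ddX a : chart_data S U X dX ddX -> U a ->
  dot (posV X dX a) (posV X dX a) = 2 ->
  twist_frame (X a) (posV X dX a) (posN X dX a).
Proof.
move=> cd Ua w2.
have V0 : posV X dX a != 0.
  by apply: contraPneq w2 => ->; rewrite dot0l => /eqP; rewrite eq_sym pnatr_eq0.
have [_ [_ [_ _ [_ [_ /(_ 0)[_ [_ [[VV NN VN _ _ _ _ _ _ _ _ _ _ _ _] _]]]]]]]] :=
  chart_frame (cd_open cd) (cd_dX cd) (cd_ddX cd) (cd_ddXC cd) (cd_imm cd)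
  (cd_lag cd) (cd_shrink cd) (cd_div cd) Ua V0.
split=> //; last by rewrite NN.
by apply/(chart_tangentP cd _ Ua) => l; exact: (posN_normal X (cd_lag cd)).
Qed.

Lemma twist_frame_exists q T : S q -> tangent_part S q T ->
  dot (J (T - q)) (J (T - q)) = 2 -> exists N, twist_frame q (J (T - q)) N.
Proof.
move=> Sq tp w2; have [U [X [dX [ddX [a [cd Ua Eq]]]]]] := Sc Sq.
have TE : T = posT X dX a.
  by have := chart_tangent_part cd Ua; rewrite Eq => tp'; exact: (tangent_part_unique Sq tp tp').
exists (posN X dX a); rewrite TE -Eq in w2 *.
exact: (chart_twist_frame cd Ua w2).
Qed.

Lemma twist_frame_sign q V N N' : S q -> tangent S q V -> dot V V = 2 ->
  twist_frame q V N -> twist_frame q V N' -> N' = N \/ N' = - N.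
Proof.
move=> Sq tV VV [tN VN NN] [tN' VN' NN'].
have n2 : (2 : R) != 0 by rewrite pnatr_eq0.
have E := unitary_expand n2 VV NN VN (tangent_lagrangian Sq tV tN) N'.
rewrite (dotC N' V) VN' (tangent_lagrangian Sq tN' tV) (tangent_lagrangian Sq tN' tN) in E.
rewrite !mul0r !scale0r !addr0 add0r in E.
set c := _ / 2 in E.
have : c ^+ 2 = 1.
  by apply: (mulIf n2); rewrite mul1r -{2}NN' E dotZl dotZr NN; ring.
move=> /eqP; rewrite sqrf_eq1 => /orP[] /eqP cE; rewrite E cE ?scale1r ?scaleN1r; by [left|right].
Qed.

Lemma LformN (V N x y : V4) : Lform V (- N) x y = - Lform V N x y.
Proof. by rewrite /Lform JN !dotNl; ring. Qed.

(** The frame vector of the chart equals N or - N at q; using that same sign on the whole parameter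
    ball carries N along to nearby points. *)
Lemma L_locally_constant q N (r0 : R) : S q -> 0 < r0 ->
  (forall p T', S p -> `|p - q| < r0 -> tangent_part S p T' -> T' = 0 /\ dot p p = 2) ->
  twist_frame q (- J q) N ->
  exists2 r : R, 0 < r & forall p, S p -> `|p - q| < r ->
    exists2 N', twist_frame p (- J p) N' &
    forall x y, Lform (- J p) N' x y = Lform (- J q) N x y.
Proof.
move=> Sq r00 near2 tf; have [U [X [dX [ddX [a [cd Ua Eq]]]]]] := Sc Sq.
have /cvgrPdist_lt/(_ _ r00)/nbhs_ballP[d1 /= d10 Hd1] := cd_cont cd Ua.
have /nbhs_ballP[d2 /= d20 Hd2] : nbhs a U.
  by apply: open_nbhs_nbhs; split=> //; exact: cd_open cd.
pose d := Num.min d1 d2; have d0 : 0 < d by rewrite lt_min d10.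
have HU p : `|p - a| < d -> [/\ U p, posT X dX p = 0, posV X dX p = - J (X p) &
    dot (posV X dX p) (posV X dX p) = 2].
  rewrite distrC lt_min => /andP[h1 h2].
  have Up : U p by apply: Hd2; rewrite -ball_normE.
  have Xq : `|X p - q| < r0.
    by rewrite distrC -Eq; apply: Hd1; rewrite -ball_normE.
  have [T0 w2] := near2 _ _ (cd_mem cd Up) Xq (chart_tangent_part cd Up).
  have VE : posV X dX p = - J (X p) by rewrite /posV T0 sub0r JN.
  by split=> //; rewrite VE dotNl dotNr dotJJ opprK.
have Vq : posV X dX a = - J q by have [|_ _ -> _] := HU a; rewrite ?subrr ?normr0 ?Eq.
have Lc x y p : `|p - a| < d ->
    Lform (posV X dX p) (posN X dX p) x y = Lform (posV X dX a) (posN X dX a) x y.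
  apply: (@pd0_const _ (fun p => Lform (posV X dX p) (posN X dX p) x y) a d) => c cd' i.
  have [Uc _ _ _] := HU c cd'.
  apply: (chart_L_derive (cd_open cd) (cd_dX cd) (cd_ddX cd) (cd_ddXC cd) (cd_imm cd)
    (cd_lag cd) (cd_shrink cd) (cd_div cd)) => //.
  have : nbhs c (ball a d).
    by apply: open_nbhs_nbhs; split; [exact: ball_open|rewrite -ball_normE /= distrC].
  by apply: filterS => p2; rewrite -ball_normE /= distrC => /HU[].
have [r r1 Hr] := cd_nbhd cd Ua d0; exists r => // p Sp pr.
rewrite -Eq in pr; have [b [Ub bd] bp] := Hr p Sp pr.
have [_ _ Vb Vb2] := HU b bd; have [|_ _ Va Va2] := HU a; first by rewrite subrr normr0.
have tfa := chart_twist_frame cd Ua Va2; have tfb := chart_twist_frame cd Ub Vb2.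
rewrite Eq Vq in tfa; rewrite -bp in tfb Vb; rewrite Vb in tfb.
have tV : tangent S q (- J q).
  have tpa : tangent_part S q (posT X dX a) by rewrite -Eq; exact (chart_tangent_part cd Ua).
  have VE : posV X dX a = J (posT X dX a - q) by rewrite /posV Eq.
  by have := tangent_part_V Sq tpa; rewrite -VE Vq.
have qq : dot (- J q) (- J q) = 2 by rewrite -Vq.
have [NE|NE] := twist_frame_sign Sq tV qq tfa tf.
  exists (posN X dX b) => // x y.
  by rewrite NE -Vb -Vq; exact: Lc.
exists (- posN X dX b).
  have [t1 t2 t3] := tfb; split.
  - by rewrite -scaleN1r; exact: tangentZ.
  - by rewrite dotNr t2 oppr0.
  - by rewrite dotNl dotNr opprK.
by move=> x y; rewrite NE !LformN -Vb -Vq Lc.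
Qed.

End Charted.

End TangentPart.

(** * Flow invariance of closed sets *)

Section Invariance.
Variable R : realType.
Notation V4 := 'rV[R]_4.

Lemma is_derive_expand (W : normedModType R) (f : R -> W) (t : R) d (e : R) :
  is_derive t 1 f d -> 0 < e ->
  exists2 r : R, 0 < r & forall h, `|h| < r -> `|f (t + h) - f t - h *: d| <= e * `|h|.
Proof.
move=> [df <-] e0.
have /cvgrPdist_le/(_ e e0) := df.
rewrite near_withinE => /nbhs_ballP[r /= r0 Hr].
exists r => // h hr; have [->|h0] := eqVneq h 0.
  by rewrite addr0 subrr scale0r subrr !normr0 mulr0.
have := Hr h; rewrite -ball_normE /= sub0r normrN => /(_ hr h0) /=.
rewrite [h%:A]mulr1 (addrC h t) -(ler_pM2r (x := `|h|)) ?normr_gt0//.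
apply: le_trans; rewrite mulrC -normrZ scalerBr scalerA mulfV// scale1r.
by rewrite distrC.
Qed.

Lemma dist_continuous (W : normedModType R) (x : W) : continuous (fun q : W => `|x - q|).
Proof.
by move=> q; apply: cvg_norm; apply: cvgB; [exact: cvg_cst|exact: cvg_id].
Qed.

Lemma compact_dist_gt0 (K : set V4) (x : V4) : compact K -> ~ K x -> K !=set0 ->
  exists2 m, 0 < m & forall q, K q -> m <= `|x - q|.
Proof.
move=> cK nKx K0.
have cf : {within K, continuous (fun q => `|x - q|)}.
  apply: continuous_subspaceT => q.
  exact: dist_continuous.
have [c /set_mem Kc Hc] := EVT_min_rV K0 cK cf.
exists `|x - c| => [|q Kq]; last by apply: Hc; exact: mem_set.
by rewrite normr_gt0 subr_eq0; apply/eqP => xc; apply: nKx; rewrite xc.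
Qed.

(** Barrier argument. Let T be the last time at which g is within phi of K, where phi grows like
    e^{(L+1) t}. Compactness of K keeps the bound true at T. If T < b, one step along the strong
    tangent v at a near point of K extends the bound beyond T: the rate L pays for the mismatch of
    velocities, the extra 1 in the exponent for the two first order errors. Only the given curve g
    occurs, so no existence theorem for flows is involved. *)
Lemma nagumo_invariance (K : set V4) (g dg : R -> V4) (a b L : R) :
  compact K -> a <= b -> 0 <= L ->
  (forall t, a <= t -> t <= b -> is_derive t 1 g (dg t)) -> K (g a) ->
  (forall t q, a <= t -> t <= b -> K q ->
     exists2 v, strong_tangent K q v & `|dg t - v| <= L * `|g t - q|) ->
  K (g b).
Proof.
move=> cK ab L0 dgP Kga Hv; apply: contrapT => nKb.
have K0 : K !=set0 by exists (g a).
have [m m0 Hm] := compact_dist_gt0 cK nKb K0.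
pose M := expR ((L + 1) * (b - a)); have M0 : 0 < M by exact: expR_gt0.
(* Makes phi b = m / 2, less than the distance m from g b to K: reaching time b is then a
   contradiction. *)
pose eps := m / (2 * M); have eps0 : 0 < eps by rewrite divr_gt0// mulr_gt0.
pose phi t := eps * expR ((L + 1) * (t - a)).
have phi0 t : 0 < phi t by rewrite mulr_gt0// expR_gt0.
pose A := [set t | [/\ a <= t, t <= b & exists2 q, K q & `|g t - q| <= phi t]].
have Aa : A a.
  by split=> //; exists (g a) => //; rewrite subrr normr0 ltW.
have supA : has_sup A by split; [exists a|exists b => t []].
pose T := sup A.
have aT : a <= T by exact: ub_le_sup supA.2 _ Aa.
have Tb : T <= b by apply: ge_sup; [exists a|move=> t []].
have [AT|nAT] := pselect (exists2 q, K q & `|g T - q| <= phi T); last first.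
  pose q0 := fun q => `|g T - q|.
  have cf : {within K, continuous q0}.
    apply: continuous_subspaceT => q.
    exact: dist_continuous.
  have [c /set_mem Kc Hc] := EVT_min_rV K0 cK cf.
  have gap : phi T < q0 c.
    by rewrite ltNge; apply/negP => h; apply: nAT; exists c.
  have gap2 : 0 < (q0 c - phi T) / 2 by rewrite divr_gt0// subr_gt0.
  have cg : {for T, continuous g}.
    by apply: differentiable_continuous; apply/derivable1_diffP; have [] := dgP T aT Tb.
  have /cvgrPdist_lt/(_ _ gap2)/nbhs_ballP[r /= r0 Hr] := cg.
  have [t At Tt] := sup_adherent r0 supA.
  have tT : t <= T by exact: ub_le_sup supA.2 _ At.
  have [_ _ [q Kq Hq]] := At.
  have gtT : `|g T - g t| < (q0 c - phi T) / 2.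
    apply: Hr; rewrite -ball_normE /= ger0_norm ?subr_ge0//.
    by move: Tt; rewrite -/T; lra.
  have phile : phi t <= phi T.
    rewrite ler_pM2l// ler_expR ler_wpM2l ?addr_ge0//; lra.
  have h : q0 c <= `|g T - g t| + `|g t - q|.
    exact: le_trans (Hc q (mem_set Kq)) (ler_distD (g t) _ _).
  clear - gtT Hq phile h gap.
  by move: (q0 c) `|g T - g t| `|g t - q| (phi t) (phi T) gtT Hq phile h gap => *; lra.
have AT' : A T by [].
have [q Kq Hq] := AT.
have [Tb'|bT] := ltP T b; last first.
  have Eb : T = b by apply/eqP; rewrite eq_le Tb bT.
  have := Hm q Kq; rewrite -Eb => /le_trans/(_ Hq).
  rewrite /phi Eb -/M /eps.
  have -> : m / (2 * M) * M = m / 2 by field; rewrite gt_eqF.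
  by move=> h; lra.
have [v tv Lv] := Hv T q aT Tb Kq.
have e4 : 0 < eps / 2 by rewrite divr_gt0.
have [d1 d10 H1] := tv _ e4.
have [d2 d20 H2] := is_derive_expand (dgP T aT Tb) e4.
pose h := Num.min (Num.min d1 d2) (b - T) / 2.
have mn : 0 < Num.min (Num.min d1 d2) (b - T) by rewrite !lt_min d10 d20 subr_gt0.
have h0 : 0 < h by rewrite divr_gt0.
have hm : h < Num.min (Num.min d1 d2) (b - T) by rewrite ltr_pdivrMr// ltr_pMr// ltr1n.
move: hm; rewrite !lt_min => /andP[/andP[hd1 hd2] hb].
have [|q' Kq' Hq'] := H1 h; first by rewrite gtr0_norm.
have /H2 Hg : `|h| < d2 by rewrite gtr0_norm.
rewrite (gtr0_norm h0) in Hq' Hg.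
have ATh : A (T + h).
  have Tha : a <= T + h by rewrite (le_trans aT)// lerDl ltW.
  have Thb : T + h <= b by rewrite -lerBrDl ltW.
  split=> //; exists q' => //.
  have -> : g (T + h) - q' = (g T - q) + (g (T + h) - g T - h *: dg T) +
     h *: (dg T - v) - (q' - (q + h *: v)).
    by apply/rowP => i; rewrite !mxE; ring.
  have n1 : `|h *: (dg T - v)| <= h * (L * phi T).
    rewrite normrZ gtr0_norm// ler_pM2l// (le_trans Lv)// ler_wpM2l//.
  have n2 : eps <= phi T.
    by rewrite ler_peMr ?(ltW eps0)// -expR0 ler_expR mulr_ge0 ?subr_ge0 ?addr_ge0.
  have n3 : phi T * (1 + (L + 1) * h) <= phi (T + h).
    rewrite /phi -mulrA ler_pM2l// (_ : (L + 1) * (T + h - a) = (L + 1) * (T - a) + (L + 1) * h); last by ring.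
    by rewrite expRD ler_pM2l ?expR_gt0// expR_ge1Dx.
  apply: le_trans (ler_normB _ _) _.
  have := ler_normD (g T - q + (g (T + h) - g T - h *: dg T)) (h *: (dg T - v)).
  have := ler_normD (g T - q) (g (T + h) - g T - h *: dg T).
  have n4 : eps * h <= phi T * h by rewrite ler_pM2r.
  clear - n1 n3 n4 Hq Hg Hq'.
  move: `|_ + _ + _| `|_ + _| `|h *: _| `|g (T + h) - _ - _| `|g T - q| `|q' - _| n1 Hq Hg Hq'.
  by move=> *; lra.
have := ub_le_sup supA.2 ATh; rewrite -/T -[leRHS]addr0 lerD2l.
by rewrite leNgt h0.
Qed.

End Invariance.

(** * Farthest points and the level set of P *)

Section FarthestPoint.
Variable R : realType.
Notation V4 := 'rV[R]_4.

(** The parametrization is kept and only its domain shrinks, so every differential condition is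
    inherited. *)
Lemma locally_charted_open_subset (S K : set V4) : locally_charted S -> K `<=` S ->
  (forall q, K q -> exists2 r : R, 0 < r & forall p, S p -> `|p - q| < r -> K p) ->
  locally_charted K.
Proof.
move=> Sc KS Ko q Kq.
have [U [X [dX [ddX [a [cd Ua Xa]]]]]] := Sc q (KS _ Kq).
pose U' := [set b | U b /\ K (X b)].
have U'U b : U' b -> U b by case.
have U'o : open U'.
  rewrite openE => b [Ub Kb]; have [r r0 Hr] := Ko _ Kb.
  have /cvgrPdist_lt/(_ _ r0) cX : X x @[x --> b] --> X b by exact (cd_cont cd Ub).
  have nU : nbhs b U by apply: open_nbhs_nbhs; split=> //; exact (cd_open cd).
  apply: filterS (filterI nU cX) => c [Uc Xc]; split=> //.
  by apply: Hr; [exact (cd_mem cd Uc)|rewrite distrC].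
exists U', X, dX, ddX, a; split=> //; last by split=> //; rewrite Xa.
split.
- exact: U'o.
- by move=> b i /U'U; exact: (cd_dX cd).
- by move=> b i j /U'U; exact: (cd_ddX cd).
- by move=> b i j /U'U; exact: (cd_ddXC cd).
- by move=> b /U'U; exact: (cd_imm cd).
- by move=> b /U'U; exact: (cd_lag cd).
- by move=> b /U'U; exact: (cd_shrink cd).
- by move=> b /U'U; exact: (cd_div cd).
- by move=> b /U'U; exact: (cd_cont cd).
- by move=> b i /U'U; exact: (cd_contd cd).
- by move=> b [].
- by move=> b e /U'U; exact: (cd_expand cd).
- move=> b d [Ub Kb] d0.
  have [r r0 Hr] := cd_nbhd cd Ub d0; have [r' r'0 Hr'] := Ko _ Kb.
  exists (Num.min r r') => [|p Kp]; first by rewrite lt_min r0.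
  rewrite lt_min => /andP[pr pr'].
  have [c [Uc cb] pc] := Hr p (KS _ Kp) pr.
  by exists c => //; split=> //; split=> //; rewrite -pc.
Qed.

Lemma closed_ballP (K : set V4) :
  (forall q, (forall r : R, 0 < r -> exists2 k, K k & `|k - q| < r) -> K q) -> closed K.
Proof.
move=> h q clq; apply: h => r r0.
have [k [Kk]] := clq (ball q r) (nbhsx_ballx q r r0).
by rewrite -ball_normE /= distrC => kq; exists k.
Qed.

Lemma compact_limit (K : set V4) q : compact K ->
  (forall r : R, 0 < r -> exists2 k, K k & `|k - q| < r) -> K q.
Proof.
move=> cK h; apply: contrapT => nKq.
have K0 : K !=set0 by have [k Kk _] := h 1 ltr01; exists k.
have [m m0 Hm] := compact_dist_gt0 cK nKq K0.
have [k Kk] := h m m0.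
by rewrite distrC ltNge Hm.
Qed.

Lemma relatively_closed_compact (S K : set V4) : compact S -> K `<=` S ->
  (forall q, S q -> (forall r : R, 0 < r -> exists2 k, K k & `|k - q| < r) -> K q) ->
  compact K.
Proof.
move=> cS KS h; apply: (subclosed_compact _ cS KS).
apply: closed_ballP => q hq; apply: (h) => //.
by apply: (compact_limit cS) => r /hq[k /KS Sk kq]; exists k.
Qed.

Lemma dot_sqr_continuous : continuous (fun x : V4 => dot x x).
Proof.
move=> x; have idc : y @[y --> x] --> x by exact: cvg_id.
exact: (cvg_dot4 idc idc).
Qed.

Lemma norm_le_sqrt_dot (u : V4) : `|u| <= Num.sqrt (dot u u).
Proof.
apply: norm_rV_le => [|i]; first exact: sqrtr_ge0.
rewrite -sqrtr_sqr ler_sqrt ?dot_ge0// expr2 /dot (bigD1 i)//= lerDl.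
by apply: sumr_ge0 => j _; rewrite -expr2 sqr_ge0.
Qed.

Section Farthest.
Variable S : set V4.
Hypothesis Sc : locally_charted S.

Lemma tangent_nonzero q : S q -> exists2 v, tangent S q v & v != 0.
Proof.
move=> Sq; have [U [X [dX [ddX [a [cd Ua <-]]]]]] := Sc Sq.
exists (dX 0 a).
  apply/(chart_tangentP cd _ Ua) => l.
  by rewrite dotJr (cd_lag cd Ua) oppr0.
apply/eqP => d0; have [|] := cd_imm cd Ua (a := 1) (b := 0); last by move/eqP; rewrite oner_eq0.
by rewrite d0 scaler0 scale0r addr0.
Qed.

Lemma frame_exists q T : S q -> tangent_part S q T -> T != q ->
  exists N, [/\ tangent S q N, dot (J (T - q)) N = 0 & dot N N = dot (q - T) (q - T)].
Proof.
move=> Sq tp Tq; have [U [X [dX [ddX [a [cd Ua Eq]]]]]] := Sc Sq.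
have TE : T = posT X dX a.
  by have := chart_tangent_part cd Ua; rewrite Eq => tp'; exact: (tangent_part_unique Sc Sq tp tp').
have V0 : posV X dX a != 0.
  apply: contraNneq Tq => /(congr1 (@J R)); rewrite JJ J0 -TE Eq => /eqP.
  by rewrite oppr_eq0 subr_eq0.
have [_ [_ [_ _ [_ [_ /(_ 0)[_ [_ [[VV NN VN _ _ _ _ _ _ _ _ _ _ _ _] _]]]]]]]] :=
  chart_frame (cd_open cd) (cd_dX cd) (cd_ddX cd) (cd_ddXC cd) (cd_imm cd)
  (cd_lag cd) (cd_shrink cd) (cd_div cd) Ua V0.
exists (posN X dX a); split.
- rewrite -Eq; apply/(chart_tangentP cd _ Ua) => l; exact: (posN_normal X (cd_lag cd)).
- by rewrite -VN TE /posV Eq.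
- by rewrite NN /posV dotJJ -TE Eq -opprB dotNl dotNr opprK.
Qed.

(** First variation: |q'|^2 <= |p|^2 at q' = p + h u + o(h) gives <p, u> <= 0, and - u is tangent as
    well. *)
Lemma farthest_normal p v : S p -> (forall q, S q -> dot q q <= dot p p) ->
  tangent S p v -> dot p v = 0.
Proof.
move=> Sp pmax tv.
suff H u : tangent S p u -> dot p u <= 0.
  apply/eqP; rewrite eq_le H//= -oppr_le0 -dotNr H//.
  by rewrite -scaleN1r; exact: tangentZ.
move=> tu; apply/ler_addgt0Pl => e e0; rewrite addr0.
pose c := 4 * `|p| + 1; have c0 : 0 < c by rewrite ltr_wpDl// mulr_ge0.
have [h [q' [h0 _ Sq' Hq']]] := tu (e / c) (divr_gt0 e0 c0).
set r := q' - _ in Hq'.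
have qE : q' = p + h *: u + r by rewrite /r addrC subrK.
clearbody r.
have := pmax q' Sq'; rewrite {1 2}qE.
have -> : dot (p + h *: u + r) (p + h *: u + r) =
   dot p p + 2 * h * dot p u + 2 * dot p r + dot (h *: u + r) (h *: u + r).
  by rewrite !dotE !(dotC u p) !(dotC r p) (dotC r u); ring.
have s0 := dot_ge0 (h *: u + r).
have pr : - dot p r <= e * h.
  rewrite (le_trans (ler_norm _))// normrN (le_trans (dot_norm_le _ _))//.
  apply: (@le_trans _ _ (c * (e / c * h))).
    by apply: ler_pM => //; rewrite ?mulr_ge0 ?lerDl.
  by rewrite [leLHS](_ : _ = e * h)//; field; rewrite gt_eqF.
move=> H; rewrite -(ler_pM2l h0); lra.
Qed.

Lemma farthest_neq0 p : S p -> (forall q, S q -> dot q q <= dot p p) -> p != 0.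
Proof.
move=> Sp pmax; apply/eqP => p0.
have [v tv v0] := tangent_nonzero Sp.
have nv : 0 < `|v| / 2 by rewrite divr_gt0// normr_gt0.
have [h [q' [h0 _ Sq' Hq']]] := tv _ nv.
have q'0 : q' = 0.
  by apply: dot_eq0; apply/eqP; rewrite eq_le dot_ge0 andbT (le_trans (pmax _ Sq'))// p0 dot0l.
move: Hq'; rewrite q'0 p0 !add0r normrN normrZ gtr0_norm// mulrC ler_pM2r//.
by rewrite leNgt ltr_pdivrMr// ltr_pMr ?ltr1n// normr_gt0.
Qed.

End Farthest.

End FarthestPoint.

(** * The level set of P through a farthest point *)

Section LevelSet.
Variable R : realType.
Notation V4 := 'rV[R]_4.

(* The complex linear map equal to 1/|p|^2 on the complex line of p and to
   1 - 1/|p|^2 on its orthogonal complement. *)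
Definition Pvec (p x : V4) : V4 := (1 - (dot p p)^-1) *: x +
  ((2 / dot p p - 1) / dot p p) *: (dot (J p) x *: J p + dot p x *: p).

Lemma PvecD p x y : Pvec p (x + y) = Pvec p x + Pvec p y.
Proof.
rewrite /Pvec !dotDr; apply/rowP => i; rewrite !mxE.
by move: (J p 0 i) => j; ring.
Qed.

Lemma PvecZ p a x : Pvec p (a *: x) = a *: Pvec p x.
Proof.
rewrite /Pvec !dotZr; apply/rowP => i; rewrite !mxE.
by move: (J p 0 i) => j; ring.
Qed.

Lemma PvecB p x y : Pvec p (x - y) = Pvec p x - Pvec p y.
Proof. by rewrite -scaleN1r PvecD PvecZ scaleN1r. Qed.

Lemma Pvec_J p x : Pvec p (J x) = J (Pvec p x).
Proof.
rewrite /Pvec JD !JZ JD !JZ JJ dotJJ (dotJr p x).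
by congr (_ + _ *: _); rewrite scalerN scaleNr addrC.
Qed.

Lemma Pvec_line p : p != 0 -> Pvec p p = (dot p p)^-1 *: p.
Proof.
move=> p0; rewrite /Pvec dotJu scale0r add0r scalerA -scalerDl; congr (_ *: _).
by field; rewrite gt_eqF// dot_gt0.
Qed.

Lemma Pvec_perp p N : dot p N = 0 -> dot (J p) N = 0 ->
  Pvec p N = (1 - (dot p p)^-1) *: N.
Proof. by move=> h1 h2; rewrite /Pvec h1 h2 !scale0r addr0 scaler0 addr0. Qed.

Lemma Pvec_norm p : exists2 C : R, 0 < C & forall x, `|Pvec p x| <= C * `|x|.
Proof.
pose k := `|(2 / dot p p - 1) / dot p p|.
pose B := 4 * `|J p| * `|J p| + 4 * `|p| * `|p|.
have k0 : 0 <= k := normr_ge0 _.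
have B0 : 0 <= B by rewrite addr_ge0 ?mulr_ge0.
exists (`|1 - (dot p p)^-1| + k * B + 1) => [|x].
  by rewrite ltr_wpDl// addr_ge0// mulr_ge0.
have hz (z : V4) : `|dot z x *: z| <= 4 * `|z| * `|z| * `|x|.
  rewrite normrZ (le_trans (ler_wpM2r (normr_ge0 z) (dot_norm_le z x)))//.
  by rewrite mulrAC.
have h3 : `|dot (J p) x *: J p + dot p x *: p| <= B * `|x|.
  by rewrite (le_trans (ler_normD _ _))// /B mulrDl lerD.
rewrite (le_trans (ler_normD _ _))// (normrZ _ x) (normrZ _ (_ + _)) -/k.
have aux (z n u a b : R) : 0 <= n -> a * z <= a * (b * n) -> u * n + a * z <= (u + a * b + 1) * n.
  by move=> n0 h; nra.
exact (aux _ _ _ _ _ (normr_ge0 x) (ler_wpM2l k0 h3)).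
Qed.

Lemma Pform_origin p x y : p != 0 -> Pform (J (0 - p)) 0 x y = dot (Pvec p x) y.
Proof.
move=> p0; have s0 : dot p p != 0 by rewrite gt_eqF// dot_gt0.
rewrite /Pform sub0r !JN JJ !opprK !dotNl !dotNr !opprK dotJJ J0 !dot0l addr0.
by rewrite /Pvec !dotDl !dotZl dotDl !dotZl; field.
Qed.

(** Here q - T is J V. On a level set of P this makes T and V functions of the position alone. *)
Lemma Pform_self (q T y : V4) : T != q -> dot (q - T) T = 0 -> dot (J (T - q)) T = 0 ->
  Pform (J (T - q)) T q y = dot (q - T) y / dot (q - T) (q - T).
Proof.
move=> Tq nT VT; set n := q - T in nT *.
have n0 : n != 0 by rewrite subr_eq0 eq_sym.
have w0 : 0 < dot n n := dot_gt0 n0.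
have -> : T - q = - n by rewrite opprB.
have JnT : dot (J n) T = 0.
  by move: VT; rewrite -opprB JN dotNl => /eqP; rewrite oppr_eq0 => /eqP.
have qE : q = n + T by rewrite subrK.
have s0 : dot n n + dot T T != 0 by rewrite gt_eqF// ltr_pwDl// dot_ge0.
have TT : dot (J T) T = 0 by exact: dotJu.
have Tn : dot T n = 0 by rewrite dotC.
have JTn : dot (J T) n = 0 by rewrite dotJ dotC JnT oppr0.
rewrite /Pform !JN JJ !opprK !dotNl !dotNr !opprK dotJJ.
rewrite {1 2 3 4 5 6 7}qE !(dotDr n T) dotDl JnT nT TT Tn JTn dotJu.
by field; rewrite s0 gt_eqF.
Qed.

(** The condition T != q says H <> 0, without which [Pform] would only be a default value. The
    reference is P at p, where the tangential part is 0. *)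
Definition level (S : set V4) (p : V4) := [set q | S q /\ exists T,
  [/\ tangent_part S q T, T != q & forall x y, Pform (J (T - q)) T x y = Pform (J (0 - p)) 0 x y]].

Section Level.
Variables (S : set V4) (p : V4).
Hypothesis Sc : locally_charted S.
Hypothesis cS : compact S.
Hypothesis Sp : S p.
Hypothesis pmax : forall q, S q -> dot q q <= dot p p.

Let p0 : p != 0. Proof. exact: (farthest_neq0 Sc Sp pmax). Qed.

Lemma level_tangent_part q : level S p q -> exists T, [/\ tangent_part S q T, T != q,
  Pvec p q = (dot (q - T) (q - T))^-1 *: (q - T) & dot (q - T) T = 0].
Proof.
move=> [Sq [T [tp Tq PE]]]; have [tT nT] := tp.
exists T; split=> //; last exact: nT.
apply: dot_inj => y; rewrite -Pform_origin// -PE dotZl mulrC.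
by apply: Pform_self => //; [exact: nT|exact: (tangent_part_VT Sc Sq tp)].
Qed.

Lemma level_sub : level S p `<=` S. Proof. by move=> q []. Qed.

Lemma level_open q : level S p q ->
  exists2 r : R, 0 < r & forall k, S k -> `|k - q| < r -> level S p k.
Proof.
move=> [Sq [T [tp Tq PE]]].
have [r r0 Hr] := P_locally_constant Sc Sq tp Tq; exists r => // k Sk kr.
have [T' tp'] := tangent_part_exists Sc Sk.
have [T'k PE'] := Hr k T' Sk kr tp'.
by split=> //; exists T'; split=> // x y; rewrite PE' PE.
Qed.

Lemma farthest_tangent_part : tangent_part S p 0.
Proof.
split; last by move=> v tv; rewrite subr0; exact: (farthest_normal Sc Sp pmax tv).
by have [v tv _] := tangent_nonzero Sc Sp; rewrite -(scale0r v); exact: tangentZ.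
Qed.

Lemma level_farthest : level S p p.
Proof.
split=> //; exists 0; split=> //; first exact: farthest_tangent_part.
by rewrite eq_sym.
Qed.

Lemma norm_le_farthest q : S q -> `|q| <= Num.sqrt (dot p p).
Proof.
by move=> Sq; rewrite (le_trans (norm_le_sqrt_dot q))// ler_wsqrtr// pmax.
Qed.

Lemma level_Pvec_self q : level S p q -> dot (Pvec p q) q = 1.
Proof.
move=> /level_tangent_part[T [_ Tq -> nT]]; rewrite dotZl.
have n0 : 0 < dot (q - T) (q - T) by rewrite dot_gt0// subr_eq0 eq_sym.
have <- : dot (q - T) (q - T) = dot (q - T) q by rewrite dotBr nT subr0.
by rewrite mulVf// gt_eqF.
Qed.

(** At a limit point with H <> 0 local constancy suffices. At a limit point with H = 0, points k of
    the level set nearby would have |P0 k|^2 = 1/|H(k)|^2 arbitrarily large, while P0 is bounded on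
    S. *)
Lemma level_compact : compact (level S p).
Proof.
apply: (relatively_closed_compact cS level_sub) => q Sq lim.
have [T tp] := tangent_part_exists Sc Sq.
have [Tq|Tq] := eqVneq T q; last first.
  have [r r0 Hr] := P_locally_constant Sc Sq tp Tq.
  have [k [Sk [T' [tp' T'k PE]]] kq] := lim r r0.
  have [_ PE'] := Hr k T' Sk kq tp'.
  by split=> //; exists T; split=> // x y; rewrite -PE' PE.
have [C C0 HC] := Pvec_norm p.
pose M := 4 * (C * Num.sqrt (dot p p)) * (C * Num.sqrt (dot p p)) + 1.
have M0 : 0 < M by rewrite ltr_wpDl// !mulr_ge0 ?sqrtr_ge0 ?(ltW C0).
have iM0 : 0 < M^-1 by rewrite invr_gt0.
have [r r0 Hr] := tangent_part_w_continuous Sc Sq tp iM0.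
have [k lk kq] := lim r r0.
have [T' [tp' T'k PE _]] := level_tangent_part lk.
have := Hr k T' lk.1 kq tp'.
rewrite Tq subrr J0 dot0l sub0r normrN dotJJ -opprB dotNl dotNr opprK.
set w := dot _ _; have w0 : 0 < w by rewrite dot_gt0// subr_eq0 eq_sym.
rewrite gtr0_norm// => wM; exfalso.
have : dot (Pvec p k) (Pvec p k) = w^-1.
  by rewrite PE dotZl dotZr -/w; field; rewrite gt_eqF.
have kle : `|Pvec p k| <= C * Num.sqrt (dot p p).
  by rewrite (le_trans (HC k))// ler_pM2l// norm_le_farthest//; exact: lk.1.
have : `|dot (Pvec p k) (Pvec p k)| <= 4 * (C * Num.sqrt (dot p p)) * (C * Num.sqrt (dot p p)).
  rewrite (le_trans (dot_norm_le _ _))//.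
  by apply: ler_pM => //; rewrite ?mulr_ge0// ler_pM2l.
move=> h1 h2; have : w^-1 < M.
  by rewrite -h2 (le_lt_trans (ler_norm _))// (le_lt_trans h1)// ltrDl.
by rewrite -[M]invrK ltf_pV2 ?posrE ?invr_gt0// ltNge (ltW wM).
Qed.

End Level.

End LevelSet.

(** * Elliptic arcs inside the level set *)

Section Arcs.
Variable R : realType.
Notation V4 := 'rV[R]_4.

Lemma tangent_open_subset (S K : set V4) q v (r : R) : 0 < r ->
  (forall k, S k -> `|k - q| < r -> K k) -> tangent S q v -> tangent K q v.
Proof.
move=> r0 Hr tv e e0; pose e' := Num.min e (Num.min 1 (r / (`|v| + 1))).
have v1 : 0 < `|v| + 1 by rewrite ltr_wpDl.
have e'0 : 0 < e' by rewrite !lt_min e0 ltr01 divr_gt0.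
have e'e : e' <= e by rewrite ge_min lexx.
have [h [q' [h0 he Sq' Hq']]] := tv e' e'0.
exists h, q'; split=> //; first exact: lt_le_trans he e'e.
  apply: Hr => //.
  have -> : q' - q = (q' - (q + h *: v)) + h *: v by rewrite opprD addrA subrK.
  rewrite (le_lt_trans (ler_normD _ _))// normrZ gtr0_norm//.
  have e1 : e' * h <= h by rewrite ler_piMl ?(ltW h0)// !ge_min lexx orbT.
  apply: (@le_lt_trans _ _ (h * (`|v| + 1))).
    by rewrite mulrDr mulr1 addrC lerD2l (le_trans Hq').
  rewrite -ltr_pdivlMr// (lt_le_trans he)// !ge_min lexx !orbT//.
by rewrite (le_trans Hq')// ler_pM2r.
Qed.

Lemma strong_tangent_open_subset (S K : set V4) q v (r : R) : 0 < r ->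
  (forall k, S k -> `|k - q| < r -> K k) -> strong_tangent S q v -> strong_tangent K q v.
Proof.
move=> r0 Hr tv e e0; pose e' := Num.min e 1.
have v1 : 0 < `|v| + 1 by rewrite ltr_wpDl.
have e'0 : 0 < e' by rewrite !lt_min e0 ltr01.
have [d d0 Hd] := tv e' e'0.
exists (Num.min d (r / (`|v| + 1))) => [|h]; first by rewrite lt_min d0 divr_gt0.
rewrite lt_min => /andP[hd hr]; have [q' Sq' Hq'] := Hd h hd.
exists q'; last by rewrite (le_trans Hq')// ler_wpM2r// ge_min lexx.
apply: Hr => //.
have -> : q' - q = (q' - (q + h *: v)) + h *: v by rewrite opprD addrA subrK.
rewrite (le_lt_trans (ler_normD _ _))// normrZ.
have e1 : e' * `|h| <= `|h| by rewrite ler_piMl// ge_min lexx orbT.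
apply: (@le_lt_trans _ _ (`|h| * (`|v| + 1))).
  by rewrite mulrDr mulr1 addrC lerD2l (le_trans Hq').
by rewrite -ltr_pdivlMr.
Qed.

(** On the level set this is T / |H|^2, rewritten through P0 alone and hence defined on all of
    R^4. *)
Definition Gfield (p x : V4) := dot (Pvec p x) (Pvec p x) *: x - Pvec p x.

Lemma Gfield_lipschitz (p : V4) (b : R) : 0 <= b -> exists2 L : R, 0 <= L &
  forall x y, `|x| <= b -> `|y| <= b -> `|Gfield p x - Gfield p y| <= L * `|x - y|.
Proof.
move=> b0; have [C C0 HC] := Pvec_norm p.
pose D := 8 * (C * b) * C * b + 4 * (C * b) * (C * b) + C.
have Cb : 0 <= C * b by rewrite mulr_ge0 ?(ltW C0).
exists D => [|x y xb yb].
  by rewrite !addr_ge0 ?mulr_ge0 ?(ltW C0).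
have Px : `|Pvec p x| <= C * b by rewrite (le_trans (HC x))// ler_pM2l.
have Py : `|Pvec p y| <= C * b by rewrite (le_trans (HC y))// ler_pM2l.
have Pxy : `|Pvec p x - Pvec p y| <= C * `|x - y| by rewrite -PvecB.
have -> : Gfield p x - Gfield p y =
  dot (Pvec p x + Pvec p y) (Pvec p x - Pvec p y) *: x +
  dot (Pvec p y) (Pvec p y) *: (x - y) - (Pvec p x - Pvec p y).
  rewrite /Gfield; move: (Pvec p x) (Pvec p y) => u v.
  rewrite !dotE (dotC v u); apply/rowP => i; rewrite !mxE; ring.
have n1 : `|dot (Pvec p x + Pvec p y) (Pvec p x - Pvec p y)| <= 8 * (C * b) * (C * `|x - y|).
  rewrite (le_trans (dot_norm_le _ _))//; apply: ler_pM; rewrite ?mulr_ge0//.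
  rewrite (_ : 8 * (C * b) = 4 * (C * b + C * b)); last by ring.
  by rewrite ler_pM2l// (le_trans (ler_normD _ _))// lerD.
have n2 : `|dot (Pvec p y) (Pvec p y)| <= 4 * (C * b) * (C * b).
  rewrite (le_trans (dot_norm_le _ _))//.
  by apply: ler_pM => //; rewrite ?mulr_ge0// ler_pM2l.
rewrite (le_trans (ler_normB _ _))// (le_trans (lerD (ler_normD _ _) (lexx _)))// !normrZ.
have m1 : `|dot (Pvec p x + Pvec p y) (Pvec p x - Pvec p y)| * `|x| <= 8 * (C * b) * (C * `|x - y|) * b.
  by apply: ler_pM.
have m2 : `|dot (Pvec p y) (Pvec p y)| * `|x - y| <= 4 * (C * b) * (C * b) * `|x - y|.
  by apply: ler_wpM2r.
rewrite (le_trans (lerD (lerD m1 m2) Pxy))// /D.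
by rewrite [leLHS](_ : _ = (8 * (C * b) * C * b + 4 * (C * b) * (C * b) + C) * `|x - y|)//; ring.
Qed.

Lemma is_derive_comb (f g : R -> R) (Y Z : V4) (t df dg : R) :
  is_derive t 1 f df -> is_derive t 1 g dg ->
  is_derive t 1 (fun s => f s *: Y + g s *: Z) (df *: Y + dg *: Z).
Proof.
move=> hf hg; have hY := is_derive_cst Y t (1 : R); have hZ := is_derive_cst Z t (1 : R).
have := is_derive_addl (is_derive_scalel hf hY) (is_derive_scalel hg hZ).
by rewrite /cst !scaler0 !addr0.
Qed.

Section Level.
Variables (S : set V4) (p : V4).
Hypothesis Sc : locally_charted S.
Hypothesis cS : compact S.
Hypothesis Sp : S p.
Hypothesis pmax : forall q, S q -> dot q q <= dot p p.

Notation K := (level S p).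

Lemma level_strong_tangent q v : K q -> tangent S q v -> strong_tangent K q v.
Proof.
move=> Kq tv; have [r r0 Hr] := level_open Sc Kq.
apply: (strong_tangent_open_subset r0 Hr).
exact: (tangent_strong Sc (level_sub Kq) tv).
Qed.

Lemma level_Gfield_tangent q : K q -> tangent S q (Gfield p q).
Proof.
move=> Kq; have [T [[tT _] Tq PE nT]] := level_tangent_part Sc Sp pmax Kq.
have w0 : dot (q - T) (q - T) != 0 by rewrite gt_eqF// dot_gt0// subr_eq0 eq_sym.
rewrite /Gfield PE dotZl dotZr mulVf// mulr1 -scalerBr subKr.
exact: (tangentZ Sc _ (level_sub Kq) tT).
Qed.

(** On the level set J P0 q is - V / |V|^2. *)
Lemma level_JP_tangent q : K q -> tangent S q (J (Pvec p q)).
Proof.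
move=> Kq; have [T [tp Tq -> nT]] := level_tangent_part Sc Sp pmax Kq.
rewrite JZ -opprB JN scalerN -scaleNr.
apply: (tangentZ Sc _ (level_sub Kq)).
exact: (tangent_part_V Sc (level_sub Kq) tp).
Qed.

(** Y and Z are eigenvectors of P0, scaled so that the whole ellipse cos t Y + sin t Z lies on the
    quadric <P0 x, x> = 1, which contains the level set ([level_Pvec_self]). *)
Definition split_pair (Y Z : V4) (a b : R) := [/\ Pvec p Y = a *: Y, Pvec p Z = b *: Z,
  dot Y Z = 0, a * dot Y Y = 1 & b * dot Z Z = 1].

Lemma split_pair_sym Y Z a b : split_pair Y Z a b -> split_pair Z Y b a.
Proof. by case=> h1 h2 h3 h4 h5; split; rewrite // dotC. Qed.

(** Along the ellipse [Gfield] is a multiple of the velocity, with factor - (b - a) sin t cos t.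
    Away from the end points the arc is thus an integral curve of G after a change of time, and
    invariance applies. *)
Lemma arc_forward Y Z a b (t0 t1 : R) : split_pair Y Z a b -> a != b ->
  0 < t0 -> t0 <= t1 -> t1 < pi / 2 ->
  K (cos t0 *: Y + sin t0 *: Z) -> K (cos t1 *: Y + sin t1 *: Z).
Proof.
move=> [PY PZ YZ YY ZZ] ab t00 t01 t1p K0.
pose g (t : R) := cos t *: Y + sin t *: Z.
pose dg (t : R) := - sin t *: Y + cos t *: Z.
have Gg t : Gfield p (g t) = - ((b - a) * (sin t * cos t)) *: dg t.
  rewrite /Gfield /g PvecD !PvecZ PY PZ.
  have -> : dot (cos t *: (a *: Y) + sin t *: (b *: Z)) (cos t *: (a *: Y) + sin t *: (b *: Z)) =
     a * cos t ^+ 2 + b * sin t ^+ 2.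
    rewrite !dotE (dotC Z Y) YZ.
    have -> : cos t * (a * (cos t * (a * dot Y Y) + sin t * (b * 0))) +
      sin t * (b * (cos t * (a * 0) + sin t * (b * dot Z Z))) =
      a * cos t ^+ 2 * (a * dot Y Y) + b * sin t ^+ 2 * (b * dot Z Z) by ring.
    by rewrite YY ZZ !mulr1.
  rewrite /dg; have := cos2Dsin2 t => cs.
  have e1 : a * cos t ^+ 2 + b * sin t ^+ 2 - a = (b - a) * sin t ^+ 2.
    by rewrite -{2}[a]mulr1 -cs; ring.
  have e2' : a * cos t ^+ 2 + b * sin t ^+ 2 - b = - (b - a) * cos t ^+ 2.
    by rewrite -{2}[b]mulr1 -cs; ring.
  move: e1 e2'; set m := a * cos t ^+ 2 + b * sin t ^+ 2 => e1 e2'.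
  have -> : m *: (cos t *: Y + sin t *: Z) - (cos t *: (a *: Y) + sin t *: (b *: Z)) =
     (cos t * (m - a)) *: Y + (sin t * (m - b)) *: Z.
    by apply/rowP => i; rewrite !mxE; ring.
  by rewrite e1 e2'; apply/rowP => i; rewrite !mxE; ring.
have bd : 0 <= `|Y| + `|Z| + Num.sqrt (dot p p) by rewrite !addr_ge0// sqrtr_ge0.
have [L L0 HL] := Gfield_lipschitz p bd.
have pi0 := @pi_gt0 R.
have spos (t : R) : 0 < t -> t < pi / 2 -> 0 < sin t by move=> h1 h2; apply: sin_gt0_pihalf; rewrite h1.
have cpos (t : R) : 0 < t -> t < pi / 2 -> 0 < cos t.
  move=> h1 h2; apply: cos_gt0_pihalf; apply/andP; split=> //.
  by apply: lt_trans h1; rewrite oppr_lt0 divr_gt0.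
have t0p := le_lt_trans t01 t1p.
have t10 := lt_le_trans t00 t01.
(* Bounds the time change f on [t0, t1], since there sin t >= sin t0 and cos t >= cos t1. *)
pose F := (`|b - a| * (sin t0 * cos t1))^-1.
have ba0 : 0 < `|b - a| by rewrite normr_gt0 subr_eq0 eq_sym.
have sc0 : 0 < sin t0 * cos t1 by rewrite mulr_gt0 ?spos ?cpos.
have F0 : 0 <= F by rewrite invr_ge0 mulr_ge0// ltW.
apply: (@nagumo_invariance _ K g dg t0 t1 (F * L)) => //.
- exact: (level_compact Sc cS Sp pmax).
- exact: mulr_ge0.
- by move=> t _ _; apply: is_derive_comb.
move=> t q t0t tt1 Kq.
have tpos := lt_le_trans t00 t0t; have tp := le_lt_trans tt1 t1p.
have st := spos t tpos tp; have ct := cpos t tpos tp.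
pose f := - ((b - a) * (sin t * cos t))^-1.
have bsc : (b - a) * (sin t * cos t) != 0.
  have ba : b - a != 0 by rewrite subr_eq0 eq_sym.
  by rewrite !mulf_neq0// gt_eqF.
have dgE : dg t = f *: Gfield p (g t).
  by rewrite Gg scalerA /f mulrNN mulVf// scale1r.
exists (f *: Gfield p q).
  apply: level_strong_tangent => //; apply: (tangentZ Sc _ (level_sub Kq)).
  exact: level_Gfield_tangent.
rewrite dgE -scalerBr normrZ -mulrA; apply: ler_pM => //.
  rewrite /f normrN normfV normrM (gtr0_norm (mulr_gt0 st ct)) /F.
  rewrite lef_pV2 ?posrE ?mulr_gt0// ?spos ?cpos// ler_pM2l//.
  have pl : t0 \in `[(- (pi / 2)), pi / 2] /\ t \in `[(- (pi / 2)), pi / 2].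
    by rewrite !in_itv /=; split; apply/andP; split; lra.
  have pc : t1 \in `[0, pi] /\ t \in `[0, pi].
    by rewrite !in_itv /=; split; apply/andP; split; lra.
  apply: ler_pM; rewrite ?(ltW (spos _ _ _)) ?(ltW (cpos _ _ _))//.
    by rewrite leNgt ltr_sin ?pl.1 ?pl.2// -leNgt.
  by rewrite leNgt ltr_cos ?pc.1 ?pc.2// -leNgt.
apply: HL.
  rewrite (le_trans (ler_normD _ _))// !normrZ.
  have := cos_max t; have := sin_max t => h1 h2.
  have k1 : `|cos t| * `|Y| <= `|Y| by rewrite ler_piMl.
  have k2 : `|sin t| * `|Z| <= `|Z| by rewrite ler_piMl.
  by rewrite (le_trans (lerD k1 k2))// lerDl sqrtr_ge0.
rewrite (le_trans (norm_le_farthest pmax (level_sub Kq)))// lerDr addr_ge0//.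
Qed.

(** Running an arc backwards is running forwards the arc of the exchanged pair, at the angles pi / 2
    - t. *)
Lemma arc_all Y Z a b (t0 t1 : R) : split_pair Y Z a b -> a != b ->
  0 < t0 -> t0 < pi / 2 -> 0 < t1 -> t1 < pi / 2 ->
  K (cos t0 *: Y + sin t0 *: Z) -> K (cos t1 *: Y + sin t1 *: Z).
Proof.
move=> sp ab t00 t0p t10 t1p K0.
have [t01|t10'] := leP t0 t1; first exact: (arc_forward sp ab t00 t01 t1p K0).
have cs t : cos (pi / 2 - t) = sin t by rewrite -(cosN (pi / 2 - t)) opprB cosBpihalf.
have sc t : sin (pi / 2 - t) = cos t by rewrite -[pi / 2 - t]opprB sinN sinBpihalf opprK.
have := @arc_forward Z Y b a (pi / 2 - t0) (pi / 2 - t1) (split_pair_sym sp).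
rewrite !cs !sc ![sin _ *: _ + _]addrC => H; apply: H; rewrite // 1?eq_sym//; lra.
Qed.

End Level.

End Arcs.

(** * Elliptic arcs through a farthest point *)

Section Normalization.
Variable R : realType.
Notation V4 := 'rV[R]_4.

(** The scaling for which l times the squared length is 1, as [split_pair] demands. *)
Definition normalize (l : R) (z : V4) := (Num.sqrt (l * dot z z))^-1 *: z.

Lemma normalize_continuous l (z : V4) : 0 < l -> z != 0 ->
  {for z, continuous (normalize l)}.
Proof.
move=> l0 z0; have idz : y @[y --> z] --> z by exact: cvg_id.
have zz := dot_gt0 z0.
have cl : l * dot y y @[y --> z] --> l * dot z z.
  exact: (cvgM (cvg_cst l) (cvg_dot4 idz idz)).
have cs : Num.sqrt (l * dot y y) @[y --> z] --> Num.sqrt (l * dot z z).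
  exact: (cvg_comp _ _ cl (@sqrt_continuous R (l * dot z z))).
have s0 : Num.sqrt (l * dot z z) != 0 by rewrite gt_eqF// sqrtr_gt0 mulr_gt0.
have ci : (Num.sqrt (l * dot y y))^-1 @[y --> z] --> (Num.sqrt (l * dot z z))^-1 by exact: cvgV s0 cs.
exact (cvgZ ci idz).
Qed.

Lemma normalize_near l (z : V4) (r : R) : 0 < l -> z != 0 -> 0 < r ->
  exists2 d : R, 0 < d & forall y, `|y - z| < d -> y != 0 /\ `|normalize l y - normalize l z| < r.
Proof.
move=> l0 z0 r0.
have /cvgrPdist_lt/(_ _ r0)/nbhs_ballP[d /= d0 Hd] := normalize_continuous l0 z0.
have nz : 0 < `|z| by rewrite normr_gt0.
exists (Num.min d `|z|) => [|y]; first by rewrite lt_min d0.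
rewrite lt_min => /andP[yd yz]; split.
  by apply: contraTneq yz => ->; rewrite sub0r normrN ltxx.
by rewrite distrC; apply: Hd; rewrite -ball_normE /= distrC.
Qed.

Lemma normalizeZ l (c : R) (z : V4) : 0 < c -> 0 < l -> normalize l (c *: z) = normalize l z.
Proof.
move=> c0 l0; rewrite /normalize dotZl dotZr scalerA.
have -> : l * (c * (c * dot z z)) = c ^+ 2 * (l * dot z z) by ring.
rewrite sqrtrM ?sqr_ge0// sqrtr_sqr gtr0_norm// invfM mulrAC mulVf ?mul1r// gt_eqF//.
Qed.

Lemma normalizeN l (z : V4) : normalize l (- z) = - normalize l z.
Proof. by rewrite /normalize dotNl dotNr opprK scalerN. Qed.

Lemma normalize_unit l (z : V4) : 0 < l -> z != 0 ->
  l * dot (normalize l z) (normalize l z) = 1.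
Proof.
move=> l0 z0; have zz := mulr_gt0 l0 (dot_gt0 z0).
rewrite /normalize dotZl dotZr.
have -> : l * ((Num.sqrt (l * dot z z))^-1 * ((Num.sqrt (l * dot z z))^-1 * dot z z)) =
  (l * dot z z) / (Num.sqrt (l * dot z z)) ^+ 2 by rewrite -exprVn; ring.
by rewrite sqr_sqrtr ?(ltW zz)// divff// gt_eqF.
Qed.

Lemma normalizeK l (z : V4) : 0 < l -> z != 0 ->
  z = Num.sqrt (l * dot z z) *: normalize l z.
Proof.
move=> l0 z0; have zz := mulr_gt0 l0 (dot_gt0 z0).
by rewrite /normalize scalerA mulfV ?scale1r// gt_eqF// sqrtr_gt0.
Qed.

Lemma norm_J_le (u : V4) : `|J u| <= `|u|.
Proof.
apply: norm_rV_le => // i; have [a b c d] := JE u.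
rewrite -[i]inord_val; case: i => -[|[|[|[|m]]]] //= _; rewrite ?a ?b ?c ?d ?normrN; exact: coord_norm.
Qed.

End Normalization.

Section Direction.
Variable R : realType.
Notation V4 := 'rV[R]_4.
Variables (S : set V4) (p : V4).
Hypothesis Sc : locally_charted S.
Hypothesis cS : compact S.
Hypothesis Sp : S p.
Hypothesis pmax : forall q, S q -> dot q q <= dot p p.

Let p0 : p != 0. Proof. exact: (farthest_neq0 Sc Sp pmax). Qed.
Let s0 : 0 < dot p p. Proof. exact: dot_gt0. Qed.
Let sn0 : dot p p != 0. Proof. by rewrite gt_eqF. Qed.
Notation K := (level S p).
Notation l1 := (dot p p)^-1.
Notation l2 := (1 - (dot p p)^-1).

Definition along (x : V4) := (dot x p / dot p p) *: p + (dot x (J p) / dot p p) *: J p.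
Definition across (x : V4) := x - along x.

Lemma along_linear (a : R) x y : along (a *: x + y) = a *: along x + along y.
Proof.
rewrite /along !dotDl !dotZl; apply/rowP => i; rewrite !mxE.
by move: (J p 0 i) => j; field.
Qed.

Lemma across_linear (a : R) x y : across (a *: x + y) = a *: across x + across y.
Proof.
rewrite /across along_linear; apply/rowP => i; rewrite !mxE.
by move: (along x 0 i) (along y 0 i) => *; ring.
Qed.

Lemma alongP x : [/\ Pvec p (along x) = l1 *: along x, Pvec p (across x) = l2 *: across x,
  dot (along x) (across x) = 0 & along x + across x = x].
Proof.
have xp : dot p (across x) = 0.
  by rewrite /across /along dotBr dotDr !dotZr dotuJ (dotC x p); field.
have xJp : dot (J p) (across x) = 0.
  by rewrite /across /along dotBr dotDr !dotZr dotJu dotJJ (dotC x (J p)); field.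
split.
- rewrite /along PvecD !PvecZ Pvec_J Pvec_line// JZ; apply/rowP => i; rewrite !mxE.
  by move: (J p 0 i) => j; field.
- exact: Pvec_perp.
- by rewrite /along dotDl !dotZl xp xJp !mulr0 addr0.
- by rewrite /across addrC subrK.
Qed.

Lemma along_norm : exists2 C : R, 0 < C & forall x, `|along x| <= C * `|x| /\ `|across x| <= C * `|x|.
Proof.
pose B := 4 * `|p| * `|p| / dot p p + 4 * `|J p| * `|J p| / dot p p.
have B0 : 0 <= B by rewrite addr_ge0// divr_ge0 ?(ltW s0)// !mulr_ge0.
have hz (z x : V4) : `|(dot x z / dot p p) *: z| <= 4 * `|z| * `|z| / dot p p * `|x|.
  rewrite normrZ normrM normfV (gtr0_norm s0) [leRHS]mulrAC [leLHS]mulrAC ler_pM2r ?invr_gt0//.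
  rewrite (le_trans (ler_wpM2r (normr_ge0 z) (dot_norm_le x z)))//.
  by rewrite [leLHS](_ : _ = 4 * `|z| * `|z| * `|x|)//; ring.
have hB x : `|along x| <= B * `|x|.
  by rewrite (le_trans (ler_normD _ _))// /B mulrDl lerD.
exists (B + 1) => [|x]; first by rewrite ltr_wpDl.
split; first by rewrite (le_trans (hB x))// ler_wpM2r// lerDl.
by rewrite (le_trans (ler_normB _ _))// mulrDl mul1r addrC lerD.
Qed.

Lemma level_energy q : K q ->
  l1 * dot (along q) (along q) + l2 * dot (across q) (across q) = 1.
Proof.
move=> Kq; have := level_Pvec_self Sc Sp pmax Kq.
have [PA PB AB qE] := alongP q.
move: (along q) (across q) PA PB AB qE => u v PA PB AB <-.
by rewrite PvecD PA PB dotDl !dotDr !dotZl AB (dotC v u) AB => h; rewrite -[RHS]h; ring.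
Qed.

Variable N : V4.
Hypothesis tN : tangent S p N.
Hypothesis JpN : dot (J p) N = 0.
Hypothesis NN : dot N N = dot p p.

Let pN : dot p N = 0. Proof. exact: (farthest_normal Sc Sp pmax tN). Qed.

Let along_p : along p = p.
Proof. by rewrite /along dotuJ mul0r scale0r addr0 mulfV// scale1r. Qed.

Let across_N : across N = N.
Proof.
by rewrite /across /along (dotC N) pN (dotC N) JpN !mul0r !scale0r addr0 subr0.
Qed.

Let across_p : across p = 0. Proof. by rewrite /across along_p subrr. Qed.

Let level_tangent_N : tangent K p N.
Proof.
have [r r0 Hr] := level_open Sc (level_farthest Sc Sp pmax).
exact: (tangent_open_subset r0 Hr tN).
Qed.

Let N0 : N != 0.
Proof. by apply: contraPneq NN => ->; rewrite dot0l => /esym/eqP; rewrite (negbTE sn0). Qed.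

(** [Gfield] vanishes at p, so its flow cannot leave p. The tangent direction N supplies instead
    points of the level set whose component off the complex line of p is about h N. *)
Lemma level_near_N (d1 d2 : R) : 0 < d1 -> 0 < d2 ->
  exists h q, [/\ 0 < h, K q, `|along q - p| < d1 & `|h^-1 *: across q - N| < d2].
Proof.
move=> d10 d20; have [C C0 HC] := along_norm.
have n1 : 0 < `|N| + 1 by rewrite ltr_wpDl.
pose e := Num.min 1 (Num.min (d1 / (C * (`|N| + 1))) (d2 / (2 * C))).
have e0 : 0 < e by rewrite !lt_min ltr01 !divr_gt0// mulr_gt0.
have e1 : e <= 1 by rewrite ge_min lexx.
have ed1 : e * (C * (`|N| + 1)) <= d1.
  by rewrite -ler_pdivlMr ?mulr_gt0// !ge_min lexx !orbT.
have ed2 : e * (2 * C) <= d2.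
  by rewrite -ler_pdivlMr ?mulr_gt0// !ge_min lexx !orbT.
have [h [q [h0 he Kq Hq]]] := level_tangent_N e0.
set r := q - _ in Hq.
have qE : q = h *: N + r + p.
  by rewrite /r; apply/rowP => i; rewrite !mxE; ring.
clearbody r; exists h, q; split=> //.
  have -> : along q - p = along (h *: N + r).
    by rewrite qE -{1}[h *: N + r]scale1r along_linear along_p scale1r addrK.
  rewrite (le_lt_trans (HC _).1)//.
  have : `|h *: N + r| <= h * (`|N| + 1).
    rewrite (le_trans (ler_normD _ _))// normrZ (gtr0_norm h0) mulrDr lerD2l mulr1.
    by rewrite (le_trans Hq)// ler_piMl// ltW.
  move=> h1; apply: (@le_lt_trans _ _ (C * (h * (`|N| + 1)))); first by rewrite ler_pM2l.
  by apply: lt_le_trans ed1; rewrite mulrCA ltr_pM2r// mulr_gt0.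
have -> : h^-1 *: across q - N = h^-1 *: across r.
  rewrite qE -addrA across_linear across_N -[r]scale1r across_linear across_p addr0 !scale1r.
  by rewrite scalerDr scalerA mulVf ?gt_eqF// scale1r addrC addKr.
rewrite normrZ normfV gtr0_norm// mulrC ltr_pdivrMr//.
apply: (@le_lt_trans _ _ (C * (e * h))).
  by rewrite (le_trans (HC r).2)// ler_pM2l.
rewrite mulrA ltr_pM2r//; apply: lt_le_trans ed2.
rewrite (_ : e * (2 * C) = C * e + C * e); last by ring.
by rewrite ltrDl mulr_gt0.
Qed.

(** For a point near p, let a and b be the squared lengths of its components on and off the complex
    line of p. Then l1 a + l2 b = 1 and l1 (a + b) <= l1 |p|^2 = 1 give (l2 - l1) b >= 0 with b > 0,
    hence l1 <= l2. *)
Lemma farthest_ge2 : 2 <= dot p p.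
Proof.
have nN : 0 < `|N| by rewrite normr_gt0.
have [h [q [h0 Kq _ Bq]]] := level_near_N ltr01 nN.
have B0 : across q != 0.
  by apply: contraTneq Bq => ->; rewrite scaler0 sub0r normrN ltxx.
have BB := dot_gt0 B0; have en := level_energy Kq.
have qs := pmax (level_sub Kq).
have [_ _ AB qE] := alongP q.
move: (along q) (across q) BB en AB qE => u v BB en AB qE.
move: qs; rewrite -qE !dotDl !dotDr (dotC v u) AB addr0 add0r.
move: (dot u u) (dot v v) BB en => a b b0 en ab.
have s1 : dot p p * (dot p p)^-1 = 1 by rewrite mulfV.
have : 0 <= (1 - (dot p p)^-1 - (dot p p)^-1) * b.
  have -> : (1 - (dot p p)^-1 - (dot p p)^-1) * b =
     (dot p p)^-1 * (dot p p - (a + b)) + (1 - dot p p * (dot p p)^-1) +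
     ((dot p p)^-1 * a + (1 - (dot p p)^-1) * b - 1) by ring.
  rewrite en s1 subrr addr0 addr0 mulr_ge0 ?invr_ge0 ?(ltW s0)// subr_ge0//.
rewrite pmulr_lge0// => h1.
have h2 : 0 <= dot p p * (1 - (dot p p)^-1 - (dot p p)^-1) by rewrite mulr_ge0 ?(ltW s0).
have : dot p p * (1 - (dot p p)^-1 - (dot p p)^-1) = dot p p - 2.
  by rewrite !mulrBr mulr1 s1; ring.
by move=> E; rewrite E subr_ge0 in h2.
Qed.

Lemma l2_gt0 : 0 < l2.
Proof.
have h := farthest_ge2; rewrite subr_gt0 invf_lt1// (lt_le_trans _ h)//.
by rewrite ltr1n.
Qed.

(** A point q of the level set near p in the direction N lies on the ellipse of a pair (Y, Z) close
    to (p, [normalize l2 N]). [arc_all] moves q along it to the angle t, and q then tends to p. *)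
Lemma half_arc (t : R) : 2 < dot p p -> 0 < t -> t < pi / 2 ->
  K (cos t *: p + sin t *: normalize l2 N).
Proof.
move=> s2 t0 tp; apply: (compact_limit (level_compact Sc cS Sp pmax)) => r r0.
have l10 : 0 < l1 by rewrite invr_gt0.
have l20 := l2_gt0.
have r20 : 0 < r / 2 by rewrite divr_gt0.
have [d1 d10 H1] := normalize_near l10 p0 r20.
have [d2 d20 H2] := normalize_near l20 N0 r20.
have [h [q [h0 Kq Aq Bq]]] := level_near_N d10 d20.
have [A0 HA] := H1 _ Aq; have [B0' HB] := H2 _ Bq.
have hi : 0 < h^-1 by rewrite invr_gt0.
rewrite normalizeZ// in HB.
have B0 : across q != 0 by apply: contraNneq B0' => ->; rewrite scaler0.
have Np : normalize l1 p = p by rewrite /normalize mulVf// sqrtr1 invr1 scale1r.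
rewrite Np in HA.
have [PA PB AB qE] := alongP q.
pose Y := normalize l1 (along q); pose Z := normalize l2 (across q).
have sp : split_pair p Y Z l1 l2.
  split.
  - by rewrite PvecZ PA scalerA mulrC -scalerA.
  - by rewrite PvecZ PB scalerA mulrC -scalerA.
  - by rewrite dotZl dotZr AB !mulr0.
  - exact: normalize_unit.
  - exact: normalize_unit.
have l12 : l1 != l2.
  apply/eqP => E; have : dot p p * (1 - l1) = dot p p * l1 by rewrite -E.
  by rewrite mulrBr mulr1 mulfV// => E2; move: s2; rewrite -(subrK 1 (dot p p)) E2 ltxx.
have en := level_energy Kq.
pose c := Num.sqrt (l1 * dot (along q) (along q)).
have aa := mulr_gt0 l10 (dot_gt0 A0); have bb := mulr_gt0 l20 (dot_gt0 B0).
have c0 : 0 < c by rewrite sqrtr_gt0.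
have c2 : c ^+ 2 = l1 * dot (along q) (along q) by rewrite sqr_sqrtr// ltW.
have c1 : c < 1.
  rewrite -sqrtr1 ltr_sqrt// -en ltrDl//.
have ci : -1 <= c <= 1 by rewrite (ltW c1) andbT (le_trans _ (ltW c0))// lerN10.
(* By [level_energy] the lengths of the two components, measured in units of Y and Z, are the cosine
   and sine of one angle u. *)
pose u := acos c; have cu : cos u = c by rewrite acosK// in_itv.
have su : sin u = Num.sqrt (l2 * dot (across q) (across q)).
  rewrite /u sin_acos// c2; congr Num.sqrt; apply/eqP.
  by rewrite subr_eq addrC eq_sym; apply/eqP.
have u0 : 0 < u by apply: acos_gt0; rewrite c1 andbT; case/andP: ci.
have up : u < pi / 2.
  rewrite ltNge; apply/negP => hu.
  have : cos u <= cos (pi / 2).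
    have ui : u \in `[0, pi] by rewrite in_itv /= (ltW u0) acos_lepi.
    have pii : (pi / 2 : R) \in `[0, pi].
      by rewrite in_itv /= divr_ge0 ?pi_ge0//= ler_pdivrMr// ler_peMr ?pi_ge0 ?ler1n.
    by rewrite leNgt ltr_cos// -leNgt.
  by rewrite cos_pihalf cu leNgt c0.
exists (cos t *: Y + sin t *: Z).
  apply: (arc_all Sc cS Sp pmax sp l12 u0 up t0 tp).
  by rewrite cu su -!normalizeK// qE.
have -> : cos t *: Y + sin t *: Z - (cos t *: p + sin t *: normalize l2 N) =
   cos t *: (Y - p) + sin t *: (Z - normalize l2 N).
  by apply/rowP => i; rewrite !mxE; move: (Y 0 i) (Z 0 i) (normalize l2 N 0 i) => *; ring.
rewrite (le_lt_trans (ler_normD _ _))// !normrZ (splitr r); apply: ltrD.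
  by rewrite (le_lt_trans _ HA)// ler_piMl// cos_max.
by rewrite (le_lt_trans _ HB)// ler_piMl// sin_max.
Qed.

End Direction.

Section NoEllipse.
Variable R : realType.
Notation V4 := 'rV[R]_4.

(** The curve is required to lie in S only for h > 0: the limit point k 0 need not yet be known to
    belong to S. *)
Lemma curve_tangent (S : set V4) (k : R -> V4) (W : V4) (h0 : R) : 0 < h0 ->
  is_derive (0 : R) (1 : R) k W -> (forall h, 0 < h -> h < h0 -> S (k h)) -> tangent S (k 0) W.
Proof.
move=> h00 dk Sk e e0; have [r r0 Hr] := is_derive_expand dk e0.
pose m := Num.min h0 (Num.min r e).
have m0 : 0 < m by rewrite !lt_min h00 r0.
have m20 : 0 < m / 2 by rewrite divr_gt0.
have : m / 2 < m by rewrite ltr_pdivrMr// ltr_pMr// ltr1n.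
rewrite {2}/m !lt_min => /and3P[mh mr me].
exists (m / 2), (k (m / 2)); split=> //; first exact: Sk.
have := Hr (m / 2); rewrite gtr0_norm// add0r => /(_ mr).
by rewrite opprD addrA.
Qed.

Variables (S : set V4) (p : V4).
Hypothesis Sc : locally_charted S.
Hypothesis cS : compact S.
Hypothesis Sp : S p.
Hypothesis pmax : forall q, S q -> dot q q <= dot p p.

Let p0 : p != 0. Proof. exact: (farthest_neq0 Sc Sp pmax). Qed.
Let s0 : 0 < dot p p. Proof. exact: dot_gt0. Qed.
Notation K := (level S p).
Notation l1 := (dot p p)^-1.
Notation l2 := (1 - (dot p p)^-1).

(** On an eigenvector J P0 generates rotation within a complex line, with the eigenvalue as angular
    speed, so the integral curve is explicit. *)
Lemma level_JP_flow (y z : V4) (a b t : R) : Pvec p y = a *: y -> Pvec p z = b *: z ->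
  0 <= t -> K (y + z) ->
  K ((cos (a * t) *: y + sin (a * t) *: J y) + (cos (b * t) *: z + sin (b * t) *: J z)).
Proof.
move=> Py Pz t0 Kyz.
have [C C0 HC] := Pvec_norm p.
have dlin (c u : R) : is_derive u (1 : R) (fun s : R => c * s) c.
  have := is_deriveZ c (is_derive_id u (1 : R)).
  by move=> h; apply: (is_derive_eqR h); rewrite /GRing.scale /= mulr1.
have dc c u : is_derive u (1 : R) (fun s : R => cos (c * s)) (- sin (c * u) * c).
  exact: (is_derive1_comp (is_derive_cos (c * u)) (dlin c u)).
have ds c u : is_derive u (1 : R) (fun s : R => sin (c * s)) (cos (c * u) * c).
  exact: (is_derive1_comp (is_derive_sin (c * u)) (dlin c u)).
pose g s := (cos (a * s) *: y + sin (a * s) *: J y) + (cos (b * s) *: z + sin (b * s) *: J z).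
pose dg s := ((- sin (a * s) * a) *: y + (cos (a * s) * a) *: J y) +
   ((- sin (b * s) * b) *: z + (cos (b * s) * b) *: J z).
have g0 : g 0 = y + z.
  by rewrite /g !mulr0 cos0 sin0 !scale0r !scale1r !addr0.
have dgE s : dg s = J (Pvec p (g s)).
  rewrite /dg /g !PvecD !PvecZ !Pvec_J Py Pz !JZ !JD !JZ !JJ.
  apply/rowP => i; rewrite !mxE; move: (J y 0 i) (J z 0 i) => *; ring.
have cK : compact K by exact: (level_compact Sc cS Sp pmax).
have Kg0 : K (g 0) by rewrite g0.
have dg' (s : R) : 0 <= s -> s <= t -> is_derive s (1 : R) g (dg s).
  move=> _ _; have := is_derive_addl (is_derive_comb y (J y) (dc a s) (ds a s))
    (is_derive_comb z (J z) (dc b s) (ds b s)).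
  exact.
have Hv (s : R) q : 0 <= s -> s <= t -> K q ->
    exists2 v, strong_tangent K q v & `|dg s - v| <= C * `|g s - q|.
  move=> _ _ Kq; exists (J (Pvec p q)).
    apply: (level_strong_tangent Sc Kq).
    exact: (level_JP_tangent Sc Sp pmax Kq).
  by rewrite dgE -JB -PvecB (le_trans (norm_J_le _)).
clearbody dg; exact (nagumo_invariance cK t0 (ltW C0) dg' Kg0 Hv).
Qed.

Variable N : V4.
Hypothesis tN : tangent S p N.
Hypothesis JpN : dot (J p) N = 0.
Hypothesis NN : dot N N = dot p p.

(* If |p|^2 > 2 the arcs from p in the directions N and -N reach M and -M, and
   the flow of J P brings -M back to M while turning the direction p by an angle
   in (0, pi): the tangent plane at M would contain two directions of one complex
   line. *)
Lemma farthest_sqr_le2 : dot p p <= 2.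
Proof.
rewrite leNgt; apply/negP => s2.
have tN' : tangent S p (- N) by rewrite -scaleN1r; exact: (tangentZ Sc _ Sp tN).
have JpN' : dot (J p) (- N) = 0 by rewrite dotNr JpN oppr0.
have NN' : dot (- N) (- N) = dot p p by rewrite dotNl dotNr opprK.
have l20 : 0 < l2 := l2_gt0 Sc Sp pmax tN JpN NN.
have pi0 := @pi_gt0 R.
set M := normalize l2 N.
have pN : dot p N = 0 := farthest_normal Sc Sp pmax tN.
have PM : Pvec p M = l2 *: M by rewrite /M /normalize PvecZ Pvec_perp// scalerA mulrC -scalerA.
have Pp : Pvec p p = l1 *: p by exact: Pvec_line.
have cE (h : R) : cos (pi / 2 - h) = sin h by rewrite -opprB cosN cosBpihalf.
have sE (h : R) : sin (pi / 2 - h) = cos h by rewrite -opprB sinN sinBpihalf opprK.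
have Kp (h : R) : 0 < h -> h < pi / 2 -> K (sin h *: p + cos h *: M).
  move=> h0 hp; have := half_arc Sc cS Sp pmax tN JpN NN (t := pi / 2 - h) s2.
  rewrite cE sE.
  by apply; lra.
have Km (h : R) : 0 < h -> h < pi / 2 -> K (sin h *: p + (- cos h) *: M).
  move=> h0 hp; have := half_arc Sc cS Sp pmax tN' JpN' NN' (t := pi / 2 - h) s2.
  rewrite cE sE.
  by rewrite normalizeN scalerN -scaleNr; apply; lra.
have zca (a b : R) (z : V4) : a *: (b *: z) = b *: (a *: z) by rewrite !scalerA mulrC.
(* In time pi / l2 the flow makes a half turn off the line of p, taking - M to M, while the line of
   p turns by th; 0 < th < pi because l1 < 1/2 < l2. *)
pose th := l1 * (pi / l2).
have Kt (h : R) : 0 < h -> h < pi / 2 ->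
    K (sin h *: (cos th *: p + sin th *: J p) + cos h *: M).
  move=> h0 hp.
  have e1 : Pvec p (sin h *: p) = l1 *: (sin h *: p) by rewrite PvecZ Pp zca.
  have e2 : Pvec p ((- cos h) *: M) = l2 *: ((- cos h) *: M) by rewrite (PvecZ p _ M) PM zca.
  have t0 : 0 <= pi / l2 by rewrite divr_ge0 ?(ltW pi0) ?(ltW l20).
  have := level_JP_flow e1 e2 t0 (Km h h0 hp).
  have -> : l2 * (pi / l2) = pi by rewrite mulrCA mulfV ?gt_eqF// mulr1.
  rewrite cospi sinpi scale0r addr0 scaleN1r scaleNr opprK.
  by rewrite -/th JZ scalerDr !scalerA (mulrC (sin h)) (mulrC (sin h)).
have dsin : is_derive (0 : R) (1 : R) (@sin R) 1.
  by apply: is_derive_eqR (is_derive_sin 0) _; rewrite cos0.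
have dcos : is_derive (0 : R) (1 : R) (@cos R) 0.
  by apply: is_derive_eqR (is_derive_cos 0) _; rewrite sin0 oppr0.
have pi20 : 0 < (pi / 2 : R) by rewrite divr_gt0.
have tan W : (forall h : R, 0 < h -> h < pi / 2 -> K (sin h *: W + cos h *: M)) -> tangent S M W.
  move=> KW; have dk : is_derive (0 : R) (1 : R) (fun h => sin h *: W + cos h *: M) W.
    have := is_derive_comb W M dsin dcos; by rewrite scale1r scale0r addr0.
  have /(_ S) := curve_tangent pi20 dk; rewrite sin0 cos0 scale0r scale1r add0r.
  by apply=> h h0 hp; exact: (level_sub (KW h h0 hp)).
have t1 := tan _ Kp; have t2 := tan _ Kt.
have SM : S M.
  apply: (compact_limit cS) => r r0.
  have dk : is_derive (0 : R) (1 : R) (fun h => sin h *: p + cos h *: M) p.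
    have := is_derive_comb p M dsin dcos; by rewrite scale1r scale0r addr0.
  have /(_ S) := curve_tangent pi20 dk; rewrite sin0 cos0 scale0r scale1r add0r.
  have SK h : 0 < h -> h < pi / 2 -> S (sin h *: p + cos h *: M).
    by move=> h0 hp; exact: (level_sub (Kp h h0 hp)).
  move=> /(_ SK) tM; have c0 : 0 < `|p| + 1 by rewrite ltr_wpDl.
  pose e := Num.min 1 (r / (`|p| + 1)).
  have e0 : 0 < e by rewrite lt_min ltr01 divr_gt0.
  have [h [q [h0 he Sq Hq]]] := tM e e0; exists q => //.
  have -> : q - M = (q - (M + h *: p)) + h *: p by rewrite opprD addrA subrK.
  rewrite (le_lt_trans (ler_normD _ _))// normrZ gtr0_norm//.
  apply: (@le_lt_trans _ _ (h * (`|p| + 1))).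
    rewrite mulrDr mulr1 addrC lerD2l (le_trans Hq)// ler_piMl ?(ltW h0)//.
    by rewrite ge_min lexx.
  by rewrite -ltr_pdivlMr// (lt_le_trans he)// ge_min lexx orbT.
have := tangent_lagrangian Sc SM t1 t2.
rewrite JD !JZ JJ dotDr !dotZr dotuJ dotNr mulr0 add0r mulrN => /eqP.
rewrite oppr_eq0 mulf_eq0 (gt_eqF s0) orbF gt_eqF//.
apply: sin_gt0_pi; rewrite mulr_gt0 ?divr_gt0 ?invr_gt0//=.
rewrite /th mulrCA gtr_pMr// mulrC ltr_pdivrMl// mulr1 ltrBrDl.
have s1 : 1 < dot p p by rewrite (lt_trans _ s2)// ltr1n.
have : l1 < 2^-1 by rewrite ltf_pV2 ?posrE//.
by move=> h; rewrite -(ltr_pM2r (x := 2^-1)) in h * => //; lra.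
Qed.

Lemma farthest_sqr_eq2 : dot p p = 2.
Proof.
by apply/eqP; rewrite eq_le farthest_sqr_le2 (farthest_ge2 Sc Sp pmax tN JpN NN).
Qed.

End NoEllipse.

(** * Tori in the round case *)

Section RoundCase.
Variable R : realType.
Notation V4 := 'rV[R]_4.

(** The angle is taken nonnegative because invariance is proved forward in time only. *)
Lemma polar_angle (c s : R) : c ^+ 2 + s ^+ 2 = 1 ->
  exists t : R, [/\ 0 <= t, cos t = c & sin t = s].
Proof.
move=> cs; have c1 : -1 <= c <= 1.
  by have s2 := sqr_ge0 s; apply/andP; split; nra.
have ca : cos (acos c) = c by rewrite acosK// in_itv.
have sa : sin (acos c) = `|s|.
  by rewrite sin_acos// -sqrtr_sqr -cs addrAC subrr add0r.
have [s0|s0] := lerP 0 s.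
  by exists (acos c); rewrite acos_ge0// ca sa ger0_norm.
have a2 : acos c <= pi by exact: acos_lepi.
have pi0 := @pi_gt0 R.
exists (- acos c + pi *+ 2); split.
- by rewrite addrC subr_ge0 (le_trans a2)// mulr2n lerDl ltW.
- by rewrite cosD2pi cosN ca.
- by rewrite sinD2pi sinN sa ltr0_norm// opprK.
Qed.

Section Torus.
Variables p N : V4.

(* For a unitary frame p/sqrt 2, N/sqrt 2 this is the product of two unit circles
   in the complex lines spanned by p + J N and p - J N. *)
Definition torus := [set x : V4 | dot x x = 2 /\
  dot p x * dot (J N) x = dot (J p) x * dot N x].

(** This is x -> - J (L0 x), with L0 the operator of [Lform] for V = - J p and N. At a point of
    [twist_level] its value is the frame vector there. *)
Definition rotation_field (x : V4) : V4 := 2^-1 *: (dot p x *: N - dot N x *: p +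
  (dot (J p) x *: J N - dot (J N) x *: J p)).

Lemma rotation_fieldB x y :
  rotation_field (x - y) = rotation_field x - rotation_field y.
Proof.
rewrite /rotation_field !dotBr; apply/rowP => i; rewrite !mxE.
by move: (J p 0 i) (J N 0 i) => *; ring.
Qed.

Lemma rotation_field_norm : exists2 L : R, 0 <= L &
  forall x, `|rotation_field x| <= L * `|x|.
Proof.
pose B := 4 * `|p| * `|N| + 4 * `|N| * `|p| + (4 * `|J p| * `|J N| + 4 * `|J N| * `|J p|).
have hz (z u x : V4) : `|dot z x *: u| <= 4 * `|z| * `|u| * `|x|.
  rewrite normrZ (le_trans (ler_wpM2r (normr_ge0 u) (dot_norm_le z x)))//.
  by rewrite mulrAC.
exists (2^-1 * B) => [|x]; first by rewrite mulr_ge0// !addr_ge0 ?mulr_ge0.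
rewrite normrZ gtr0_norm// -mulrA ler_pM2l// /B.
rewrite (le_trans (ler_normD _ _))//.
pose k (z u : V4) := 4 * `|z| * `|u| * `|x|.
have hB (a b c d : V4) : `|dot a x *: b - dot c x *: d| <= k a b + k c d.
  exact: (le_trans (ler_normB _ _) (lerD (hz _ _ _) (hz _ _ _))).
rewrite [leRHS](_ : _ = (k p N + k N p) + (k (J p) (J N) + k (J N) (J p))); last by rewrite /k; ring.
exact: (lerD (hB _ _ _ _) (hB _ _ _ _)).
Qed.

Hypothesis pp : dot p p = 2.
Hypothesis NN : dot N N = 2.
Hypothesis pN : dot p N = 0.
Hypothesis JpN : dot (J p) N = 0.

(** In the coordinates a + i c and b + i d of x, the torus equation a d = c b says that (a, c) and
    (b, d) are parallel. The pair then factors as a unit complex number times a real unit vector,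
    which gives the two angles. *)
Lemma torus_param x : torus x -> exists a b : R, [/\ 0 <= a, 0 <= b &
  x = cos a *: (cos b *: p + sin b *: N) + sin a *: J (cos b *: p + sin b *: N)].
Proof.
have n2 : (2 : R) != 0 by rewrite pnatr_eq0.
have pJN : dot p (J N) = 0 by rewrite dotJr JpN oppr0.
have E := unitary_expand n2 pp NN pN pJN x.
have D := unitary_dot n2 pp NN pN pJN x x.
move=> [xx]; rewrite xx in D.
rewrite (dotC p) (dotC (J N)) (dotC (J p)) (dotC N).
move: D E; set a' := dot x p; set b' := dot x N; set c' := dot x (J p); set d' := dot x (J N).
move=> D E Q.
pose a := a' / 2; pose b := b' / 2; pose c := c' / 2; pose d := d' / 2.
rewrite -/a -/b -/c -/d in E.
have nn : (a ^+ 2 + c ^+ 2) + (b ^+ 2 + d ^+ 2) = 1.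
  transitivity ((a' * a' + b' * b' + c' * c' + d' * d') / 2 / 2).
    by rewrite /a /b /c /d; field.
  by rewrite -D divff.
have ad : a * d = c * b.
  transitivity (a' * d' / 2 / 2); first by rewrite /a /d; field.
  by rewrite Q /b /c; field.
clearbody a b c d.
have fin u v w z : u ^+ 2 + v ^+ 2 = 1 -> w ^+ 2 + z ^+ 2 = 1 ->
   a = u * w -> c = v * w -> b = u * z -> d = v * z ->
   exists al be : R, [/\ 0 <= al, 0 <= be &
  x = cos al *: (cos be *: p + sin be *: N) + sin al *: J (cos be *: p + sin be *: N)].
  move=> /polar_angle[al [al0 <- <-]] /polar_angle[be [be0 <- <-]] ea ec eb ed.
  exists al, be; split=> //; rewrite E ea ec eb ed JD !JZ.
  apply/rowP => i; rewrite !mxE; move: (J p 0 i) (J N 0 i) => *; ring.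
have [z0|z0] := eqVneq (a ^+ 2 + c ^+ 2) 0.
  move/eqP: z0; rewrite paddr_eq0 ?sqr_ge0// !sqrf_eq0 => /andP[/eqP a0 /eqP c0].
  apply: (fin b d 0 1); rewrite ?mulr0 ?mulr1//.
  - by rewrite -nn a0 c0 expr0n /= !add0r.
  - by rewrite expr0n expr1n add0r.
have zp : 0 < a ^+ 2 + c ^+ 2 by rewrite lt0r z0 addr_ge0 ?sqr_ge0.
pose r := Num.sqrt (a ^+ 2 + c ^+ 2).
have r2 : r ^+ 2 = a ^+ 2 + c ^+ 2 by rewrite sqr_sqrtr ?(ltW zp).
have r0 : r != 0 by rewrite gt_eqF// sqrtr_gt0.
have r20 : r ^+ 2 != 0 by rewrite r2.
apply: (fin (a / r) (c / r) r ((a * b + c * d) / r)).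
- by rewrite !expr_div_n -mulrDl -r2 divff.
- apply: (mulIf r20); rewrite mulrDl expr_div_n divfK// mul1r -expr2 -[RHS]mulr1 -nn.
  have -> : (a * b + c * d) ^+ 2 = (a ^+ 2 + c ^+ 2) * (b ^+ 2 + d ^+ 2) - (a * d - c * b) ^+ 2 by ring.
  by rewrite ad subrr expr0n subr0 r2; ring.
- by rewrite divfK.
- by rewrite divfK.
- rewrite mulrACA -invfM -expr2 r2.
  have -> : a * (a * b + c * d) = (a ^+ 2 + c ^+ 2) * b + c * (a * d - c * b) by ring.
  by rewrite ad subrr mulr0 addr0 mulrC mulKf.
- rewrite mulrACA -invfM -expr2 r2.
  have -> : c * (a * b + c * d) = (a ^+ 2 + c ^+ 2) * d - a * (a * d - c * b) by ring.
  by rewrite ad subrr mulr0 subr0 mulrC mulKf.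
Qed.

Lemma rotation_field_arc t :
  rotation_field (cos t *: p + sin t *: N) = - sin t *: p + cos t *: N.
Proof.
have Np : dot N p = 0 by rewrite dotC.
have JNp : dot (J N) p = 0 by rewrite dotC dotJr JpN oppr0.
rewrite /rotation_field !dotDr !dotZr pp NN pN JpN Np JNp !dotJu.
by apply/rowP => i; rewrite !mxE; field.
Qed.

End Torus.

Variables (S : set V4) (p : V4).
Hypothesis Sc : locally_charted S.
Hypothesis cS : compact S.
Hypothesis Sp : S p.
Hypothesis pmax : forall q, S q -> dot q q <= dot p p.
Hypothesis pp : dot p p = 2.
Notation K := (level S p).

(** Now P0 is half the identity: <P0 q, q> = 1 gives |q|^2 = 2, and q - T is a multiple of q, so T
    is both parallel and orthogonal to q. *)
Lemma level_round q : K q -> tangent_part S q 0 /\ dot q q = 2.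
Proof.
move=> Kq; have n2 : (2 : R) != 0 by rewrite pnatr_eq0.
have PE x : Pvec p x = 2^-1 *: x.
  rewrite /Pvec pp divff// subrr mul0r scale0r addr0; congr (_ *: _); lra.
have := level_Pvec_self Sc Sp pmax Kq; rewrite PE dotZl => qq.
have qq2 : dot q q = 2 by rewrite -[LHS](mulVKf n2) qq mulr1.
split=> //; have [T [tp Tq]] := level_tangent_part Sc Sp pmax Kq.
have w0 : 0 < dot (q - T) (q - T) by rewrite dot_gt0// subr_eq0 eq_sym.
rewrite PE; set w := dot _ _ in w0 * => /(congr1 (fun x => w *: x)).
rewrite !scalerA divff ?gt_eqF// scale1r => TE nT.
have w20 : w / 2 != 0 by rewrite mulf_neq0 ?invr_eq0// gt_eqF.
move: nT; rewrite -TE dotZl => /eqP; rewrite mulf_eq0 (negPf w20)/= => /eqP qT.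
have TE' : T = (1 - w / 2) *: q by rewrite scalerBl scale1r TE subKr.
move: qT; rewrite TE' dotZr qq2 => /eqP; rewrite mulf_eq0 (negPf n2) orbF => /eqP c0.
by rewrite TE' c0 scale0r in tp.
Qed.

Variable N : V4.
Hypothesis tN : tangent S p N.
Hypothesis JpN : dot (J p) N = 0.
Hypothesis NN : dot N N = 2.

Let pN : dot p N = 0. Proof. exact: (farthest_normal Sc Sp pmax tN). Qed.

(** The existential over N' absorbs the sign ambiguity of the frame. *)
Definition twist_level := [set q : V4 | K q /\ exists2 N', twist_frame S q (- J q) N' &
  forall x y, Lform (- J q) N' x y = Lform (- J p) N x y].
Notation K2 := twist_level.

Lemma level_tangent_J q : K q -> tangent S q (J q) /\ tangent S q (- J q).
Proof.
move=> Kq; have [tp _] := level_round Kq; have Sq := level_sub Kq.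
have := tangent_part_V Sc Sq tp; rewrite sub0r JN => tJ; split=> //.
by rewrite -[J q]opprK -scaleN1r; exact: (tangentZ Sc).
Qed.

Lemma level_twist_constant q Nq : K q -> twist_frame S q (- J q) Nq ->
  exists2 r : R, 0 < r & forall k, S k -> `|k - q| < r -> K k /\
    exists2 N', twist_frame S k (- J k) N' &
    forall x y, Lform (- J k) N' x y = Lform (- J q) Nq x y.
Proof.
move=> Kq tf; have [r0 r00 Hr] := level_open Sc Kq.
have near2 k T : S k -> `|k - q| < r0 -> tangent_part S k T -> T = 0 /\ dot k k = 2.
  move=> Sk kr tp; have [tp0 kk] := level_round (Hr k Sk kr).
  by split=> //; exact: (tangent_part_unique Sc Sk tp tp0).
have [r1 r10 Hr1] := L_locally_constant Sc (level_sub Kq) r00 near2 tf.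
exists (Num.min r0 r1) => [|k Sk]; first by rewrite lt_min r00.
by rewrite lt_min => /andP[k0 k1]; split; [exact: Hr|exact: Hr1].
Qed.

Lemma twist_level_open q : K2 q ->
  exists2 r : R, 0 < r & forall k, S k -> `|k - q| < r -> K2 k.
Proof.
move=> [Kq [N' tf LE]]; have [r r0 Hr] := level_twist_constant Kq tf.
exists r => // k Sk kr; have [Kk [N'' tf' LE']] := Hr k Sk kr.
by split=> //; exists N'' => // x y; rewrite LE' LE.
Qed.

Lemma twist_level_sub : K2 `<=` S. Proof. by move=> q [/level_sub]. Qed.

(** At a limit point q any frame vector Nq is carried to a nearby k of the set. There it agrees up
    to sign with the vector that k comes with, so Nq or - Nq has the right operator. *)
Lemma twist_level_compact : compact K2.
Proof.
apply: (relatively_closed_compact cS twist_level_sub) => q Sq lim.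
have Kq : K q.
  apply: (compact_limit (level_compact Sc cS Sp pmax)) => r /lim[k [Kk _] kq].
  by exists k.
have [tp qq] := level_round Kq.
have [|Nq] := twist_frame_exists Sc Sq tp; first by rewrite dotJJ sub0r dotNl dotNr opprK.
rewrite sub0r JN => tf; have [r r0 Hr] := level_twist_constant Kq tf.
have [k [Kk [N' tk LE]] kq] := lim r r0.
have Sk := level_sub Kk; have [_ kk] := level_round Kk.
have [_ [N'' tk' LE']] := Hr k Sk kq.
split=> //; have VV : dot (- J k) (- J k) = 2 by rewrite dotNl dotNr opprK dotJJ.
have [NE|NE] := twist_frame_sign Sc Sk (level_tangent_J Kk).2 VV tk tk'.
  by exists Nq => // x y; rewrite -LE' NE LE.
have [t1 t2 t3] := tf; exists (- Nq).
  split; rewrite ?dotNr ?t2 ?oppr0 ?dotNl ?opprK//.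
  by rewrite -scaleN1r; exact: (tangentZ Sc).
by move=> x y; rewrite LformN -LE' NE LformN opprK LE.
Qed.

(** Applied to q itself, the operator built from V = - J q and N' returns J N'; as this operator is
    L0, N' = - J (L0 q). *)
Lemma twist_levelP q : K2 q -> tangent S q (rotation_field p N q) /\
  dot (J q) (rotation_field p N q) = 0.
Proof.
move=> [Kq [N' [tN' JqN' N'N'] LE]]; have [tp qq] := level_round Kq.
have Sq := level_sub Kq; have [tJ _] := level_tangent_J Kq.
rewrite dotNl in JqN'; have {}JqN' : dot (J q) N' = 0 by apply/eqP; rewrite -oppr_eq0 JqN'.
have qN' : dot N' q = 0 by case: tp => _ /(_ _ tN'); rewrite subr0 dotC.
suff -> : rotation_field p N q = N' by split.
have JN'q : dot (J N') q = 0 by rewrite dotC dotJr JqN' oppr0.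
suff JE' : J N' = - (2^-1 *: (dot (J p) q *: N + dot N q *: J p - dot p q *: J N - dot (J N) q *: p)).
  have -> : N' = - J (J N') by rewrite JJ opprK.
  rewrite JE' JN !JZ !JB !JD !JZ !JJ /rotation_field.
  apply/rowP => i; rewrite !mxE; move: (J p 0 i) (J N 0 i) => *; ring.
apply: dot_inj => y; have := LE q y.
rewrite /Lform !JN !JJ !opprK !dotNl dotJu qq qN' JN'q => h.
transitivity ((- 0 * dot N' y + 0 * - dot (J q) y + 2 * dot (J N') y + 0 * dot q y) / 2).
  by field.
rewrite h !dotE; ring.
Qed.

Lemma twist_level_strong_tangent q v : K2 q -> tangent S q v -> strong_tangent K2 q v.
Proof.
move=> Kq tv; have [r r0 Hr] := twist_level_open Kq.
apply: (strong_tangent_open_subset r0 Hr).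
exact: (tangent_strong Sc (twist_level_sub Kq) tv).
Qed.

Lemma twist_level_start : K2 p.
Proof.
split; first exact: level_farthest.
by exists N => //; split=> //; rewrite dotNl JpN oppr0.
Qed.

Lemma twist_level_arc (t : R) : 0 <= t -> K2 (cos t *: p + sin t *: N).
Proof.
move=> t0; have [L L0 HL] := rotation_field_norm p N.
pose g (s : R) := cos s *: p + sin s *: N.
pose dg (s : R) := - sin s *: p + cos s *: N.
have dgP (s : R) : 0 <= s -> s <= t -> is_derive s (1 : R) g (dg s).
  by move=> _ _; exact: (is_derive_comb p N (is_derive_cos s) (is_derive_sin s)).
have dgE s : dg s = rotation_field p N (g s) by rewrite /g rotation_field_arc.
have Kg0 : K2 (g 0) by rewrite /g cos0 sin0 scale1r scale0r addr0; exact: twist_level_start.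
have Hv (s : R) q : 0 <= s -> s <= t -> K2 q ->
    exists2 v, strong_tangent K2 q v & `|dg s - v| <= L * `|g s - q|.
  move=> _ _ Kq; exists (rotation_field p N q).
    exact: (twist_level_strong_tangent Kq (twist_levelP Kq).1).
  by rewrite dgE -rotation_fieldB.
clearbody dg; exact (nagumo_invariance twist_level_compact t0 L0 dgP Kg0 Hv).
Qed.

Lemma twist_level_rotate (t : R) y : 0 <= t -> K2 y -> K2 (cos t *: y + sin t *: J y).
Proof.
move=> t0 Ky.
pose g (s : R) := cos s *: y + sin s *: J y.
pose dg (s : R) := - sin s *: y + cos s *: J y.
have dgP (s : R) : 0 <= s -> s <= t -> is_derive s (1 : R) g (dg s).
  by move=> _ _; exact: (is_derive_comb y (J y) (is_derive_cos s) (is_derive_sin s)).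
have dgE s : dg s = J (g s) by rewrite /dg /g JD !JZ JJ scalerN scaleNr addrC.
have Kg0 : K2 (g 0) by rewrite /g cos0 sin0 scale1r scale0r addr0.
have Hv (s : R) q : 0 <= s -> s <= t -> K2 q ->
    exists2 v, strong_tangent K2 q v & `|dg s - v| <= 1 * `|g s - q|.
  move=> _ _ Kq; exists (J q).
    exact: (twist_level_strong_tangent Kq (level_tangent_J Kq.1).1).
  by rewrite dgE -JB mul1r; exact: norm_J_le.
clearbody dg; exact (nagumo_invariance twist_level_compact t0 ler01 dgP Kg0 Hv).
Qed.

(** The quadratic equation of the torus is <J q, N'> = 0 with N' written as [rotation_field].
    Conversely each torus point is reached from p by an arc of that field followed by a rotation
    e^{i a}. *)
Lemma twist_level_torus : K2 = torus p N.
Proof.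
apply/seteqP; split=> q.
  move=> Kq; have [_ qq] := level_round Kq.1; have [_ b] := twist_levelP Kq.
  split=> //; move: b.
  rewrite /rotation_field !dotE !dotJJ !(dotJ q) !(dotC q) => h.
  apply/eqP; rewrite -subr_eq0; apply/eqP; rewrite -oppr0 -h.
  by field.
move=> Tq; have [a [b [a0 b0 ->]]] := torus_param pp NN pN JpN Tq.
by apply: twist_level_rotate => //; exact: twist_level_arc.
Qed.

End RoundCase.

(** * Rigidity *)

Section Clifford.
Variable R : realType.
Notation V4 := 'rV[R]_4.

Definition unitary_pair (p N : V4) :=
  [/\ dot p p = 2, dot N N = 2, dot p N = 0 & dot (J p) N = 0].

(** Stated for an arbitrary compact charted set, so that it can be applied a second time to what the
    first torus leaves of S. *)
Lemma contains_torus (S : set V4) : S !=set0 -> compact S -> locally_charted S ->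
  exists p N, [/\ unitary_pair p N, torus p N `<=` S, compact (torus p N) &
    forall q, torus p N q -> exists2 r : R, 0 < r &
      forall k, S k -> `|k - q| < r -> torus p N k].
Proof.
move=> S0 cS Sc.
have cd : {within S, continuous (fun x : V4 => dot x x)}.
  apply: continuous_subspaceT; exact: dot_sqr_continuous.
have [p /set_mem Sp pm] := EVT_max_rV S0 cS cd.
have pmax q : S q -> dot q q <= dot p p by move=> Sq; apply: pm; exact: mem_set.
have p0 := farthest_neq0 Sc Sp pmax.
have tp := farthest_tangent_part Sc Sp pmax.
have [|N [tN JpN NN]] := frame_exists Sc Sp tp; first by rewrite eq_sym.
rewrite sub0r JN dotNl in JpN; rewrite subr0 in NN.
have {}JpN : dot (J p) N = 0 by apply/eqP; rewrite -oppr_eq0 JpN.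
have pp := farthest_sqr_eq2 Sc cS Sp pmax tN JpN NN.
have NN2 : dot N N = 2 by rewrite NN.
have TE := twist_level_torus Sc cS Sp pmax pp tN JpN NN2.
exists p, N; split; first by split=> //; exact: (farthest_normal Sc Sp pmax tN).
- by rewrite -TE; exact: twist_level_sub.
- by rewrite -TE; exact: (twist_level_compact Sc cS Sp pmax pp).
- by rewrite -TE; exact: (twist_level_open Sc Sp pmax pp).
Qed.

(** The expression is cos (2 t) A + sin (2 t) B / 2, which vanishes when (cos (2 t), sin (2 t)) is
    proportional to (- B, 2 A). *)
Lemma traceless_form_zero (A B : R) : exists t : R,
  (cos t ^+ 2 - sin t ^+ 2) * A + cos t * sin t * B = 0.
Proof.
pose n := (2 * A) ^+ 2 + B ^+ 2.
have [n0|n0] := eqVneq n 0.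
  move/eqP: n0; rewrite paddr_eq0 ?sqr_ge0// !sqrf_eq0 => /andP[/eqP A0 /eqP ->].
  by exists 0; rewrite (_ : A = 0) ?mulr0 ?addr0//; lra.
have np : 0 < n by rewrite lt0r n0 addr_ge0 ?sqr_ge0.
have r0 : Num.sqrt n != 0 by rewrite gt_eqF// sqrtr_gt0.
have [|t [_ ct st]] := @polar_angle R (- B / Num.sqrt n) (2 * A / Num.sqrt n).
  by rewrite !expr_div_n sqrrN -mulrDl addrC sqr_sqrtr ?(ltW np)// divff.
exists (t / 2); rewrite [t]splitr cosD sinD in ct st.
have -> : (cos (t / 2) ^+ 2 - sin (t / 2) ^+ 2) * A + cos (t / 2) * sin (t / 2) * B =
  (cos (t / 2) * cos (t / 2) - sin (t / 2) * sin (t / 2)) * A +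
  (sin (t / 2) * cos (t / 2) + cos (t / 2) * sin (t / 2)) * (B / 2) by field.
by rewrite ct st; field.
Qed.

(* The quadratic form cutting out the first torus is J-invariant with trace 0, so
   it has a zero on the geodesic through p2 and N2. *)
Lemma tori_meet (p1 N1 p2 N2 : V4) : unitary_pair p1 N1 -> unitary_pair p2 N2 ->
  exists x, torus p1 N1 x /\ torus p2 N2 x.
Proof.
move=> [_ _ pN1 JpN1] [pp NN pN JpN].
have n2 : (2 : R) != 0 by rewrite pnatr_eq0.
have Np : dot N2 p2 = 0 by rewrite dotC.
have pJN : dot p2 (J N2) = 0 by rewrite dotJr JpN oppr0.
have JNp : dot (J N2) p2 = 0 by rewrite dotC.
(* Expanding <p1, J N1> = 0 in the basis of the second torus gives A + D = 0, where A and D are the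
   values at p2 and N2 of the form cutting out the first torus; its values at J p2 and J N2 repeat
   them. *)
have E1 := unitary_dot n2 pp NN pN pJN p1 (J N1).
have E2 := unitary_dot n2 pp NN pN pJN (J p1) N1.
rewrite dotJr JpN1 oppr0 in E1; rewrite JpN1 in E2.
rewrite !dotJJ !(dotJr p1) in E1.
rewrite !dotJJ !(dotJr N1) in E2.
pose A := dot p1 p2 * dot (J N1) p2 - dot (J p1) p2 * dot N1 p2.
pose D := dot p1 N2 * dot (J N1) N2 - dot (J p1) N2 * dot N1 N2.
pose B := dot p1 p2 * dot (J N1) N2 + dot p1 N2 * dot (J N1) p2 -
  dot (J p1) p2 * dot N1 N2 - dot (J p1) N2 * dot N1 p2.
have AD : D = - A.
  by rewrite /A /D; lra.
have [t Ht] := traceless_form_zero A B.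
exists (cos t *: p2 + sin t *: N2).
have xx : dot (cos t *: p2 + sin t *: N2) (cos t *: p2 + sin t *: N2) = 2.
  rewrite !dotE pp NN pN Np !mulr0 addr0 add0r -[RHS]mul1r -(cos2Dsin2 t); ring.
split; split=> //.
  rewrite !dotE; apply/eqP; rewrite -subr_eq0; apply/eqP; rewrite -Ht.
  transitivity (cos t ^+ 2 * A + sin t ^+ 2 * D + cos t * sin t * B).
    by rewrite /A /D /B; ring.
  by rewrite AD; ring.
by rewrite !dotE !dotJu JNp JpN; ring.
Qed.

Lemma charted_torus (S : set V4) : S !=set0 -> compact S -> locally_charted S ->
  exists p N, unitary_pair p N /\ S = torus p N.
Proof.
move=> S0 cS Sc; have [p [N [pN TS cT oT]]] := contains_torus S0 cS Sc.
exists p, N; split=> //; apply/seteqP; split=> // q Sq; apply: contrapT => nTq.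
pose S' := [set x | S x /\ ~ torus p N x].
have S'S : S' `<=` S by move=> x [].
(* A torus is nonempty since it meets itself. *)
have T0 : torus p N !=set0 by have [x [Tx _]] := tori_meet pN pN; exists x.
have cS' : compact S'.
  apply: (relatively_closed_compact cS S'S) => x Sx lim; split=> // Tx.
  have [r r0 Hr] := oT x Tx; have [k [Sk nTk] kx] := lim r r0.
  by apply: nTk; exact: Hr.
have Sc' : locally_charted S'.
  apply: (locally_charted_open_subset Sc S'S) => x [Sx nTx].
  have [m m0 Hm] := compact_dist_gt0 cT nTx T0; exists m => // k Sk kx.
  by split=> // Tk; have := Hm k Tk; rewrite distrC leNgt kx.
have S'0 : S' !=set0 by exists q.
have [p' [N' [pN' TS' _ _]]] := contains_torus S'0 cS' Sc'.
have [x [Tx /TS'[_]]] := tori_meet pN pN'.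
exact.
Qed.

(** F and G are unit vectors on the lines of p + J N and p - J N. In the coordinates F, J F, G, J G
    the equation |x|^2 = 2 is the sum of the two circle equations and the quadratic equation is
    their difference. *)
Lemma torus_clifford (p N : V4) : unitary_pair p N ->
  exists A : 'M[R]_4, A *m A^T = 1%:M /\
    torus p N = [set x *m A | x in @clifford_torus R].
Proof.
move=> [pp NN pN JpN]; have n2 : (2 : R) != 0 by rewrite pnatr_eq0.
have Np : dot N p = 0 by rewrite dotC.
have pJN : dot p (J N) = 0 by rewrite dotJr JpN oppr0.
have JNp : dot (J N) p = 0 by rewrite dotC.
pose F := 2^-1 *: (p + J N); pose G := 2^-1 *: (p - J N).
have JF : J F = 2^-1 *: (J p - N) by rewrite JZ JD JJ.
have JG : J G = 2^-1 *: (J p + N) by rewrite JZ JB JJ opprK.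
pose f (i : 'I_4) := nth 0 [:: F; J F; G; J G] i.
pose A : 'M[R]_4 := \matrix_i f i.
have FF : dot F F = 1.
  by rewrite /F !dotE !dotJJ pp NN pJN JNp; field.
have GG : dot G G = 1.
  by rewrite /G !dotE !dotJJ pp NN pJN JNp; field.
have FG : dot F G = 0.
  by rewrite /G !dotE !dotJJ pp NN pJN JNp; field.
have JFG : dot (J F) G = 0.
  by rewrite JF /G !dotE !dotJJ dotJu dotuJ pN Np; field.
have GF : dot G F = 0 by rewrite dotC.
have GJF : dot G (J F) = 0 by rewrite dotC.
have FJG : dot F (J G) = 0 by rewrite dotJr JFG oppr0.
have JGF : dot (J G) F = 0 by rewrite dotC.
have AA : A *m A^T = 1%:M.
  apply/matrixP => i j; rewrite !mxE.
  transitivity (dot (f i) (f j)); first by apply: eq_bigr => k _; rewrite !mxE.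
  rewrite /f; case: i => -[|[|[|[|?]]]] //= ?; case: j => -[|[|[|[|?]]]] //= ?;
  by rewrite ?dotJJ ?dotuJ ?dotJu ?FF ?GG ?FG ?GF ?JFG ?GJF ?FJG ?JGF.
have coef y (i : 'I_4) : (y *m A^T) 0 i = dot y (f i).
  by rewrite !mxE; apply: eq_bigr => k _; rewrite !mxE.
have tcl y : torus p N y <-> @clifford_torus R (y *m A^T).
  rewrite /clifford_torus /= !coef /f !inordK//= JF JG /F /G !dotE.
  have := unitary_dot n2 pp NN pN pJN y y.
  rewrite /torus /= (dotC p) (dotC (J N)) (dotC (J p)) (dotC N).
  move: (dot y y) (dot y p) (dot y N) (dot y (J p)) (dot y (J N)) => s a b c d.
  move=> sE; split=> [[s2 Q]|[h1 h2]].
    have {}Q : a * d = c * b by [].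
    split; nra.
  split; nra.
exists A; split=> //; apply/seteqP; split=> [y Ty|_ [x Cx <-]].
  exists (y *m A^T); first exact/tcl.
  by rewrite -mulmxA (mulmx1C AA) mulmx1.
by apply/tcl; rewrite -mulmxA AA mulmx1.
Qed.

End Clifford.

Unset Implicit Arguments.

Theorem theorem1p6 (R : realType) (S : set 'rV[R]_4) :
  S !=set0 ->
  compact S ->
  embedded_surface S ->
  self_shrinker S ->
  lagrangian S ->
  hamiltonian_stationary S ->
  exists A : 'M[R]_4,
    A *m A^T = 1%:M /\ S = [set x *m A | x in @clifford_torus R].
Proof.
move=> S0 cS emb shr lag ham.
have Sc : locally_charted S.
  move=> q Sq; have [U [X [lp [a Ua Xa]]]] := emb q Sq.
  have [dX [ddX cd]] := local_param_chart_data shr lag ham lp.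
  by exists U, X, dX, ddX, a.
have [p [N [pN ->]]] := charted_torus S0 cS Sc.
exact: torus_clifford.
Qed.
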